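(* Let $g$ be the slice Riemannian metric on $\mathbb{B}$ and let $I^+(\mathbb{B},g)$ denote the group of orientation preserving isometries of $(\mathbb{B},g)$. The formula \[ (u,\epsilon,H(t))\cdot q=\epsilon\, u\,(1+\tanh(t)q)^{-1}(q+\tanh(t))\,\overline{u},\qquad q\in\mathbb{B}, \] where $u\in\mathrm{Sp}(1)$, $\epsilon\in\mathbb{Z}_2=\{\pm1\}$, $t\in\mathbb{R}$, defines an action of the group $\mathrm{Sp}(1)\times(\mathbb{Z}_2\ltimes \mathrm{SO}_0(1,1))$ on $\mathbb{B}$, and the set of transformations of $\mathbb{B}$ given by this action is exactly $I^+(\mathbb{B},g)$. Furthermore, this group of transformations coincides with the group generated by all diffeomorphisms of $\mathbb{B}$ induced, via the identification $\Phi$, by left translations $L_A(X)=AX$ or right translations $R_A(X)=XA$ of $\mathrm{Sp}(1,1)$ ($A\in\mathrm{Sp}(1,1)$) that commute with the left $\mathrm{Sp}(1)\times\{1\}$-action and the right $\mathrm{Sp}(1)I_2$-action on $\mathrm{Sp}(1,1)$.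
   Context: $\mathbb{H}$ denotes the quaternions, $\mathbb{B}=\{q\in\mathbb{H}:|q|<1\}$, $\mathrm{Sp}(1)=\{u\in\mathbb{H}:|u|=1\}$. Let $I_{1,1}=\operatorname{diag}(1,-1)$ and $\mathrm{Sp}(1,1)=\{A\in M_2(\mathbb{H}):A^*I_{1,1}A=I_{1,1}\}$, where $A^*$ is the conjugate transpose. For $t\in\mathbb{R}$, $H(t)=\begin{pmatrix}\cosh t&\sinh t\\ \sinh t&\cosh t\end{pmatrix}$, and $\mathrm{SO}_0(1,1)=\{H(t):t\in\mathbb{R}\}$. The group $\mathbb{Z}_2\ltimes\mathrm{SO}_0(1,1)$ is the set $\{\pm1\}\times\mathrm{SO}_0(1,1)$ with product $(\epsilon_1,H(t_1))\star(\epsilon_2,H(t_2))=(\epsilon_1\epsilon_2,H(\epsilon_2t_1+t_2))$. Slice Riemannian metric: for $q\in\mathbb{B}$ and tangent vectors $\alpha,\beta\in T_q\mathbb{B}=\mathbb{H}$, \[ g_q(\alpha,\beta)=\frac{\operatorname{Re}\big((\alpha-q\alpha q)\overline{(\beta-q\beta q)}\big)}{|1-q^2|^2(1-|q|^2)^2}. \] Slice regular functions and regular Möbius transformations: the slice regular functions on $\mathbb{B}$ are exactly the functions $f(q)=\sum_{n\ge0}q^na_n$ ($a_n\in\mathbb{H}$) with the series converging on $\mathbb{B}$. The $*$-product is $(\sum q^na_n)*(\sum q^nb_n)=\sum_n q^n\sum_{k=0}^n a_kb_{n-k}$; $f^c(q)=\sum q^n\overline{a_n}$, $f^s=f*f^c$,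 and $f^{-*}=(f^s)^{-1}f^c$ (pointwise product, off the zero set of $f^s$). For $a,b\in\mathbb{H}$ let $\ell_{a,b}(q)=qa+b$. For $A=\begin{pmatrix}a&c\\ b&d\end{pmatrix}\in\mathrm{Sp}(1,1)$ the regular Möbius transformation is $\mathcal{F}_A=\ell_{c,d}^{-*}*\ell_{a,b}$, which is a diffeomorphism of $\mathbb{B}$ onto $\mathbb{B}$. Identification $\Phi$: the subgroup $\mathrm{Sp}(1)\times\{1\}=\{\operatorname{diag}(u,1):u\in\mathrm{Sp}(1)\}$ acts on $\mathrm{Sp}(1,1)$ by left multiplication and $\mathrm{Sp}(1)I_2=\{uI_2:u\in\mathrm{Sp}(1)\}$ acts by right multiplication. It is known that $\Phi:(\mathrm{Sp}(1)\times\{1\})\backslash\mathrm{Sp}(1,1)/\mathrm{Sp}(1)I_2\to\mathbb{B}$, $[A]\mapsto(\mathcal{F}_{A^{-1}})^{-1}(0)$, is a well-defined diffeomorphism. A diffeomorphism $\widetilde f$ of $\mathrm{Sp}(1,1)$ commuting with both actions induces the diffeomorphism $f$ of $\mathbb{B}$ determined by $f(\Phi([X]))=\Phi([\widetilde f(X)])$. *)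

(* Defs.v *)
(* Quaternions H are modelled as real row
   vectors 'rV[R]_4 (coordinates 1, i, j, k), which carries the normed-space
   structure needed for directional derivatives. *)
From HB Require Import structures.
From mathcomp Require Import all_boot all_order all_algebra.
From mathcomp Require Import all_classical all_reals all_analysis.
From Stdlib Require Import ClassicalEpsilon.
Set Implicit Arguments. Unset Strict Implicit. Unset Printing Implicit Defensive.
Import Order.TTheory GRing.Theory Num.Theory.
Import numFieldNormedType.Exports.
Local Open Scope ring_scope.
Local Open Scope classical_set_scope.

Section Quaternions.
Variable R : realType.

Definition quat := 'rV[R]_4.

Definition qc (x : quat) (i : nat) : R := x ord0 (inord i).
Definition mkq (a b c d : R) : quat :=
  \row_(i < 4) (match val i with 0 => a | 1 => b | 2 => c | _ => d end).

Definition qone : quat := mkq 1 0 0 0.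
Definition qreal (r : R) : quat := r *: qone.

Definition qmul (x y : quat) : quat :=
  let a1 := qc x 0 in let b1 := qc x 1 in let c1 := qc x 2 in let d1 := qc x 3 in
  let a2 := qc y 0 in let b2 := qc y 1 in let c2 := qc y 2 in let d2 := qc y 3 in
  mkq (a1*a2 - b1*b2 - c1*c2 - d1*d2)
      (a1*b2 + b1*a2 + c1*d2 - d1*c2)
      (a1*c2 - b1*d2 + c1*a2 + d1*b2)
      (a1*d2 + b1*c2 - c1*b2 + d1*a2).

Definition qconj (x : quat) : quat := mkq (qc x 0) (- qc x 1) (- qc x 2) (- qc x 3).
Definition qre (x : quat) : R := qc x 0.
Definition qnorm2 (x : quat) : R := qc x 0 ^+ 2 + qc x 1 ^+ 2 + qc x 2 ^+ 2 + qc x 3 ^+ 2.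
Definition qinv (x : quat) : quat := (qnorm2 x)^-1 *: qconj x.
Definition qpow (x : quat) (n : nat) : quat := iter n (qmul x) qone.

Definition inB (q : quat) : Prop := qnorm2 q < 1.
Definition inSp1 (u : quat) : Prop := qnorm2 u = 1.

Definition slice_metric (q a b : quat) : R :=
  qre (qmul (a - qmul (qmul q a) q) (qconj (b - qmul (qmul q b) q))) /
  (qnorm2 (qone - qmul q q) * (1 - qnorm2 q) ^+ 2).

Fixpoint iterD (vs : seq quat) (f : quat -> quat) : quat -> quat :=
  match vs with
  | [::] => f
  | v :: vs' => fun x => 'D_v (iterD vs' f) x
  end.

Definition smooth_on_B (f : quat -> quat) : Prop :=
  forall (vs : seq quat) (q : quat), inB q ->
    {for q, continuous (iterD vs f)} /\ forall v, derivable (iterD vs f) q v.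

Definition diffeo_B (f : quat -> quat) : Prop :=
  (forall q, inB q -> inB (f q)) /\ smooth_on_B f /\
  exists h : quat -> quat,
    (forall q, inB q -> inB (h q)) /\ smooth_on_B h /\
    (forall q, inB q -> h (f q) = q /\ f (h q) = q).

Definition ebasis (j : 'I_4) : quat := delta_mx ord0 j.
Definition jacobian (f : quat -> quat) (q : quat) : 'M[R]_4 :=
  \matrix_(i < 4, j < 4) ('D_(ebasis j) f q) ord0 i.

Definition isometry_B (f : quat -> quat) : Prop :=
  diffeo_B f /\
  forall q a b, inB q ->
    slice_metric (f q) ('D_a f q) ('D_b f q) = slice_metric q a b.

Definition orient_pres_isometry_B (f : quat -> quat) : Prop :=
  isometry_B f /\ forall q, inB q -> 0 < \det (jacobian f q).

Definition tanh (t : R) : R := (expR t - expR (- t)) / (expR t + expR (- t)).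

Definition act (u : quat) (eps t : R) (q : quat) : quat :=
  eps *: qmul (qmul (qmul u (qinv (qone + tanh t *: q))) (q + qreal (tanh t)))
              (qconj u).

Definition is_sign (eps : R) : Prop := eps = 1 \/ eps = -1.

Definition action_transformation (f : quat -> quat) : Prop :=
  exists u eps t, inSp1 u /\ is_sign eps /\ forall q, inB q -> f q = act u eps t q.

Definition pseries (a : nat -> quat) (q : quat) : nat -> quat :=
  series (fun n => qmul (qpow q n) (a n)).

Definition sr_eval (a : nat -> quat) (q : quat) : quat := lim (pseries a q @ \oo).

Definition sr_coeffs (f : quat -> quat) : nat -> quat :=
  epsilon (inhabits (fun _ => 0))
    (fun a => forall q, inB q -> pseries a q @ \oo --> f q).

Definition star_coef (a b : nat -> quat) (n : nat) : quat :=
  \sum_(k < n.+1) qmul (a k) (b (n - k)%N).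
Definition sr_star (f g : quat -> quat) : quat -> quat :=
  sr_eval (star_coef (sr_coeffs f) (sr_coeffs g)).
Definition sr_c (f : quat -> quat) : quat -> quat :=
  sr_eval (fun n => qconj (sr_coeffs f n)).
Definition sr_s (f : quat -> quat) : quat -> quat := sr_star f (sr_c f).
Definition sr_invstar (f : quat -> quat) : quat -> quat :=
  fun q => qmul (qinv (sr_s f q)) (sr_c f q).

Definition ell (a b : quat) : quat -> quat := fun q => qmul q a + b.

Record qmat := QM { m11 : quat; m12 : quat; m21 : quat; m22 : quat }.

Definition qmmul (A B : qmat) : qmat :=
  QM (qmul (m11 A) (m11 B) + qmul (m12 A) (m21 B))
     (qmul (m11 A) (m12 B) + qmul (m12 A) (m22 B))
     (qmul (m21 A) (m11 B) + qmul (m22 A) (m21 B))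
     (qmul (m21 A) (m12 B) + qmul (m22 A) (m22 B)).
Definition qmadj (A : qmat) : qmat :=
  QM (qconj (m11 A)) (qconj (m21 A)) (qconj (m12 A)) (qconj (m22 A)).
Definition qm1 : qmat := QM qone 0 0 qone.
Definition I11 : qmat := QM qone 0 0 (- qone).

Definition inSp11 (A : qmat) : Prop := qmmul (qmmul (qmadj A) I11) A = I11.

Definition mobius (A : qmat) : quat -> quat :=
  sr_star (sr_invstar (ell (m12 A) (m22 A))) (ell (m11 A) (m21 A)).

(* Phi([X]) = p  iff  p = (F_{X^{-1}})^{-1}(0) *)
Definition Phi_rel (X : qmat) (p : quat) : Prop :=
  inB p /\ forall Y, qmmul Y X = qm1 -> mobius Y p = 0.

Definition diagu1 (u : quat) : qmat := QM u 0 0 qone.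
Definition scalu (u : quat) : qmat := QM u 0 0 u.

Definition commutes_actions (ft : qmat -> qmat) : Prop :=
  forall u X, inSp1 u -> inSp11 X ->
    ft (qmmul (diagu1 u) X) = qmmul (diagu1 u) (ft X) /\
    ft (qmmul X (scalu u)) = qmmul (ft X) (scalu u).

Definition induced_by (ft : qmat -> qmat) (f : quat -> quat) : Prop :=
  forall X p, inSp11 X -> Phi_rel X p -> Phi_rel (ft X) (f p).

Definition translation_generator (f : quat -> quat) : Prop :=
  exists A, inSp11 A /\
    ((commutes_actions (qmmul A) /\ induced_by (qmmul A) f) \/
     (commutes_actions (fun X => qmmul X A) /\ induced_by (fun X => qmmul X A) f)).

(* the group (of transformations of B) generated by a set S of bijections of B;
   maps are identified when they agree on B *)
Inductive generated (S : (quat -> quat) -> Prop) : (quat -> quat) -> Prop :=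
| gen_id f : (forall q, inB q -> f q = q) -> generated S f
| gen_mul s g f : S s -> generated S g ->
    (forall q, inB q -> f q = s (g q)) -> generated S f
| gen_mulinv s s' g f : S s ->
    (forall q, inB q -> inB (s' q) /\ s (s' q) = q /\ s' (s q) = q) ->
    generated S g -> (forall q, inB q -> f q = s' (g q)) -> generated S f.

End Quaternions.

(* Main.v *)
Require Import Defs.
From mathcomp Require Import all_boot all_order all_algebra.
From mathcomp Require Import all_classical all_reals all_analysis.
From mathcomp Require Import ring lra.
Set Implicit Arguments. Unset Strict Implicit. Unset Printing Implicit Defensive.
Import Order.TTheory GRing.Theory Num.Theory.
Import numFieldNormedType.Exports.
Local Open Scope ring_scope.

(** Write [s q] for the signed position on the real axis of the foot of the
    perpendicular from [q], and [r q] for the distance from [q] to the axis.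
    Both [s] and [r] are 1-Lipschitz, and the infinitesimal inequality
    [(1 + sinh(2r)^2) ds^2 + dr^2 <= g] shows that only curves on the axis
    realise [ds^2 = g].

    If [f] is an isometry with inverse [h] and [k] is conjugation by i or j, then
    [h o k o f] is an involution moving points by a bounded distance; such an
    isometry fixes the axis pointwise, so [k] fixes [f(axis)] and [f] preserves
    the axis. After composing with an element of the group, [f] fixes the axis
    pointwise, hence preserves [r] and [s], that is, the real part and the
    modulus of [q]. The metric then shows that [df] is Euclidean-orthogonal, so
    [f] is the restriction of a linear isometry fixing 1, and orientation makes
    it a conjugation by a unit quaternion.

    For the last statement, [Phi [X] = p] amounts to [p x22 = x21]; the commuting
    left translations are those by [diag(+-1, d)], the commuting right
    translations those by real matrices of Sp(1,1). *)

(** With [theta] the direction of the imaginary part, a point of the unit 2-sphere, the metric reads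
    [cosh(2r)^2 ds^2 + dr^2 + tanh(2r)^2 dtheta^2 / 4]. The last coefficient is bounded, so
    rotations about the axis move all points by a bounded distance, however far out they are; this
    metric property singles out the axis. Neither geodesics nor a Riemannian distance occur:
    distances are estimated by following [s] and [r] along curves of speed at most 1, which
    isometries preserve by the chain rule. The chain rule needs total differentiability, while
    [smooth_on_B] speaks of directional derivatives, hence the detour through continuous partial
    derivatives. As [r] is not smooth on the axis, [axis_gap] stands in for it. Pointwise
    orthogonality of [df] becomes linearity because the ball is convex: [f] and its inverse both
    contract chords. For [Phi], the coefficients of a slice regular function are picked by
    [epsilon], so uniqueness of power series coefficients must precede any computation. *)

Section QuaternionAlgebra.
Variable R : realType.
Implicit Types (x y z : quat R) (r : R).

Lemma qc_mkq0 a b c d : qc (mkq a b c d : quat R) 0 = a.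
Proof. by rewrite /qc /mkq mxE /= inordK. Qed.
Lemma qc_mkq1 a b c d : qc (mkq a b c d : quat R) 1 = b.
Proof. by rewrite /qc /mkq mxE /= inordK. Qed.
Lemma qc_mkq2 a b c d : qc (mkq a b c d : quat R) 2 = c.
Proof. by rewrite /qc /mkq mxE /= inordK. Qed.
Lemma qc_mkq3 a b c d : qc (mkq a b c d : quat R) 3 = d.
Proof. by rewrite /qc /mkq mxE /= inordK. Qed.
Lemma qcD x y i : qc (x + y) i = qc x i + qc y i.
Proof. by rewrite /qc mxE. Qed.
Lemma qcN x i : qc (- x) i = - qc x i.
Proof. by rewrite /qc mxE. Qed.
Lemma qcZ r x i : qc (r *: x) i = r * qc x i.
Proof. by rewrite /qc mxE. Qed.
Lemma qc0 i : qc (0 : quat R) i = 0.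
Proof. by rewrite /qc mxE. Qed.

Definition qcE :=
  (qc_mkq0, qc_mkq1, qc_mkq2, qc_mkq3, qcD, qcN, qcZ, qc0).

Lemma quatP x y : qc x 0 = qc y 0 -> qc x 1 = qc y 1 ->
  qc x 2 = qc y 2 -> qc x 3 = qc y 3 -> x = y.
Proof.
move=> h0 h1 h2 h3; apply/rowP => i.
have hi : x ord0 i = qc x i /\ y ord0 i = qc y i by rewrite /qc inord_val.
rewrite !hi.1 !hi.2; case: i {hi} => -[|[|[|[|//]]]] ? //=.
Qed.

End QuaternionAlgebra.

Ltac qring := apply: quatP; rewrite /qmul /qreal /qconj /qone ?qcE; ring.

(** * Quaternion ring identities, norm and inverse *)

Section QuaternionRing.
Variable R : realType.
Implicit Types (x y z a b p q u v : quat R) (r : R).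
Local Notation "x ** y" := (qmul x y) (at level 40, left associativity).
Local Notation "1q" := (qone R).
Local Notation N2 := (@qnorm2 R).

Lemma qmulA x y z : x ** (y ** z) = x ** y ** z. Proof. by qring. Qed.
Lemma qmulDl x y z : (x + y) ** z = x ** z + y ** z. Proof. by qring. Qed.
Lemma qmulDr x y z : x ** (y + z) = x ** y + x ** z. Proof. by qring. Qed.
Lemma qmulNl x y : (- x) ** y = - (x ** y). Proof. by qring. Qed.
Lemma qmulNr x y : x ** (- y) = - (x ** y). Proof. by qring. Qed.
Lemma qmulBl x y z : (x - y) ** z = x ** z - y ** z. Proof. by qring. Qed.
Lemma qmulBr x y z : x ** (y - z) = x ** y - x ** z. Proof. by qring. Qed.
Lemma qmulZl r x y : (r *: x) ** y = r *: (x ** y). Proof. by qring. Qed.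
Lemma qmulZr r x y : x ** (r *: y) = r *: (x ** y). Proof. by qring. Qed.
Lemma qmul1l x : 1q ** x = x. Proof. by qring. Qed.
Lemma qmul1r x : x ** 1q = x. Proof. by qring. Qed.
Lemma qmul0l x : 0 ** x = 0. Proof. by qring. Qed.
Lemma qmul0r x : x ** 0 = 0. Proof. by qring. Qed.
Lemma qrealE r x : qreal r ** x = r *: x. Proof. by qring. Qed.
Lemma qrealEr r x : x ** qreal r = r *: x. Proof. by qring. Qed.
Lemma qconjM x y : qconj (x ** y) = qconj y ** qconj x. Proof. by qring. Qed.
Lemma qconjD x y : qconj (x + y) = qconj x + qconj y. Proof. by qring. Qed.
Lemma qconjN x : qconj (- x) = - qconj x. Proof. by qring. Qed.
Lemma qconjZ r x : qconj (r *: x) = r *: qconj x. Proof. by qring. Qed.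
Lemma qconjK x : qconj (qconj x) = x. Proof. by qring. Qed.
Lemma qconj1 : qconj 1q = 1q. Proof. by qring. Qed.
Lemma qconj0 : qconj 0 = 0 :> quat R. Proof. by qring. Qed.
Lemma qmul_conjr x : x ** qconj x = N2 x *: 1q.
Proof. by rewrite /qnorm2; qring. Qed.
Lemma qmul_conjl x : qconj x ** x = N2 x *: 1q.
Proof. by rewrite /qnorm2; qring. Qed.

Lemma qnorm2M x y : N2 (x ** y) = N2 x * N2 y.
Proof. by rewrite /qnorm2 /qmul !qcE; ring. Qed.
Lemma qnorm2Z r x : N2 (r *: x) = r ^+ 2 * N2 x.
Proof. by rewrite /qnorm2 !qcE; ring. Qed.
Lemma qnorm2N x : N2 (- x) = N2 x.
Proof. by rewrite /qnorm2 !qcE; ring. Qed.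
Lemma qnorm2_conj x : N2 (qconj x) = N2 x.
Proof. by rewrite /qnorm2 /qconj !qcE; ring. Qed.
Lemma qnorm2_1 : N2 1q = 1.
Proof. by rewrite /qnorm2 /qone !qcE; ring. Qed.
Lemma qnorm2_0 : N2 0 = 0.
Proof. by rewrite /qnorm2 !qcE; ring. Qed.
Lemma qnorm2_ge0 x : 0 <= N2 x.
Proof. by rewrite /qnorm2 !addr_ge0 ?sqr_ge0. Qed.
Lemma qnorm2_eq0 x : (N2 x == 0) = (x == 0).
Proof.
apply/eqP/eqP => [|->]; last exact: qnorm2_0.
rewrite /qnorm2 => /eqP; rewrite !paddr_eq0 ?addr_ge0 ?sqr_ge0 // !sqrf_eq0.
by case/andP=> /andP[/andP[/eqP ? /eqP ?] /eqP ?] /eqP ?;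
  apply: quatP; rewrite qc0.
Qed.
Lemma qnorm2_gt0 x : (0 < N2 x) = (x != 0).
Proof. by rewrite lt0r qnorm2_eq0 qnorm2_ge0 andbT. Qed.

Lemma qmulVl x : x != 0 -> qinv x ** x = 1q.
Proof.
by move=> x0; rewrite /qinv qmulZl qmul_conjl scalerA mulVf ?qnorm2_eq0 ?scale1r.
Qed.
Lemma qmulVr x : x != 0 -> x ** qinv x = 1q.
Proof.
by move=> x0; rewrite /qinv qmulZr qmul_conjr scalerA mulVf ?qnorm2_eq0 ?scale1r.
Qed.
Lemma qnorm2V x : N2 (qinv x) = (N2 x)^-1.
Proof.
have [->|x0] := eqVneq x 0.
  by rewrite /qinv qnorm2_0 invr0 scale0r qnorm2_0.
rewrite /qinv qnorm2Z qnorm2_conj expr2 -mulrA mulVf ?mulr1 //.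
by rewrite qnorm2_eq0.
Qed.
Lemma qmul_eq0 x y : (x ** y == 0) = (x == 0) || (y == 0).
Proof. by rewrite -!qnorm2_eq0 qnorm2M mulf_eq0. Qed.
Lemma qmulI x y z : x != 0 -> x ** y = x ** z -> y = z.
Proof. by move=> x0 e; rewrite -(qmul1l y) -(qmulVl x0) -qmulA e qmulA qmulVl // qmul1l. Qed.
Lemma qmulIr x y z : x != 0 -> y ** x = z ** x -> y = z.
Proof. by move=> x0 e; rewrite -(qmul1r y) -(qmulVr x0) qmulA e -qmulA qmulVr // qmul1r. Qed.
Lemma qone_neq0 : 1q != 0.
Proof. by rewrite -qnorm2_eq0 qnorm2_1 oner_eq0. Qed.
Lemma qconj_eq0 x : (qconj x == 0) = (x == 0).
Proof. by rewrite -!qnorm2_eq0 qnorm2_conj. Qed.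
Lemma qinv_eq0 x : (qinv x == 0) = (x == 0).
Proof. by rewrite -!qnorm2_eq0 qnorm2V invr_eq0. Qed.

Lemma inSp1_mulr u : inSp1 u -> u ** qconj u = 1q.
Proof. by move=> h; rewrite qmul_conjr h scale1r. Qed.
Lemma inSp1_mull u : inSp1 u -> qconj u ** u = 1q.
Proof. by move=> h; rewrite qmul_conjl h scale1r. Qed.
Lemma inSp1_conj u : inSp1 u -> inSp1 (qconj u).
Proof. by rewrite /inSp1 qnorm2_conj. Qed.
Lemma inSp1_mul u v : inSp1 u -> inSp1 v -> inSp1 (u ** v).
Proof. by rewrite /inSp1 qnorm2M => -> ->; rewrite mulr1. Qed.
Lemma inSp1_1 : inSp1 1q. Proof. exact: qnorm2_1. Qed.

Lemma qre_qmul_conj x y : qre (x ** qconj y) =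
  qc x 0 * qc y 0 + qc x 1 * qc y 1 + qc x 2 * qc y 2 + qc x 3 * qc y 3.
Proof. by rewrite /qre /qmul /qconj !qcE; ring. Qed.
Lemma qnorm2E x : N2 x = qre (x ** qconj x).
Proof. by rewrite qre_qmul_conj /qnorm2; ring. Qed.
Lemma qre_mulC x y : qre (x ** y) = qre (y ** x).
Proof. by rewrite /qre /qmul !qcE; ring. Qed.
(** Left and right multiplications are Euclidean similarities: [b ** qconj b] is real, and the real
    part is invariant under cyclic permutation. *)
Lemma qre_conj_mul a b x y :
  qre ((a ** x ** b) ** qconj (a ** y ** b)) = N2 a * N2 b * qre (x ** qconj y).
Proof.
have -> : a ** x ** b ** qconj (a ** y ** b) = N2 b *: (a ** (x ** qconj y) ** qconj a).
  rewrite !qconjM -!qmulA (qmulA b) qmul_conjr qmulZl qmul1l !qmulZr.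
  by rewrite !qmulA.
rewrite /qre qcZ -/(qre _) -qmulA qre_mulC -qmulA qmul_conjl qmulZr qmul1r.
by rewrite /qre qcZ; ring.
Qed.

End QuaternionRing.

(** * Derivatives of quaternion-valued maps *)

Section QuaternionCalculus.
Variable R : realType.
Local Notation "x ** y" := (qmul x y) (at level 40, left associativity).
Local Notation N2 := (@qnorm2 R).

Section General.
Variable V : normedModType R.
Implicit Types (f g : V -> quat R) (x v : V).

Lemma is_derive_qc f x v df i :
  is_derive x v f df -> is_derive x v (fun y => qc (f y) i) (qc df i).
Proof.
move=> [fd <-]; apply: DeriveDef.
  exact: ((derivable_mxP _ _ _).1 fd).
by rewrite (derive_mx fd) /qc mxE.
Qed.

Lemma is_derive_quat f x v df :
  (forall i, (i < 4)%N -> is_derive x v (fun y => qc (f y) i) (qc df i)) ->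
  is_derive x v f df.
Proof.
move=> h.
have hi (j : 'I_4) : is_derive x v (fun y => f y ord0 j) (df ord0 j).
  by have := h _ (ltn_ord j); rewrite /qc inord_val.
have fd : derivable f x v.
  by apply/derivable_mxP => i j; rewrite (ord1 i); case: (hi j).
apply: DeriveDef => //; rewrite (derive_mx fd).
by apply/rowP => j; rewrite mxE; case: (hi j) => _ <-.
Qed.

Lemma qc_sum_ebasis (q : quat R) : q = \sum_(i < 4) qc q i *: ebasis R i.
Proof.
rewrite {1}(row_sum_delta q); apply: eq_bigr => i _.
by rewrite /qc inord_val.
Qed.

Lemma differentiable_qc f x i :
  differentiable f x -> differentiable (fun y => qc (f y) i) x.
Proof.
move=> fd.
apply: (@differentiable_comp _ _ _ _ f (fun q : quat R => qc q i)) => //.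
exact: differentiable_coord.
Qed.

Lemma differentiable_quat f x :
  (forall i, (i < 4)%N -> differentiable (fun y => qc (f y) i) x) ->
  differentiable f x.
Proof.
move=> h.
have -> : f = \sum_(i < 4) (fun y => qc (f y) i *: ebasis R i).
  by apply/funext => y; rewrite fct_sumE; exact: qc_sum_ebasis.
apply: differentiable_sum => i.
exact/(@differentiableZl _ _ _ (fun y => qc (f y) i))/h.
Qed.

Lemma differentiable_addf (h k : V -> R) x : differentiable h x ->
  differentiable k x -> differentiable (fun y => h y + k y) x.
Proof. exact: differentiableD. Qed.

Lemma differentiable_oppf (h : V -> R) x : differentiable h x ->
  differentiable (fun y => - h y) x.
Proof. exact: differentiableN. Qed.

Lemma differentiable_mulf (h k : V -> R) x : differentiable h x ->
  differentiable k x -> differentiable (fun y => h y * k y) x.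
Proof. exact: differentiableM. Qed.

Lemma differentiable_qmul f g x : differentiable f x -> differentiable g x ->
  differentiable (fun y => f y ** g y) x.
Proof.
move=> fd gd; have fi i := differentiable_qc i fd.
have gi i := differentiable_qc i gd.
apply: differentiable_quat => -[|[|[|[|//]]]] _; under eq_fun do rewrite qcE;
  repeat first [exact: fi | exact: gi | apply: differentiable_mulf
    | apply: differentiable_addf | apply: differentiable_oppf].
Qed.

Lemma differentiable_qinv f x : differentiable f x -> f x != 0 ->
  differentiable (fun y => qinv (f y)) x.
Proof.
move=> fd fx; have fi i := differentiable_qc i fd.
have nd : differentiable (fun y => (N2 (f y))^-1) x.
  apply: differentiableV; last by rewrite qnorm2_eq0.
  rewrite /qnorm2; under eq_fun do rewrite !expr2.
  by repeat first [exact: fi | apply: differentiable_mulf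
    | apply: differentiable_addf].
apply: differentiable_quat => -[|[|[|[|//]]]] _;
  under eq_fun do rewrite /qinv /qconj !qcE;
  by repeat first [exact: nd | exact: fi | apply: differentiable_mulf
    | apply: differentiable_oppf].
Qed.

Lemma is_derive_qmul f g x v df dg :
  is_derive x v f df -> is_derive x v g dg ->
  is_derive x v (fun y => f y ** g y) (df ** g x + f x ** dg).
Proof.
move=> fd gd; have fi i := is_derive_qc i fd; have gi i := is_derive_qc i gd.
by apply: is_derive_quat => -[|[|[|[|//]]]] _; under eq_fun do rewrite qcE;
  apply: is_derive_eq; rewrite /GRing.scale /= /qmul !qcE; ring.
Qed.

(** Once the inverse is known to be differentiable, its derivative is forced by differentiating
    [f ** qinv f = 1], which holds near [x]. *)
Lemma is_derive_qinv f x v df :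
  differentiable f x -> is_derive x v f df -> f x != 0 ->
  is_derive x v (fun y => qinv (f y)) (- (qinv (f x) ** df ** qinv (f x))).
Proof.
move=> fd fv fx.
have gd : derivable (fun y => qinv (f y)) x v.
  exact: diff_derivable (differentiable_qinv fd fx).
move/derivableP in gd.
set dg := 'D_v _ _ in gd.
have e := is_derive_qmul fv gd.
have fn : \forall y \near x, f y != 0.
  exact: cvgr_neq0 (differentiable_continuous fd) fx.
have e1 : is_derive x v (cst (qone R)) (df ** qinv (f x) + f x ** dg).
  apply: near_eq_is_derive e.
  by near=> y; rewrite qmulVr //; near: y.
have [_] := e1; rewrite derive_cst => /esym/eqP; rewrite addrC addr_eq0 => /eqP h.
have dgE : dg = - (qinv (f x) ** df ** qinv (f x)).
  by apply: (qmulI fx); rewrite h qmulNr !qmulA qmulVr // qmul1l.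
by rewrite -dgE.
Unshelve. all: by end_near. Qed.

End General.
End QuaternionCalculus.

(** * Continuous partial derivatives imply differentiability *)

Section ContinuouslyDifferentiable.
Variable R : realType.
Local Open Scope classical_set_scope.
Local Notation "x ** y" := (qmul x y) (at level 40, left associativity).
Local Notation N2 := (@qnorm2 R).

(** The endpoints come in either order, because coordinate increments have either sign. *)
Lemma mvt_dist_le (g g' : R -> R) (a b C : R) :
  (forall x, Num.min a b <= x <= Num.max a b ->
     is_derive x 1 g (g' x) /\ `|g' x| <= C) ->
  `|g b - g a| <= C * `|b - a|.
Proof.
wlog ab : a b / a <= b.
  move=> h; case/orP: (le_total a b) => ba; first exact: h.
  by rewrite (distrC (g b)) (distrC b) minC maxC; exact: h.
rewrite (min_idPl ab) (max_idPr ab) => h.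
have hd x : x \in `]a, b[%R -> is_derive x 1 g (g' x).
  rewrite in_itv /= => /andP[/ltW ax /ltW xb].
  by apply: (h x _).1; rewrite ax xb.
have gc : {within `[a, b], continuous g}.
  apply: derivable_within_continuous => x; rewrite in_itv /= => xab.
  by case: (h x xab) => -[].
have [c cab ->] := MVT_segment ab hd gc.
rewrite normrM ler_wpM2r //.
by apply: (h c _).2; move: cab; rewrite in_itv.
Qed.

Lemma is_derive_along (V W : normedModType R) (f : V -> W) z e (s : R) :
  derivable f (s *: e + z) e ->
  is_derive s 1 (fun t : R => f (t *: e + z)) ('D_e f (s *: e + z)).
Proof.
have E : (fun h : R => h^-1 *: (((fun t : R => f (t *: e + z)) \o shift s)
    (h *: (1 : R)) - f (s *: e + z))) =
  (fun h : R => h^-1 *: ((f \o shift (s *: e + z)) (h *: e) - f (s *: e + z))).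
  by apply/funext => h /=; rewrite addrA -scalerDl [h *: 1]mulr1.
by move=> fd; apply: DeriveDef; rewrite /derivable /derive E.
Qed.

Lemma differentiable_of_littleo (V W : normedModType R) (f : V -> W)
    (df : {linear V -> W}) x : continuous df ->
  f \o shift x = cst (f x) + df +o_ 0 id -> differentiable f x.
Proof.
by move=> c key; apply/diff_locallyP; rewrite (diff_unique c key); split.
Qed.

Section Partials.
Variable n : nat.
Implicit Types (q v w : 'rV[R]_n).

Lemma row_norm_le q (C : R) : 0 <= C -> (forall i, `|q ord0 i| <= C) -> `|q| <= C.
Proof.
move=> C0 h; rewrite [leLHS]/Num.Def.normr /= mx_normrE bigmax_le //=.
by move=> -[i j] _ /=; rewrite (ord1 i).
Qed.

Lemma row_norm_ge q i : `|q ord0 i| <= `|q|.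
Proof.
rewrite [leRHS]/Num.Def.normr /= mx_normrE.
exact: (le_bigmax _ (fun ij : 'I_1 * 'I_n => `|q ij.1 ij.2|) (ord0, i)).
Qed.

(** Vertices of the staircase from 0 to [q], along which one coordinate changes at a time. *)
Definition partial_vec q (k : nat) : 'rV[R]_n :=
  \row_j (if (j < k)%N then q ord0 j else 0).

Lemma partial_vecS q (i : 'I_n) :
  partial_vec q i.+1 = q ord0 i *: delta_mx ord0 i + partial_vec q i.
Proof.
apply/rowP => j; rewrite !mxE eqxx /= ltnS leq_eqVlt.
have [-> |ne] := eqVneq j i; first by rewrite eqxx ltnn mulr1 addr0.
by rewrite (inj_eq val_inj) (negbTE ne) /= mulr0 add0r.
Qed.

(** The increment is split along the staircase of [partial_vec]; on each step the mean value
    inequality is applied to a coordinate of [f] minus its expected linear part. *)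
Lemma differentiable_of_partials (f : 'rV[R]_n -> 'rV[R]_n) q :
  (\forall p \near q, forall i : 'I_n, derivable f p (delta_mx ord0 i)) ->
  (forall i : 'I_n, {for q, continuous (fun p => 'D_(delta_mx ord0 i) f p)}) ->
  differentiable f q.
Proof.
move=> fd fc.
pose e (i : 'I_n) : 'rV[R]_n := delta_mx ord0 i.
pose M : 'M[R]_n := \matrix_i 'D_(e i) f q.
have ME v k : (v *m M) ord0 k = \sum_i v ord0 i * 'D_(e i) f q ord0 k.
  by rewrite mxE; apply: eq_bigr => i _; rewrite mxE.
have Mc : continuous (mulmxr M : 'rV[R]_n -> 'rV[R]_n).
  have cM : forall q', differentiable (mulmxr M : 'rV[R]_n -> 'rV[R]_n) q'.
    move=> q'; have -> : (mulmxr M : 'rV[R]_n -> 'rV[R]_n) =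
        \sum_i (fun v : 'rV[R]_n => v ord0 i *: row i M).
      by apply/funext => v; rewrite fct_sumE /= mulmx_sum_row.
    apply: differentiable_sum => i; apply: differentiableZl.
    exact: differentiable_coord.
  by move=> q'; exact: differentiable_continuous (cM q').
apply: (differentiable_of_littleo Mc).
apply/eqaddoP => _/posnumP[eps].
(* Each of the [n] steps will cost [eps' * |w|]; dividing by [n.+1] also covers [n = 0]. *)
pose eps' := eps%:num / n.+1%:R.
have eps'0 : 0 < eps' by rewrite divr_gt0.
have : \forall p \near q, (forall i : 'I_n, derivable f p (e i)) /\
    (forall i : 'I_n, `|'D_(e i) f q - 'D_(e i) f p| <= eps').
  near=> p; split; first by near: p.
  near: p; apply: filter_forall => i.
  exact: ((cvgrPdist_le _ _).1 (fc i)).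
move=> /nbhs_ballP[d /= d0 hd].
have small : \forall w \near (0 : 'rV[R]_n), `|w| < d by exact: nbhs0_lt.
near=> w.
have wd : `|w| < d by near: w; exact: small.
(* The norm is the maximum of the coordinates, so the whole staircase stays within distance [|w|] of
   [q]. *)
have Hball (i : 'I_n) s : Num.min 0 (w ord0 i) <= s <= Num.max 0 (w ord0 i) ->
    ball q d (s *: e i + (partial_vec w i + q)).
  move=> hs; rewrite -ball_normE /= addrA [X in q - X]addrC opprD addrA subrr sub0r normrN.
  apply: le_lt_trans wd; apply: row_norm_le => // j; rewrite !mxE eqxx /=.
  have [->|ne] := eqVneq j i.
    rewrite ltnn mulr1 addr0; apply: le_trans (row_norm_ge w i).
    move: hs; have [w0|w0] := leP 0 (w ord0 i) => /andP[s1 s2].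
      by rewrite (ger0_norm s1) (ger0_norm w0).
    by rewrite (ler0_norm s2) (ltr0_norm w0) lerN2.
  rewrite mulr0 add0r; case: ifP => _; first exact: row_norm_ge.
  by rewrite normr0.
have step (i : 'I_n) k :
  `|f (partial_vec w i.+1 + q) ord0 k - f (partial_vec w i + q) ord0 k
     - w ord0 i * 'D_(e i) f q ord0 k| <= eps' * `|w|.
  pose g (s : R) := f (s *: e i + (partial_vec w i + q)) ord0 k
     - s * 'D_(e i) f q ord0 k.
  pose g' (s : R) := 'D_(e i) f (s *: e i + (partial_vec w i + q)) ord0 k
     - 'D_(e i) f q ord0 k.
  have hg s : Num.min 0 (w ord0 i) <= s <= Num.max 0 (w ord0 i) ->
      is_derive s 1 g (g' s) /\ `|g' s| <= eps'.
    move=> hs; have [h1 h2] := hd _ (Hball i s hs); split.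
      have D1 := is_derive_along (h1 i).
      have D2 : is_derive s 1 (fun t => f (t *: e i + (partial_vec w i + q)) ord0 k)
          ('D_(e i) f (s *: e i + (partial_vec w i + q)) ord0 k).
        case: D1 => D1 D1'; apply: DeriveDef.
          exact: ((derivable_mxP _ _ _).1 D1).
        by rewrite -D1' (derive_mx D1) mxE.
      have D3 : is_derive s 1 (fun t : R => t * 'D_(e i) f q ord0 k)
          ('D_(e i) f q ord0 k).
        by apply: is_derive_eq; rewrite /GRing.scale /= mulr0 mulr1 add0r.
      exact: is_deriveB.
    apply: le_trans (h2 i); rewrite distrC.
    by have := row_norm_ge ('D_(e i) f q - 'D_(e i) f (s *: e i + (partial_vec w i + q))) k;
      rewrite !mxE.
  have := mvt_dist_le hg; rewrite /g scale0r add0r mul0r !subr0.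
  rewrite addrA -partial_vecS addrAC => le_g; apply: le_trans le_g _.
  by rewrite ler_wpM2l ?(ltW eps'0) // row_norm_ge.
apply: row_norm_le; first by rewrite mulr_ge0.
move=> k.
have -> : (f \o shift q - (cst (f q) + mulmxr M)) w ord0 k =
   \sum_(i < n) (f (partial_vec w i.+1 + q) ord0 k
     - f (partial_vec w i + q) ord0 k - w ord0 i * 'D_(e i) f q ord0 k).
  rewrite sumrB -ME -(big_mkord xpredT (fun i => f (partial_vec w i.+1 + q) ord0 k
    - f (partial_vec w i + q) ord0 k)) telescope_sumr //.
  have -> : partial_vec w n = w.
    by apply/rowP => j; rewrite mxE ltn_ord.
  have -> : partial_vec w 0 = 0 by apply/rowP => j; rewrite !mxE.
  rewrite add0r -[LHS]/((f (w + q) - (f q + w *m M)) ord0 k) !mxE.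
  by rewrite opprD addrA.
apply: le_trans (ler_norm_sum _ _ _) _.
apply: le_trans (ler_sum _ (fun i _ => step i k)) _.
rewrite sumr_const card_ord -mulr_natl mulrA ler_wpM2r // /eps'.
by rewrite mulrCA ler_piMr // ler_pdivrMr // mul1r ler_nat.
Unshelve. all: by end_near. Qed.
End Partials.

End ContinuouslyDifferentiable.

(** * Smooth maps on the ball *)

Section SmoothOnB.
Variable R : realType.
Local Open Scope classical_set_scope.
Local Notation "x ** y" := (qmul x y) (at level 40, left associativity).
Local Notation N2 := (@qnorm2 R).
Implicit Types (f g : quat R -> quat R) (q v : quat R).

Lemma inB_near q : inB q -> \forall p \near q, inB p.
Proof.
move=> hq; have c : {for q, continuous (@qnorm2 R)}.
  apply: differentiable_continuous; rewrite /qnorm2.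
  have h i : differentiable (fun x : quat R => qc x i) q.
    exact: differentiable_coord.
  under eq_fun do rewrite !expr2.
  by repeat first [exact: h | apply: differentiable_mulf
    | apply: differentiable_addf].
exact: (cvgr_lt _ c _ hq).
Qed.

(** The first two levels of [smooth_on_B] provide the partial derivatives and their continuity. *)
Lemma smooth_on_B_differentiable f q :
  smooth_on_B f -> inB q -> differentiable f q.
Proof.
move=> fs hq; apply: (@differentiable_of_partials R 4).
  near=> p => i; have hp : inB p by near: p; exact: inB_near.
  by case: (fs [::] p hp) => _; apply.
by move=> i; exact: (fs [:: delta_mx ord0 i] q hq).1.
Unshelve. all: by end_near. Qed.

Lemma is_derive_comp_curve f (c : R -> quat R) t v : differentiable f (c t) ->
  is_derive t 1 c v -> is_derive t 1 (fun s => f (c s)) ('D_v f (c t)).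
Proof.
move=> fd [cd <-].
have cd' := (derivable1_diffP _ _).1 cd.
have fcd : differentiable (f \o c) t by exact: differentiable_comp.
apply: DeriveDef; first exact: diff_derivable.
by rewrite deriveE // diff_comp // (deriveE _ fd) (deriveE _ cd').
Qed.

Lemma derive_comp f g q v : differentiable f q -> differentiable g (f q) ->
  'D_v (fun x => g (f x)) q = 'D_('D_v f q) g (f q).
Proof.
move=> fd gd.
have fcd : differentiable (g \o f) q by exact: differentiable_comp.
by rewrite deriveE // diff_comp // (deriveE _ gd) (deriveE _ fd).
Qed.

(* Closed under directional derivatives, hence made of smooth maps. *)
Inductive qrational : (quat R -> quat R) -> Prop :=
| qrational_cst c : qrational (fun _ => c)
| qrational_id : qrational (fun q => q)
| qrational_add f g : qrational f -> qrational g -> qrational (fun q => f q + g q)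
| qrational_mul f g : qrational f -> qrational g -> qrational (fun q => f q ** g q)
| qrational_inv f : qrational f -> (forall q, inB q -> f q != 0) ->
    qrational (fun q => qinv (f q)).

Lemma qrational_differentiable f q : qrational f -> inB q -> differentiable f q.
Proof.
move=> fr hq; elim: fr => {f}.
- by move=> c; exact: differentiable_cst.
- by case: (is_diff_id q).
- by move=> f g _ fd _ gd; exact: (differentiableD fd gd).
- by move=> f g _ fd _ gd; exact: differentiable_qmul.
- by move=> f _ fd f0; apply: differentiable_qinv => //; exact: f0.
Qed.

Lemma qrational_is_derive f v : qrational f ->
  exists2 df, qrational df & forall q, inB q -> is_derive q v f (df q).
Proof.
move=> fr; elim: (fr) => {f fr}.
- by move=> c; exists (fun _ => 0); [exact: qrational_cst|move=> q _; exact: is_derive_cst].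
- by exists (fun _ => v); [exact: qrational_cst|move=> q _; exact: is_derive_id].
- move=> f g _ [df dfr fd] _ [dg dgr gd]; exists (fun q => df q + dg q).
    exact: qrational_add.
  by move=> q hq; exact: (is_deriveD (fd q hq) (gd q hq)).
- move=> f g fr [df dfr fd] gr [dg dgr gd]; exists (fun q => df q ** g q + f q ** dg q).
    by apply: qrational_add; exact: qrational_mul.
  by move=> q hq; exact: (is_derive_qmul (fd q hq) (gd q hq)).
- move=> f fr [df dfr fd] f0.
  (* [qrational] has no constructor for opposites, so the sign enters as a constant factor. *)
  exists (fun q => qreal (-1) ** (qinv (f q) ** df q ** qinv (f q))).
    have fi : qrational (fun q => qinv (f q)) by exact: qrational_inv.
    apply: qrational_mul; first exact: qrational_cst.
    by apply: qrational_mul => //; exact: qrational_mul.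
  move=> q hq; rewrite qrealE scaleN1r; apply: is_derive_qinv (f0 q hq); last exact: fd.
  exact: qrational_differentiable.
Qed.

(** The ball is open, so agreement there passes to every iterated derivative, and each of these is
    again [qrational]. *)
Lemma smooth_of_qrational f g : qrational g -> (forall q, inB q -> f q = g q) ->
  smooth_on_B f.
Proof.
move=> gr fg vs.
have [h hr fh] : exists2 h, qrational h & forall q, inB q -> Defs.iterD vs f q = h q.
  elim: vs => [|v vs [h hr fh]]; first by exists g.
  have [dh dhr hd] := qrational_is_derive v hr; exists dh => // q hq /=.
  have [_ <-] := hd q hq; apply: near_eq_derive.
  by near=> p; apply: fh; near: p; exact: inB_near.
move=> q hq.
have nfh : \forall p \near q, h p = Defs.iterD vs f p.
  by near=> p; rewrite fh //; near: p; exact: inB_near.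
have hd := qrational_differentiable hr hq.
split.
  have hc := differentiable_continuous hd.
  rewrite /prop_for /continuous_at fh //.
  exact: cvg_trans (near_eq_cvg nfh) hc.
by move=> v; exact: near_eq_derivable nfh (diff_derivable hd).
Unshelve. all: by end_near. Qed.

End SmoothOnB.

(** * The hyperbolic tangent *)

Section HyperbolicTangent.
Variable R : realType.
Implicit Types s t x : R.
Local Notation th := (@Defs.tanh R).

(** In terms of the single quantity [expR (2 * t)] the addition formula and the inverse function
    become field identities. *)
Lemma tanhE t : th t = (expR (2 * t) - 1) / (expR (2 * t) + 1).
Proof.
have e0 := expR_gt0 t; have e1 := expR_gt0 (2 * t).
rewrite /Defs.tanh expRN mulr_natl mulr2n expRD.
have h1 : expR t + (expR t)^-1 != 0 by rewrite gt_eqF // addr_gt0 ?invr_gt0.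
have h2 : expR t * expR t + 1 != 0 by rewrite gt_eqF // addr_gt0 ?mulr_gt0.
by field; rewrite ?gt_eqF // ?addr_gt0 ?mulr_gt0.
Qed.

Lemma tanh_gtN1 t : -1 < th t.
Proof.
have e1 := expR_gt0 (2 * t).
by rewrite tanhE ltr_pdivlMr; lra.
Qed.

Lemma tanh_lt1 t : th t < 1.
Proof.
have e1 := expR_gt0 (2 * t).
by rewrite tanhE ltr_pdivrMr; lra.
Qed.

Lemma sqr_tanh_lt1 t : th t ^+ 2 < 1.
Proof. by have := tanh_gtN1 t; have := tanh_lt1 t; nra. Qed.

Lemma tanhN t : th (- t) = - th t.
Proof. by rewrite /Defs.tanh opprK [X in _ / X]addrC -mulNr opprB. Qed.

Lemma tanh0 : th 0 = 0.
Proof. by rewrite /Defs.tanh oppr0 subrr mul0r. Qed.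

Lemma tanhD s t : th (s + t) = (th s + th t) / (1 + th s * th t).
Proof.
have e1 := expR_gt0 (2 * s); have e2 := expR_gt0 (2 * t).
rewrite !tanhE mulrDr expRD.
set a := expR (2 * s) in e1 *; set b := expR (2 * t) in e2 *.
have e3 : 0 < a * b by rewrite mulr_gt0.
by field; rewrite !gt_eqF //; nra.
Qed.

Lemma ln_tanh t : 2^-1 * ln ((1 + th t) / (1 - th t)) = t.
Proof.
have e1 := expR_gt0 (2 * t).
have -> : (1 + th t) / (1 - th t) = expR (2 * t).
  rewrite tanhE; set a := expR (2 * t) in e1 *.
  by field; rewrite !gt_eqF //; lra.
by rewrite expRK mulrA mulVf ?mul1r.
Qed.

Lemma tanh_surj x : x ^+ 2 < 1 -> exists t, th t = x.
Proof.
move=> hx; exists (2^-1 * ln ((1 + x) / (1 - x))).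
have h1 : 0 < 1 + x by nra.
have h2 : 0 < 1 - x by nra.
rewrite tanhE mulrA divff // mul1r lnK; last by rewrite posrE divr_gt0.
by field; rewrite !gt_eqF //; lra.
Qed.

Lemma is_derive_tanh t : is_derive t 1 th (1 - th t ^+ 2).
Proof.
have h x : expR x + expR (- x) != 0 by rewrite gt_eqF // addr_gt0 ?expR_gt0.
have dN : is_derive t 1 (fun x : R => expR (- x)) (- expR (- t)).
  have := is_derive1_comp (is_derive_expR (- t)) (is_deriveNid t 1).
  by rewrite mulrN1.
have dE := is_derive_expR t.
have dn : is_derive t 1 (fun x => expR x - expR (- x)) (expR t + expR (- t)).
  by have := is_deriveB dE dN; rewrite opprK.
have dd : is_derive t 1 (fun x => expR x + expR (- x)) (expR t - expR (- t)).
  exact: (is_deriveD dE dN).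
have dV := @is_deriveV _ (fun x => expR x + expR (- x)) _ _ _ (h t) dd.
apply: is_derive_eq (is_deriveM dn dV) _.
by rewrite /GRing.scale /= /Defs.tanh; field; rewrite h.
Qed.

End HyperbolicTangent.

(** * The action formula and its group law *)

Section Boosts.
Variable R : realType.
Local Notation "x ** y" := (qmul x y) (at level 40, left associativity).
Local Notation N2 := (@qnorm2 R).
Local Notation th := (@Defs.tanh R).
Implicit Types (q u v a b : quat R) (s t e : R).

(** The part of the action due to [H(t)], with parameter [s = tanh t] so that identities are
    rational in [s]. *)
Definition boost s q : quat R := qinv (qone R + s *: q) ** (q + qreal s).

Lemma actE u e t q : act u e t q = e *: (u ** boost (th t) q ** qconj u).
Proof. by rewrite /act /boost !qmulA. Qed.

Lemma boost_den_neq0 s q : s ^+ 2 < 1 -> inB q -> qone R + s *: q != 0.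
Proof.
move=> hs hq; apply/eqP => /eqP; rewrite addr_eq0 => /eqP h.
have := qnorm2_1 R; rewrite h qnorm2N qnorm2Z => h1.
by have := qnorm2_ge0 q; rewrite /inB in hq; nra.
Qed.

(** Both factors are built from [q] with real coefficients, hence commute. *)
Lemma boost_comm s q : s ^+ 2 < 1 -> inB q ->
  boost s q = (q + qreal s) ** qinv (qone R + s *: q).
Proof.
move=> hs hq; have w0 := boost_den_neq0 hs hq.
apply: (qmulI w0); apply: (qmulIr w0).
rewrite /boost !qmulA qmulVr // qmul1l -!qmulA qmulVl // qmul1r.
by rewrite /qreal; qring.
Qed.

(** From [|1 + s q|^2 - |q + s|^2 = (1 - s^2)(1 - |q|^2)]. It gives the invariance of the ball and,
    later, the change of the factor [1 - |q|^2] of the metric. *)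
Lemma qnorm2_boost s q : s ^+ 2 < 1 -> inB q ->
  1 - N2 (boost s q) = N2 (qinv (qone R + s *: q)) * (1 - s ^+ 2) * (1 - N2 q).
Proof.
move=> hs hq; have w0 := boost_den_neq0 hs hq.
rewrite -qnorm2_eq0 in w0.
rewrite /boost qnorm2M qnorm2V -mulrA.
have -> : (1 - s ^+ 2) * (1 - N2 q) = N2 (qone R + s *: q) - N2 (q + qreal s).
  by rewrite /qnorm2 /qone /qreal !qcE; ring.
by rewrite mulrBr mulVf.
Qed.

Lemma boost_inB s q : s ^+ 2 < 1 -> inB q -> inB (boost s q).
Proof.
move=> hs hq; rewrite /inB -subr_gt0 qnorm2_boost //.
rewrite !mulr_gt0 ?subr_gt0 // qnorm2V invr_gt0 qnorm2_gt0.
exact: boost_den_neq0.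
Qed.

Lemma boost0 q : boost 0 q = q.
Proof.
rewrite /boost scale0r addr0 /qreal scale0r addr0.
by rewrite -{1}(qmul1l q) qmulA qmulVl ?qone_neq0 ?qmul1l.
Qed.

(** Conjugation by a unit quaternion is a ring automorphism fixing the reals, and the coefficients
    of [boost] are real. *)
Lemma boost_conj s u q : s ^+ 2 < 1 -> inSp1 u -> inB q ->
  boost s (u ** q ** qconj u) = u ** boost s q ** qconj u.
Proof.
move=> hs hu hq.
have hq' : inB (u ** q ** qconj u).
  by rewrite /inB !qnorm2M qnorm2_conj hu mulr1 mul1r.
have w0 := boost_den_neq0 hs hq'; have w0' := boost_den_neq0 hs hq.
have cE x : u ** x ** qconj u ** u = u ** x.
  by rewrite -!qmulA inSp1_mull // qmul1r.
apply: (qmulI w0); rewrite /boost qmulA qmulVr // qmul1l.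
have -> : qone R + s *: (u ** q ** qconj u) = u ** (qone R + s *: q) ** qconj u.
  by rewrite qmulDr qmulDl qmulZr qmulZl qmul1r inSp1_mulr.
rewrite !qmulA cE -(qmulA u _ (qinv _)) qmulVr // qmul1r.
by rewrite qmulDr qmulDl qrealEr qmulZl inSp1_mulr.
Qed.

(** The source of the twist [e2 * t1] in the semidirect product. *)
Lemma boost_sign s e q : s ^+ 2 < 1 -> is_sign e -> inB q ->
  boost s (e *: q) = e *: boost (e * s) q.
Proof.
move=> hs [->|->] hq; first by rewrite !scale1r mul1r.
rewrite !mulN1r !scaleN1r /boost scaleNr scalerN -qmulNr.
by rewrite opprD /qreal scaleNr opprK.
Qed.

(** Addition of velocities: clearing the inner denominator [w] produces the same real factor
    [1 + s * t] in the outer numerator and denominator. *)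
Lemma boost_comp s t q : s ^+ 2 < 1 -> t ^+ 2 < 1 -> inB q ->
  boost s (boost t q) = boost ((s + t) / (1 + s * t)) q.
Proof.
move=> hs ht hq; have w0 := boost_den_neq0 ht hq.
have hb := boost_inB ht hq.
have k0 : 0 < 1 + s * t by nra.
have hk : ((s + t) / (1 + s * t)) ^+ 2 < 1.
  by rewrite expr_div_n ltr_pdivrMr ?exprn_gt0 //; nra.
have w1 := boost_den_neq0 hk hq; have w2 := boost_den_neq0 hs hb.
set k := _ / _ in hk w1 *.
set w := qone R + t *: q in w0.
have wb : w ** boost t q = q + qreal t by rewrite /boost qmulA qmulVr // qmul1l.
have E1 : w ** (qone R + s *: boost t q) = (1 + s * t) *: (qone R + k *: q).
  rewrite qmulDr qmul1r qmulZr wb [(1 + s * t) *: _]scalerDr scalerA /k.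
  rewrite [(1 + s * t) * _]mulrC divfK ?gt_eqF //.
  by rewrite /w /qreal; qring.
have E2 : w ** (boost t q + qreal s) = (1 + s * t) *: (q + qreal k).
  rewrite qmulDr wb qrealEr /w /qreal [(1 + s * t) *: _]scalerDr scalerA.
  rewrite [(1 + s * t) * k]mulrC divfK ?gt_eqF //.
  by qring.
apply: (qmulI w2); rewrite {1}/boost qmulA qmulVr // qmul1l.
apply: (qmulI w0); rewrite qmulA E1 E2 qmulZl; congr (_ *: _).
by rewrite /boost qmulA qmulVr // qmul1l.
Qed.

Lemma act_inB u e t q : inSp1 u -> is_sign e -> inB q -> inB (act u e t q).
Proof.
move=> hu he hq; have hb := boost_inB (sqr_tanh_lt1 t) hq.
rewrite /inB actE; move: (boost _ _) hb => b hb.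
rewrite qnorm2Z !qnorm2M qnorm2_conj hu mulr1 mul1r.
have -> : e ^+ 2 = 1 by case: he => ->; ring.
by rewrite mul1r.
Qed.

Lemma act_id q : act (qone R) 1 0 q = q.
Proof. by rewrite actE tanh0 boost0 scale1r qconj1 qmul1r qmul1l. Qed.

Lemma act_comp u1 u2 e1 e2 t1 t2 q :
  inSp1 u1 -> is_sign e1 -> inSp1 u2 -> is_sign e2 -> inB q ->
  act u1 e1 t1 (act u2 e2 t2 q) = act (u1 ** u2) (e1 * e2) (e2 * t1 + t2) q.
Proof.
move=> hu1 he1 hu2 he2 hq.
have h1 := sqr_tanh_lt1 t1; have h2 := sqr_tanh_lt1 t2.
have hb := boost_inB h2 hq.
have hc : inB (u2 ** boost (th t2) q ** qconj u2).
  rewrite /inB; move: (boost _ _) hb => b hb.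
  by rewrite !qnorm2M qnorm2_conj hu2 mulr1 mul1r.
have e2E : th (e2 * t1) = e2 * th t1.
  by case: he2 => ->; rewrite ?mul1r ?mulN1r ?tanhN.
have h3 : (e2 * th t1) ^+ 2 < 1 by rewrite -e2E sqr_tanh_lt1.
rewrite !actE boost_sign // boost_conj // boost_comp // tanhD e2E.
by rewrite qmulZr qmulZl scalerA qconjM !qmulA.
Qed.

(** In the semidirect product the inverse of [(e, t)] is [(e, - e t)], because [e * e = 1]. *)
Lemma act_inv u e t q : inSp1 u -> is_sign e -> inB q ->
  act (qconj u) e (- (e * t)) (act u e t q) = q.
Proof.
move=> hu he hq; have hu' := inSp1_conj hu.
rewrite act_comp // inSp1_mull // mulrN mulrA.
have -> : e * e = 1 by case: he => ->; ring.
by rewrite mul1r addNr act_id.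
Qed.

Lemma act_invr u e t q : inSp1 u -> is_sign e -> inB q ->
  act u e t (act (qconj u) e (- (e * t)) q) = q.
Proof.
move=> hu he hq; have hu' := inSp1_conj hu.
rewrite act_comp // inSp1_mulr // subrr.
have -> : e * e = 1 by case: he => ->; ring.
by rewrite act_id.
Qed.

End Boosts.

(** * Explicit 4 by 4 determinants *)

Section Determinant.
Variable R : realType.

Definition det3 (a : nat -> nat -> R) i0 i1 i2 j0 j1 j2 : R :=
  a i0 j0 * (a i1 j1 * a i2 j2 - a i1 j2 * a i2 j1)
  - a i0 j1 * (a i1 j0 * a i2 j2 - a i1 j2 * a i2 j0)
  + a i0 j2 * (a i1 j0 * a i2 j1 - a i1 j1 * a i2 j0).

(** Entries are indexed by naturals so that the expansion is free of ordinals and open to [ring]. *)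
Lemma det_mx44 (a : nat -> nat -> R) :
  \det (\matrix_(i < 4, j < 4) a i j) =
  a 0 0 * det3 a 1 2 3 1 2 3 - a 0 1 * det3 a 1 2 3 0 2 3
  + a 0 2 * det3 a 1 2 3 0 1 3 - a 0 3 * det3 a 1 2 3 0 1 2.
Proof.
rewrite (expand_det_row _ ord0) !big_ord_recl big_ord0 /cofactor.
rewrite !(expand_det_row _ ord0) !big_ord_recl !big_ord0 /cofactor.
rewrite !(expand_det_row _ ord0) !big_ord_recl !big_ord0 /cofactor.
rewrite !det_mx11 !mxE /= /bump /= !addn0 !add0n /det3.
by rewrite !exprS !expr0; ring.
Qed.
End Determinant.

(** * The action is by orientation preserving isometries *)

Section ActionIsIsometric.
Variable R : realType.
Local Notation "x ** y" := (qmul x y) (at level 40, left associativity).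
Local Notation N2 := (@qnorm2 R).
Local Notation th := (@Defs.tanh R).
Implicit Types (q u v a b x y : quat R) (s t e : R).

Definition qunit (j : nat) : quat R :=
  mkq (j == 0)%:R (j == 1)%:R (j == 2)%:R (j == 3)%:R.

Lemma ebasisE (j : 'I_4) : ebasis R j = qunit j.
Proof.
apply: quatP; rewrite /qunit !qcE /qc /ebasis mxE eqxx /= -val_eqE /= inordK //;
  by rewrite eq_sym.
Qed.

Lemma qcE_ord x (i : 'I_4) : x ord0 i = qc x i.
Proof. by rewrite /qc inord_val. Qed.

Lemma qmul_sumr a x : a ** x = \sum_(k < 4) qc x k *: (a ** qunit k).
Proof.
rewrite !big_ord_recl big_ord0 /= /bump /= /qunit /=.
by apply: quatP; rewrite /qmul !qcE; ring.
Qed.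

Lemma det_qmull a : \det (\matrix_(i < 4, j < 4) qc (a ** qunit j) i) = N2 a ^+ 2.
Proof.
rewrite (det_mx44 (fun i j => qc (a ** qunit j) i)) /det3 /qmul /qunit !qcE.
by rewrite /= ?(mul0r, mul1r, add0r, addr0, subr0, sub0r) /qnorm2; ring.
Qed.

Lemma det_qmulr a : \det (\matrix_(i < 4, j < 4) qc (qunit j ** a) i) = N2 a ^+ 2.
Proof.
rewrite (det_mx44 (fun i j => qc (qunit j ** a) i)) /det3 /qmul /qunit !qcE.
by rewrite /= ?(mul0r, mul1r, add0r, addr0, subr0, sub0r) /qnorm2; ring.
Qed.

(** The matrix of [x -> a x b] is the product of those of a left and a right multiplication. The
    result is nonnegative whatever [a] and [b] are, which is why the action preserves
    orientation. *)
Lemma det_qmul_conj a b :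
  \det (\matrix_(i < 4, j < 4) qc (a ** qunit j ** b) i) = N2 a ^+ 2 * N2 b ^+ 2.
Proof.
rewrite -det_qmull -det_qmulr -det_mulmx; congr (\det _).
apply/matrixP => i j; rewrite !mxE -qmulA qmul_sumr.
rewrite -qcE_ord summxE; apply: eq_bigr => k _.
by rewrite qcE_ord qcZ mulrC; congr (_ * _); rewrite [RHS]mxE.
Qed.

Lemma boost_qrational s : s ^+ 2 < 1 -> qrational (boost s).
Proof.
move=> hs.
have -> : boost s = (fun q => qinv (qone R + qreal s ** q) ** (q + qreal s)).
  by apply/funext => q; rewrite /boost qrealE.
have hq : qrational (fun q => q) := qrational_id R.
have hc c : qrational (fun=> c) := qrational_cst c.
apply: qrational_mul; last exact: qrational_add.
apply: qrational_inv => [|q]; first by apply: qrational_add => //; exact: qrational_mul.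
by rewrite qrealE; exact: boost_den_neq0.
Qed.

Lemma act_qrational u e t : qrational (act u e t).
Proof.
have -> : act u e t = (fun q => qreal e ** (u ** boost (th t) q ** qconj u)).
  by apply/funext => q; rewrite actE qrealE.
have hc c : qrational (fun=> c) := qrational_cst c.
have hb := boost_qrational (sqr_tanh_lt1 t).
by do 2![apply: qrational_mul => //]; exact: qrational_mul.
Qed.

(** The quotient rule gives two terms; since [boost] can also be written with its denominator on the
    right, they combine into one two-sided product around [v], so the differential is a
    similarity. *)
Lemma is_derive_boost s q v : s ^+ 2 < 1 -> inB q ->
  is_derive q v (boost s) ((1 - s ^+ 2) *:
    (qinv (qone R + s *: q) ** v ** qinv (qone R + s *: q))).
Proof.
move=> hs hq; have w0 := boost_den_neq0 hs hq.
set w := qone R + s *: q in w0 *.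
have dw : is_derive q v (fun x => qone R + s *: x) (s *: v).
  by apply: is_derive_eq; rewrite add0r.
have dw' : differentiable (fun x => qone R + s *: x) q.
  by apply: (@differentiableD _ _ _ (cst (qone R)) ( *:%R s)) => //.
have dn : is_derive q v (fun x => x + qreal s) v.
  by apply: is_derive_eq; rewrite addr0.
apply: is_derive_eq (is_derive_qmul (is_derive_qinv dw' dw w0) dn) _.
rewrite -/w; apply: (qmulI w0); rewrite qmulDr qmulNl qmulNr !qmulA qmulVr // qmul1l.
rewrite -!qmulA -/(boost s q) boost_comm // -/w.
have wE : w = qone R + s *: q by [].
clearbody w; move: (qmulVr w0) (qmulVl w0); move: (qinv w) => p wp pw.
have zE : q + qreal s = q + qreal s by [].
move: {1 3}(q + qreal s) zE => z zE.
apply: (qmulIr w0); rewrite !(qmulZr, qmulZl, qmulDl, qmulNl) -!qmulA pw.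
by rewrite !qmul1r qmul1l !qmulA wp qmul1l wE zE /qreal; qring.
Qed.

Lemma derive_act u e t q v : inB q ->
  'D_v (act u e t) q = (e * (1 - th t ^+ 2)) *:
   (u ** qinv (qone R + th t *: q) ** v ** (qinv (qone R + th t *: q) ** qconj u)).
Proof.
move=> hq; have hb := is_derive_boost v (sqr_tanh_lt1 t) hq.
have d : is_derive q v (fun x => qreal e ** (u ** boost (th t) x ** qconj u))
    (qreal e ** (u ** ((1 - th t ^+ 2) *: (qinv (qone R + th t *: q) ** v
        ** qinv (qone R + th t *: q))) ** qconj u)).
  have d1 := is_derive_qmul (is_derive_cst u q v) hb.
  rewrite qmul0l add0r in d1.
  have d2 := is_derive_qmul d1 (is_derive_cst (qconj u) q v).
  rewrite qmul0r addr0 in d2.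
  have d3 := is_derive_qmul (is_derive_cst (qreal e) q v) d2.
  by rewrite qmul0l add0r in d3.
have -> : act u e t = (fun q => qreal e ** (u ** boost (th t) q ** qconj u)).
  by apply/funext => x; rewrite actE qrealE.
case: d => _ ->; move: (qinv _) => p.
by rewrite qrealE !qmulZr qmulZl scalerA !qmulA.
Qed.

Lemma act_diffeo u e t : inSp1 u -> is_sign e -> diffeo_B (act u e t).
Proof.
move=> hu he; split; first by move=> q; exact: act_inB.
split; first exact: smooth_of_qrational (act_qrational u e t) _.
exists (act (qconj u) e (- (e * t))); split.
  by move=> q; apply: act_inB => //; exact: inSp1_conj.
split; first exact: smooth_of_qrational (act_qrational _ _ _) _.
by move=> q hq; rewrite act_inv // act_invr.
Qed.

Lemma act_jacobian u e t q : inSp1 u -> is_sign e -> inB q ->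
  0 < \det (Defs.jacobian (act u e t) q).
Proof.
move=> hu he hq.
set p := qinv (qone R + th t *: q).
have p0 : 0 < N2 p.
  rewrite qnorm2_gt0 qinv_eq0; apply: boost_den_neq0 => //; exact: sqr_tanh_lt1.
have -> : Defs.jacobian (act u e t) q = (e * (1 - th t ^+ 2)) *:
    \matrix_(i < 4, j < 4) qc ((u ** p) ** qunit j ** (p ** qconj u)) i.
  apply/matrixP => i j.
  by rewrite !mxE qcE_ord derive_act // ebasisE qcZ.
rewrite detZ det_qmul_conj !qnorm2M qnorm2_conj hu mul1r mulr1.
have h1 := sqr_tanh_lt1 t.
have he4 : e ^+ 4 = 1 by case: he => ->; ring.
rewrite exprMn he4 mul1r mulr_gt0 ?exprn_gt0 ?subr_gt0 //.
by rewrite mulr_gt0 // exprn_gt0.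
Qed.

(** With [w = 1 + s q], [z = q + s] and [p = w^-1], the boost is [p z = z p], and
    [w c w - z c z = (1 - s^2)(c - q c q)]. Numerator and denominators of the metric thus change by
    powers of [1 - s^2] and [|p|], which cancel. *)
Lemma act_metric u e t q a b : inSp1 u -> is_sign e -> inB q ->
  slice_metric (act u e t q) ('D_a (act u e t) q) ('D_b (act u e t) q) =
  slice_metric q a b.
Proof.
move=> hu he hq; rewrite !derive_act // actE.
have hs := sqr_tanh_lt1 t; set s := th t in hs *.
have w0 := boost_den_neq0 hs hq; have hb := qnorm2_boost hs hq.
have bE : boost s q = qinv (qone R + s *: q) ** (q + qreal s) by [].
have bC := boost_comm hs hq.
set w := qone R + s *: q in w0 bE bC hb *.
have wE : w = qone R + s *: q by [].
clearbody w; set p := qinv w in bE bC hb *.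
set z := q + qreal s in bE bC.
have zE : z = q + qreal s by [].
have wp : w ** p = qone R by exact: qmulVr.
have pw : p ** w = qone R by exact: qmulVl.
have wz : w ** z = z ** w by rewrite wE zE /qreal; qring.
have p0 : 0 < N2 p by rewrite qnorm2_gt0 /p qinv_eq0.
have zp : z ** p = p ** z by rewrite -bE -bC.
clearbody p z s; move: (boost s q) bE bC hb => T bE bC hb.
have he2 : e * e = 1 by case: he => ->; ring.
have uu : qconj u ** u = qone R by exact: inSp1_mull.
have conjE x y : (u ** x ** qconj u) ** (u ** y ** qconj u) = u ** (x ** y) ** qconj u.
  by rewrite !qmulA -(qmulA _ (qconj u) u) uu qmul1r.
set k := e * (1 - s ^+ 2).
have hk : k * k = (1 - s ^+ 2) ^+ 2 by rewrite /k mulrACA he2 mul1r.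
clearbody k.
have num c : let S := e *: (u ** T ** qconj u) in
   let C := k *: (u ** p ** c ** (p ** qconj u)) in
   C - S ** C ** S = (k * (1 - s ^+ 2)) *:
     ((u ** (p ** p)) ** (c - q ** c ** q) ** ((p ** p) ** qconj u)).
  move=> S C.
  have -> : C = k *: (u ** (p ** c ** p) ** qconj u) by rewrite /C !qmulA.
  rewrite /S !qmulZl !qmulZr !qmulZl !conjE !scalerA.
  rewrite he2 mul1r.
  rewrite -scalerBr -scalerA; congr (_ *: _).
  rewrite -qmulBl -qmulBr.
  have -> : p ** c ** p = (p ** p) ** (w ** c ** w) ** (p ** p).
    by rewrite !qmulA -(qmulA p p w) pw qmul1r -(qmulA _ w p) wp qmul1r.
  have -> : T ** (p ** p ** (w ** c ** w) ** (p ** p)) ** T =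
     (p ** p) ** (z ** c ** z) ** (p ** p).
    have -> : (p ** p) ** (w ** c ** w) ** (p ** p) = p ** c ** p.
      by rewrite !qmulA -(qmulA p p w) pw qmul1r -(qmulA _ w p) wp qmul1r.
    rewrite {1}bE bC !qmulA -(qmulA p z p) zp !qmulA.
    by rewrite -(qmulA (_ ** c) p z) -zp !qmulA.
  rewrite -qmulBl -qmulBr.
  have -> : w ** c ** w - z ** c ** z = (1 - s ^+ 2) *: (c - q ** c ** q).
    by rewrite wE zE /qreal; qring.
  by rewrite qmulZr qmulZl !qmulZr !qmulZl !qmulA.
have den1 : N2 (qone R - (e *: (u ** T ** qconj u)) ** (e *: (u ** T ** qconj u)))
    = N2 p ^+ 2 * (1 - s ^+ 2) ^+ 2 * N2 (qone R - q ** q).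
  rewrite qmulZl qmulZr conjE scalerA he2 scale1r.
  have -> : qone R - u ** (T ** T) ** qconj u =
     u ** (p ** p) ** ((1 - s ^+ 2) *: (qone R - q ** q)) ** qconj u.
    have -> : (1 - s ^+ 2) *: (qone R - q ** q) = w ** w - z ** z.
      by rewrite wE zE /qreal; qring.
    have -> : T ** T = p ** p ** (z ** z).
      by rewrite {1}bE bC !qmulA -(qmulA (p ** z) z p) zp !qmulA -(qmulA p z p) zp !qmulA.
    rewrite -(qmulA u (p ** p)) [(p ** p) ** (w ** w - _)]qmulBr.
    have -> : p ** p ** (w ** w) = qone R.
      by rewrite !qmulA -(qmulA p p w) pw qmul1r pw.
    by rewrite qmulBr qmulBl qmul1r inSp1_mulr.
  by rewrite !qnorm2M qnorm2Z qnorm2_conj hu; ring.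
have den2 : 1 - N2 (e *: (u ** T ** qconj u)) = N2 p * (1 - s ^+ 2) * (1 - N2 q).
  rewrite -hb qnorm2Z expr2 he2; by rewrite !qnorm2M qnorm2_conj hu; ring.
rewrite /slice_metric !num den1 den2 !qconjZ !qmulZl !qmulZr /qre !qcZ -!/(qre _).
rewrite qre_conj_mul !qnorm2M qnorm2_conj hu.
rewrite /inB -subr_gt0 in hq.
have hs' : 0 < 1 - s ^+ 2 by rewrite subr_gt0.
set A := qre _; set D := N2 (_ - _).
have -> : k * (1 - s ^+ 2) * (k * (1 - s ^+ 2) *
      (1 * (N2 p * N2 p) * (N2 p * N2 p * 1) * A)) =
    (k * k) * (1 - s ^+ 2) ^+ 2 * N2 p ^+ 4 * A by ring.
rewrite hk.
have -> : (N2 p ^+ 2 * (1 - s ^+ 2) ^+ 2 * D * (N2 p * (1 - s ^+ 2) * (1 - N2 q)) ^+ 2)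
   = ((1 - s ^+ 2) ^+ 4 * N2 p ^+ 4) * (D * (1 - N2 q) ^+ 2) by ring.
have -> : (1 - s ^+ 2) ^+ 2 * (1 - s ^+ 2) ^+ 2 * N2 p ^+ 4 * A =
  ((1 - s ^+ 2) ^+ 4 * N2 p ^+ 4) * A by ring.
by rewrite -mulf_div divff ?mul1r // gt_eqF // mulr_gt0 // exprn_gt0.
Qed.

Lemma act_orient_pres_isometry u e t : inSp1 u -> is_sign e ->
  orient_pres_isometry_B (act u e t).
Proof.
move=> hu he; split; last by move=> q; exact: act_jacobian.
by split; [exact: act_diffeo | move=> q a b; exact: act_metric].
Qed.

End ActionIsIsometric.

(** * Coordinates about the real axis *)

Section AxisCoordinates.
Variable R : realType.
Local Notation "x ** y" := (qmul x y) (at level 40, left associativity).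
Local Notation N2 := (@qnorm2 R).
Local Notation th := (@Defs.tanh R).
Implicit Types (q v : quat R).

(* [axis_coord q] is the signed distance from 0 to the foot of the
   perpendicular dropped from [q] on the real axis, and
   [axis_gap q = sinh (2 r)^2], where [r] is the distance from [q] to the axis. *)
Definition axis_coord q : R := 4^-1 * ln (N2 (qone R + q) / N2 (qone R - q)).
Definition im2 q : R := qc q 1 ^+ 2 + qc q 2 ^+ 2 + qc q 3 ^+ 2.
Definition axis_gap q : R := 4 * im2 q / (1 - N2 q) ^+ 2.
Definition gq q v : R := slice_metric q v v.

Definition imdot q v : R := qc q 1 * qc v 1 + qc q 2 * qc v 2 + qc q 3 * qc v 3.
Definition sden q : R := N2 (qone R - q ** q).
Definition d_axis_coord q v : R :=
  ((1 + N2 q - 2 * qc q 0 ^+ 2) * qc v 0 - 2 * qc q 0 * imdot q v) / sden q.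
Definition d_axis_gap q v : R :=
  8 * (2 * qc q 0 * im2 q * qc v 0 + (1 + N2 q - 2 * qc q 0 ^+ 2) * imdot q v)
  / (1 - N2 q) ^+ 3.

Lemma im2_ge0 q : 0 <= im2 q.
Proof. by rewrite /im2 !addr_ge0 ?sqr_ge0. Qed.

Lemma qnorm2_im q : N2 q = qc q 0 ^+ 2 + im2 q.
Proof. by rewrite /qnorm2 /im2 !addrA. Qed.

(** Consequences: [1 + axis_gap] is [sden] over [(1 - |q|^2)^2], and [4 * im2 q <= sden q], which
    will bound the speed of rotations about the axis. *)
Lemma sdenE q : sden q = (1 - N2 q) ^+ 2 + 4 * im2 q.
Proof. by rewrite /sden /qnorm2 /im2 /qmul /qone !qcE; ring. Qed.

Lemma sdenE2 q : sden q = N2 (qone R + q) * N2 (qone R - q).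
Proof. by rewrite /sden /qnorm2 /qmul /qone !qcE; ring. Qed.

Lemma sden_gt0 q : inB q -> 0 < sden q.
Proof.
move=> hq; rewrite sdenE ltr_wpDr ?mulr_ge0 ?im2_ge0 //.
by rewrite exprn_gt0 // subr_gt0.
Qed.

(** Only the real part of [v], the length of its imaginary part and its radial component [imdot q v]
    enter the speed. *)
Lemma gqE q v : gq q v = (sden q * qc v 0 ^+ 2 + (1 - N2 q) ^+ 2 * im2 v
  + 4 * imdot q v ^+ 2) / (sden q * (1 - N2 q) ^+ 2).
Proof.
rewrite /gq /slice_metric -/(sden q); congr (_ / _).
rewrite -qnorm2E sdenE /imdot /im2 /qnorm2 /qmul !qcE; ring.
Qed.

Lemma onepm_gt0 q : inB q -> 0 < N2 (qone R + q) /\ 0 < N2 (qone R - q).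
Proof.
move=> /sden_gt0; rewrite sdenE2 => h.
have h1 := qnorm2_ge0 (qone R + q); have h2 := qnorm2_ge0 (qone R - q).
by split; rewrite lt0r ?h1 ?h2 andbT; apply/eqP => e; move: h; rewrite e ?mul0r ?mulr0 ltxx.
Qed.

Lemma axis_gap_ge0 q : 0 <= axis_gap q.
Proof. by rewrite /axis_gap divr_ge0 ?sqr_ge0 // mulr_ge0 // im2_ge0. Qed.

Lemma axis_gap1 q : inB q -> 1 + axis_gap q = sden q / (1 - N2 q) ^+ 2.
Proof.
rewrite /inB -subr_gt0 => hq; rewrite sdenE /axis_gap.
by field; rewrite gt_eqF.
Qed.

(** The numerators of the next two bounds. Times [im2 q], the first one is the square of the radial
    numerator plus a multiple of the Cauchy-Schwarz defect of the imaginary parts, which is the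
    rotational part of the speed. *)
Let speed_gap q v : sden q * qc v 0 ^+ 2 + (1 - N2 q) ^+ 2 * im2 v
  + 4 * imdot q v ^+ 2
  - ((1 + N2 q - 2 * qc q 0 ^+ 2) * qc v 0 - 2 * qc q 0 * imdot q v) ^+ 2 >= 0 /\
  (2 * qc q 0 * im2 q * qc v 0 + (1 + N2 q - 2 * qc q 0 ^+ 2) * imdot q v) ^+ 2 <=
  im2 q * (sden q * qc v 0 ^+ 2 + (1 - N2 q) ^+ 2 * im2 v
  + 4 * imdot q v ^+ 2
  - ((1 + N2 q - 2 * qc q 0 ^+ 2) * qc v 0 - 2 * qc q 0 * imdot q v) ^+ 2).
Proof.
set X := (X in X >= 0 /\ _); set B := (X in X ^+ 2 <= _).
have cs : 0 <= im2 q * im2 v - imdot q v ^+ 2.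
  have -> : im2 q * im2 v - imdot q v ^+ 2 =
    (qc q 1 * qc v 2 - qc q 2 * qc v 1) ^+ 2 + (qc q 1 * qc v 3 - qc q 3 * qc v 1) ^+ 2
    + (qc q 2 * qc v 3 - qc q 3 * qc v 2) ^+ 2.
    by rewrite /im2 /imdot; ring.
  by rewrite !addr_ge0 ?sqr_ge0.
have E : im2 q * X = B ^+ 2 + (1 - N2 q) ^+ 2 * (im2 q * im2 v - imdot q v ^+ 2).
  rewrite /X /B sdenE qnorm2_im; move: (im2 q) (im2 v) (imdot q v) (qc q 0) (qc v 0).
  by move=> a b c d e; ring.
have le2 : B ^+ 2 <= im2 q * X.
  by rewrite E lerDl mulr_ge0 // sqr_ge0.
split=> //.
(* On the axis one cannot divide by [im2 q], but there [X] is visibly nonnegative. *)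
have [y0|y0] := eqVneq (im2 q) 0.
  have p0 : imdot q v = 0.
    by apply/eqP; rewrite -sqrf_eq0 eq_le sqr_ge0 andbT; move: cs; rewrite y0 mul0r sub0r oppr_ge0.
  have -> : X = (1 - N2 q) ^+ 2 * im2 v.
    by rewrite /X sdenE qnorm2_im y0 p0; ring.
  by rewrite mulr_ge0 ?sqr_ge0 ?im2_ge0.
rewrite -(@pmulr_rge0 _ (im2 q)); last by rewrite lt0r y0 im2_ge0.
by apply: le_trans le2; exact: sqr_ge0.
Qed.

Lemma d_axis_coord_le q v : inB q ->
  (1 + axis_gap q) * d_axis_coord q v ^+ 2 <= gq q v.
Proof.
move=> hq; have D0 := sden_gt0 hq; have [h1 _] := speed_gap q v.
rewrite axis_gap1 // gqE /d_axis_coord.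
rewrite /inB -subr_gt0 in hq; rewrite -subr_ge0.
set X := _ - _ ^+ 2 in h1.
set D := sden q in D0 X h1 *; set m := 1 - N2 q in hq X h1 *.
have -> : forall a b, a / (D * m ^+ 2) - D / m ^+ 2 * (b / D) ^+ 2 =
   (a - b ^+ 2) / (D * m ^+ 2).
  by move=> a b; field; rewrite !gt_eqF.
by rewrite divr_ge0 // mulr_ge0 ?sqr_ge0 // ltW.
Qed.

(** Since [axis_gap = sinh (2 r)^2], the left side is [16 sinh(2r)^2 cosh(2r)^2 dr^2]; this is
    [dr^2 <= g - (1 + axis_gap) ds^2] in a form that makes sense on the axis. *)
Lemma d_axis_gap_le q v : inB q -> d_axis_gap q v ^+ 2 <=
  16 * (axis_gap q * (1 + axis_gap q)) *
  (gq q v - (1 + axis_gap q) * d_axis_coord q v ^+ 2).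
Proof.
move=> hq; have D0 := sden_gt0 hq; have [_ h1] := speed_gap q v.
rewrite axis_gap1 // gqE /d_axis_coord /d_axis_gap /axis_gap.
rewrite /inB -subr_gt0 in hq; rewrite -subr_ge0 in h1; rewrite -subr_ge0.
set D := sden q in D0 h1 *; set m := 1 - N2 q in hq h1 *.
set B := 2 * qc q 0 * im2 q * _ + _ in h1 *.
set b := (1 + N2 q - 2 * qc q 0 ^+ 2) * qc v 0 - _ in h1 *.
set a := D * _ + _ + _ in h1 *.
have -> : 16 * (4 * im2 q / m ^+ 2 * (D / m ^+ 2)) *
    (a / (D * m ^+ 2) - D / m ^+ 2 * (b / D) ^+ 2) - (8 * B / m ^+ 3) ^+ 2
  = 64 * (im2 q * (a - b ^+ 2) - B ^+ 2) / m ^+ 6.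
  by field; rewrite !gt_eqF.
by rewrite divr_ge0 ?exprn_ge0 ?(ltW hq) // mulr_ge0.
Qed.

Section Along.
Variables (c : R -> quat R) (t : R) (v : quat R).
Hypotheses (cB : inB (c t)) (cv : is_derive t 1 c v).

Let dc i : is_derive t 1 (fun s => qc (c s) i) (qc v i) := is_derive_qc i cv.

Lemma is_derive_im2 : is_derive t 1 (fun s => im2 (c s)) (2 * imdot (c t) v).
Proof.
have d i := dc i.
under eq_fun do rewrite /im2 !expr2.
by apply: is_derive_eq; rewrite /GRing.scale /= /imdot; ring.
Qed.

Lemma is_derive_qnorm2 : is_derive t 1 (fun s => N2 (c s))
  (2 * (qc (c t) 0 * qc v 0 + imdot (c t) v)).
Proof.
have d := dc 0; have di := is_derive_im2.
under eq_fun do rewrite qnorm2_im expr2.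
by apply: is_derive_eq; rewrite /GRing.scale /=; ring.
Qed.

Lemma is_derive_axis_gap :
  is_derive t 1 (fun s => axis_gap (c s)) (d_axis_gap (c t) v).
Proof.
have m0 : 1 - N2 (c t) != 0 by rewrite gt_eqF // subr_gt0.
have dn := is_derive_qnorm2; have di := is_derive_im2.
have dm : is_derive t 1 (fun s => 1 - N2 (c s))
    (- (2 * (qc (c t) 0 * qc v 0 + imdot (c t) v))).
  by apply: is_derive_eq; rewrite ?/GRing.scale /=; ring.
have dV := @is_deriveV _ (fun s => 1 - N2 (c s)) _ _ _ m0 dm.
have e q : axis_gap q = 4 * im2 q * ((1 - N2 q)^-1 * (1 - N2 q)^-1).
  by rewrite /axis_gap expr2 invfM.
under eq_fun do rewrite e.
apply: is_derive_eq; rewrite /GRing.scale /= /d_axis_gap; move: m0; rewrite qnorm2_im => m0.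
by field.
Qed.

Lemma is_derive_axis_coord :
  is_derive t 1 (fun s => axis_coord (c s)) (d_axis_coord (c t) v).
Proof.
have [p0 n0] := onepm_gt0 cB.
have nE (e : R) q : e ^+ 2 = 1 -> N2 (qone R + e *: q) = 1 + 2 * (e * qc q 0) + N2 q.
  move=> e1; have -> : N2 (qone R + e *: q) = 1 + 2 * (e * qc q 0) + e ^+ 2 * N2 q.
    by rewrite /qnorm2 /qone !qcE; ring.
  by rewrite e1 mul1r.
have pE q : N2 (qone R + q) = 1 + 2 * qc q 0 + N2 q.
  by rewrite -[q in LHS]scale1r nE ?expr1n // mul1r.
have mE q : N2 (qone R - q) = 1 - 2 * qc q 0 + N2 q.
  by rewrite -[- q]scaleN1r nE ?sqrrN ?expr1n // mulN1r mulrN.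
have d1 (e : R) : is_derive t 1 (fun s => 1 + e * qc (c s) 0 + N2 (c s))
   (e * qc v 0 + 2 * (qc (c t) 0 * qc v 0 + imdot (c t) v)).
  have d0 := dc 0; have dn := is_derive_qnorm2.
  by apply: is_derive_eq; rewrite /GRing.scale /=; ring.
have hp : 0 < 1 + 2 * qc (c t) 0 + N2 (c t) by rewrite -pE.
have hm : 0 < 1 + (- 2) * qc (c t) 0 + N2 (c t) by rewrite mulNr -mE.
have dp := @is_derive1_comp _ (@ln R) (fun s => 1 + 2 * qc (c s) 0 + N2 (c s))
  _ _ _ (is_derive1_ln hp) (d1 2).
have dm := @is_derive1_comp _ (@ln R) (fun s => 1 + (- 2) * qc (c s) 0 + N2 (c s))
  _ _ _ (is_derive1_ln hm) (d1 (- 2)).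
have dd : is_derive t 1 (fun s => 4^-1 * (ln (1 + 2 * qc (c s) 0 + N2 (c s)) -
    ln (1 + (- 2) * qc (c s) 0 + N2 (c s)))) _ := is_deriveZ 4^-1 (is_deriveB dp dm).
have -> : d_axis_coord (c t) v =
    4^-1 * (((1 + 2 * qc (c t) 0 + N2 (c t))^-1 *
       (2 * qc v 0 + 2 * (qc (c t) 0 * qc v 0 + imdot (c t) v))) -
     ((1 + (- 2) * qc (c t) 0 + N2 (c t))^-1 *
       (- 2 * qc v 0 + 2 * (qc (c t) 0 * qc v 0 + imdot (c t) v)))).
  rewrite /d_axis_coord sdenE2 pE mE -mulNr.
  by field; rewrite !gt_eqF.
(* The logarithm of the quotient splits where both norms are positive, in particular as long as the
   curve stays in the ball. *)
have hB : \forall s \near t, inB (c s).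
  have cc : {for t, continuous c}.
    apply: differentiable_continuous; apply/derivable1_diffP; by case: cv.
  exact: cc _ (inB_near cB).
apply: near_eq_is_derive dd.
near=> s.
have sB : inB (c s) by near: s.
have [p1 n1] := onepm_gt0 sB.
rewrite /axis_coord ln_div ?posrE // pE mE -mulNr; by [].
Unshelve. all: by end_near. Qed.

End Along.
End AxisCoordinates.

(** * Curves of speed at most 1 *)

Section SlowCurves.
Variable R : realType.
Local Notation "x ** y" := (qmul x y) (at level 40, left associativity).
Local Notation N2 := (@qnorm2 R).
Local Notation th := (@Defs.tanh R).
Implicit Types (q v : quat R) (c : R -> quat R).

Lemma lipschitz_of_derive (g : R -> R) (C a b : R) :
  (forall x : R, exists2 d : R, is_derive x 1 g d & `|d| <= C) ->
  `|g b - g a| <= C * `|b - a|.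
Proof.
move=> h; apply: (@mvt_dist_le R g (fun x => 'D_1 g x)) => x _.
by have [d [gd <-] dC] := h x; split=> //; exact: derivableP.
Qed.

(** An upper bound on the speed is all that Lipschitz estimates need; curves run over the whole
    line, which avoids one-sided derivatives. *)
Definition slow c := forall t, inB (c t) /\
  exists2 v, is_derive (t : R) 1 c v & gq (c t) v <= 1.

Lemma slow_axis_coord c (a b : R) : slow c ->
  `|axis_coord (c b) - axis_coord (c a)| <= `|b - a|.
Proof.
move=> cs; rewrite -[leRHS]mul1r.
apply: (@lipschitz_of_derive (fun t => axis_coord (c t))) => t.
have [cB [v cv g1]] := cs t; exists (d_axis_coord (c t) v).
  exact: is_derive_axis_coord.
have h := d_axis_coord_le v cB; have h0 := axis_gap_ge0 (c t).
rewrite -(@ler_pXn2r _ 2) ?nnegrE // expr1n -normrX ger0_norm ?sqr_ge0 //.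
apply: le_trans g1; apply: le_trans h.
by rewrite ler_peMl ?sqr_ge0 // lerDl.
Qed.

(* [gap_dist d] regularises [asinh (sqrt y) / 2] at [y = 0]. *)
Definition gap_dist (d y : R) : R :=
  2^-1 * ln (Num.sqrt (y + d ^+ 2) + Num.sqrt (1 + y)).

Lemma is_derive_gap_dist (d y : R) : 0 < d -> 0 <= y ->
  is_derive y 1 (gap_dist d) (4 * (Num.sqrt (y + d ^+ 2) * Num.sqrt (1 + y)))^-1.
Proof.
move=> d0 y0.
have h1 : 0 < y + d ^+ 2 by rewrite ltr_wpDl // exprn_gt0.
have h2 : 0 < 1 + y by rewrite ltr_wpDr.
have s1 : 0 < Num.sqrt (y + d ^+ 2) by rewrite sqrtr_gt0.
have s2 : 0 < Num.sqrt (1 + y) by rewrite sqrtr_gt0.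
have d1 : is_derive y 1 (fun x : R => x + d ^+ 2) 1.
  by have := is_deriveD (is_derive_id y 1) (is_derive_cst (d ^+ 2) y 1); rewrite addr0.
have d2 : is_derive y 1 (fun x : R => 1 + x) 1.
  by have := is_deriveD (is_derive_cst (1 : R) y 1) (is_derive_id y 1); rewrite add0r.
have e1 := @is_derive1_comp _ (@Num.sqrt R) (fun x : R => x + d ^+ 2) _ _ _
  (is_derive1_sqrt h1) d1.
have e2 := @is_derive1_comp _ (@Num.sqrt R) (fun x : R => 1 + x) _ _ _
  (is_derive1_sqrt h2) d2.
have e3 : is_derive y 1 (fun x : R => Num.sqrt (x + d ^+ 2) + Num.sqrt (1 + x)) _
  := is_deriveD e1 e2.
have h3 : 0 < Num.sqrt (y + d ^+ 2) + Num.sqrt (1 + y) by rewrite addr_gt0.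
have e4 := @is_derive1_comp _ (@ln R)
  (fun x : R => Num.sqrt (x + d ^+ 2) + Num.sqrt (1 + x)) _ _ _ (is_derive1_ln h3) e3.
have e5 : is_derive y 1 (gap_dist d) _ := is_deriveZ 2^-1 e4.
apply: is_derive_eq e5 _; rewrite /GRing.scale /=.
move: (Num.sqrt _) (Num.sqrt _) s1 s2 {h3 e1 e2 e3 e4} => x z x0 z0.
by field; rewrite !gt_eqF // addr_gt0.
Qed.

(** The slope of [gap_dist d] is at most that of [asinh (sqrt y) / 2], so the bound [dr^2 <= g]
    survives the regularisation. *)
Lemma slow_gap_dist c (d a b : R) : 0 < d -> slow c ->
  `|gap_dist d (axis_gap (c b)) - gap_dist d (axis_gap (c a))| <= `|b - a|.
Proof.
move=> d0 cs; rewrite -[leRHS]mul1r.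
apply: (@lipschitz_of_derive (fun t => gap_dist d (axis_gap (c t)))) => t.
have [cB [v cv g1]] := cs t; have y0 := axis_gap_ge0 (c t).
have e1 := is_derive_gap_dist d0 y0.
have e2 := @is_derive1_comp _ (gap_dist d) (fun t => axis_gap (c t)) _ _ _ e1
  (is_derive_axis_gap cB cv).
eexists; first exact: e2.
have h1 : 0 < axis_gap (c t) + d ^+ 2 by rewrite ltr_wpDl // exprn_gt0.
have h2 : 0 < 1 + axis_gap (c t) by rewrite ltr_wpDr.
rewrite -(@ler_pXn2r _ 2) ?nnegrE // expr1n -normrX ger0_norm ?sqr_ge0 //.
move: (d_axis_gap (c t) v) (d_axis_gap_le v cB) => D hD.
rewrite exprMn exprVn !exprMn !sqr_sqrtr ?(ltW h1) ?(ltW h2) //.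
rewrite ler_pdivrMl; last by rewrite !mulr_gt0 // exprn_gt0.
rewrite mulr1; apply: le_trans hD _.
have h3 : 0 <= (1 + axis_gap (c t)) * d_axis_coord (c t) v ^+ 2.
  by rewrite mulr_ge0 ?sqr_ge0 // ltW.
have h4 : 0 <= d ^+ 2 by exact: sqr_ge0.
apply: (@le_trans _ _ (16 * (axis_gap (c t) * (1 + axis_gap (c t))) * 1)).
  apply: ler_wpM2l; first exact: mulr_ge0 _ (mulr_ge0 y0 (ltW h2)).
  by move: g1 h3; lra.
rewrite mulr1; have -> : 4 ^+ 2 = 16 :> R by ring.
by rewrite ler_wpM2l // ler_wpM2r ?(ltW h2) // lerDl.
Qed.

(** A curve of speed at most 1 starting on the axis is within [r] of it at time [r], in exponential
    form since [asinh x = ln (x + sqrt (1 + x^2))]. The regularisation costs a factor [1 + d],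
    removed by letting [d] tend to 0. *)
Lemma slow_axis_gap c (r : R) : slow c -> axis_gap (c 0) = 0 -> 0 <= r ->
  Num.sqrt (axis_gap (c r)) + Num.sqrt (1 + axis_gap (c r)) <= expR (2 * r).
Proof.
move=> cs c0 r0; set y := axis_gap (c r).
have y0 : 0 <= y := axis_gap_ge0 _.
have key d : 0 < d -> Num.sqrt y + Num.sqrt (1 + y) <= (1 + d) * expR (2 * r).
  move=> d0; have := slow_gap_dist 0 r d0 cs.
  rewrite c0 -/y subr0 (ger0_norm r0) ler_norml => /andP[_].
  rewrite /gap_dist add0r addr0 sqrtr_sqr (gtr0_norm d0) sqrtr1 => h.
  have h1 : 0 < y + d ^+ 2 by rewrite ltr_wpDl // exprn_gt0.
  have h3 : 0 < Num.sqrt (y + d ^+ 2) + Num.sqrt (1 + y).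
    by rewrite ltr_wpDr ?sqrtr_ge0 ?sqrtr_gt0.
  have h4 : 0 < d + 1 by rewrite addr_gt0.
  have {h} : ln (Num.sqrt (y + d ^+ 2) + Num.sqrt (1 + y)) <= ln (d + 1) + 2 * r by lra.
  rewrite -ler_expR expRD !lnK ?posrE // [1 + d]addrC; apply: le_trans.
  by rewrite lerD2r ler_sqrt // ?lerDl ?sqr_ge0 // ltW.
apply/ler_addgt0Pr => e e0.
have E0 := expR_gt0 (2 * r).
(* This [d] makes the excess [d * expR (2 * r)] equal to [e]. *)
apply: le_trans (key (e / expR (2 * r)) (divr_gt0 e0 E0)) _.
by rewrite mulrDl mul1r divfK // gt_eqF.
Qed.

Lemma gap_sqrt_inj (y z : R) : 0 <= y -> 0 <= z ->
  Num.sqrt y + Num.sqrt (1 + y) <= Num.sqrt z + Num.sqrt (1 + z) -> y <= z.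
Proof.
move=> y0 z0; apply: contra_leT; rewrite -ltNge => zy.
by apply: ltrD; rewrite ltr_sqrt ?ltrD2l //; lra.
Qed.

(** The speed is exactly 1 in both cases, along the axis and perpendicular to it at 0. *)
Lemma slow_ray (I : quat R) : N2 I = 1 -> I = qone R \/ qc I 0 = 0 ->
  slow (fun t => th t *: I).
Proof.
move=> I1 hI t; have h := sqr_tanh_lt1 t.
have hB : inB (th t *: I) by rewrite /inB qnorm2Z I1 mulr1.
split=> //; exists ((1 - th t ^+ 2) *: I).
  apply: is_derive_quat => i _; under eq_fun do rewrite qcZ.
  have dt := is_derive_tanh t.
  by apply: is_derive_eq; rewrite /GRing.scale /= qcZ; ring.
rewrite gqE sdenE qnorm2Z I1; set s := th t in h hB *.
have -> : im2 (s *: I) = s ^+ 2 * im2 I by rewrite /im2 !qcZ; ring.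
have -> : im2 ((1 - s ^+ 2) *: I) = (1 - s ^+ 2) ^+ 2 * im2 I.
  by rewrite /im2 !qcZ; ring.
have -> : imdot (s *: I) ((1 - s ^+ 2) *: I) = s * (1 - s ^+ 2) * im2 I.
  by rewrite /im2 /imdot !qcZ; ring.
have m0 : 0 < 1 - s ^+ 2 by rewrite subr_gt0.
have p0 : 0 < 1 + s ^+ 2 by rewrite ltr_wpDr ?sqr_ge0.
have I2 := qnorm2_im I; rewrite I1 in I2.
case: hI => [->|I0].
  have -> : im2 (qone R) = 0 by rewrite /im2 /qone !qcE; ring.
  rewrite qcZ /qone qcE; rewrite le_eqVlt; apply/orP; left; apply/eqP.
  by field; rewrite gt_eqF.
have -> : im2 I = 1 by rewrite I2 I0; ring.
rewrite qcZ I0 le_eqVlt; apply/orP; left; apply/eqP.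
have e : (1 - s ^+ 2) ^+ 2 + 4 * s ^+ 2 = (1 + s ^+ 2) ^+ 2 by ring.
rewrite !mulr1 e.
by field; rewrite !gt_eqF.
Qed.

(** At time [pi] these half turns are conjugation by i and by j. A rotation about the axis has
    squared speed at most [im2 / sden <= 1/4], uniformly on the ball. *)
Lemma rot_slow q : inB q ->
  slow (fun t => mkq (qc q 0) (qc q 1) (qc q 2 * cos t - qc q 3 * sin t)
    (qc q 2 * sin t + qc q 3 * cos t)) /\
  slow (fun t => mkq (qc q 0) (qc q 1 * cos t - qc q 3 * sin t) (qc q 2)
    (qc q 1 * sin t + qc q 3 * cos t)).
Proof.
move=> hq.
have gen (c : R -> quat R) (t : R) v : N2 (c t) = N2 q -> is_derive t 1 c v ->
    qc v 0 = 0 -> imdot (c t) v = 0 -> im2 v <= im2 (c t) ->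
    inB (c t) /\ (exists2 v, is_derive (t : R) 1 c v & gq (c t) v <= 1).
  move=> nq cv v0 cd le_v.
  have cB : inB (c t) by rewrite /inB nq.
  split=> //; exists v => //; have D0 := sden_gt0 cB.
  have m0 : 0 < 1 - N2 (c t) by rewrite subr_gt0.
  rewrite gqE v0 cd expr0n /= !mulr0 add0r addr0.
  rewrite ler_pdivrMr ?mulr_gt0 ?exprn_gt0 // mul1r mulrC ler_wpM2r ?sqr_ge0 //.
  apply: le_trans le_v _; rewrite sdenE.
  have := im2_ge0 (c t); have := sqr_ge0 (1 - N2 (c t)); lra.
split=> t; have cs := cos2Dsin2 t.
- apply: (gen (fun t => mkq (qc q 0) (qc q 1) (qc q 2 * cos t - qc q 3 * sin t)
    (qc q 2 * sin t + qc q 3 * cos t)) t (mkq 0 0 (- qc q 2 * sin t - qc q 3 * cos t)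
    (qc q 2 * cos t - qc q 3 * sin t))).
  + rewrite /qnorm2 !qcE -[in RHS](mulr1 (qc q 2 ^+ 2)) -[in RHS](mulr1 (qc q 3 ^+ 2)).
    by rewrite -cs; ring.
  + apply: is_derive_quat => -[|[|[|[|//]]]] _; under eq_fun do rewrite qcE;
      by apply: is_derive_eq; rewrite /GRing.scale /= qcE; ring.
  + by rewrite qcE.
  + by rewrite /imdot !qcE; ring.
  + rewrite /im2 !qcE -subr_ge0; apply: le_trans (sqr_ge0 (qc q 1)) _.
    by rewrite le_eqVlt; apply/orP; left; apply/eqP; ring.
- apply: (gen (fun t => mkq (qc q 0) (qc q 1 * cos t - qc q 3 * sin t) (qc q 2)
    (qc q 1 * sin t + qc q 3 * cos t)) t (mkq 0 (- qc q 1 * sin t - qc q 3 * cos t) 0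
    (qc q 1 * cos t - qc q 3 * sin t))).
  + rewrite /qnorm2 !qcE -[in RHS](mulr1 (qc q 1 ^+ 2)) -[in RHS](mulr1 (qc q 3 ^+ 2)).
    by rewrite -cs; ring.
  + apply: is_derive_quat => -[|[|[|[|//]]]] _; under eq_fun do rewrite qcE;
      by apply: is_derive_eq; rewrite /GRing.scale /= qcE; ring.
  + by rewrite qcE.
  + by rewrite /imdot !qcE; ring.
  + rewrite /im2 !qcE -subr_ge0; apply: le_trans (sqr_ge0 (qc q 2)) _.
    by rewrite le_eqVlt; apply/orP; left; apply/eqP; ring.
Qed.

End SlowCurves.

(** * Maps preserving the metric, and polar coordinates about the axis *)

Section InfinitesimalIsometries.
Variable R : realType.
Local Notation "x ** y" := (qmul x y) (at level 40, left associativity).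
Local Notation N2 := (@qnorm2 R).
Local Notation th := (@Defs.tanh R).
Implicit Types (q v I : quat R) (f h : quat R -> quat R) (s t r : R).

(** Just enough of an isometry to push [slow] curves forward; stable under composition and shared by
    inverses of isometries. *)
Definition inf_isometry f := forall q, inB q ->
  [/\ inB (f q), differentiable f q & forall v, gq (f q) ('D_v f q) = gq q v].

Lemma inf_isometry_slow f (c : R -> quat R) : inf_isometry f -> slow c ->
  slow (fun t => f (c t)).
Proof.
move=> fi cs t; have [cB [v cv g1]] := cs t; have [fB fd fg] := fi _ cB.
split=> //; exists ('D_v f (c t)); first exact: is_derive_comp_curve.
by rewrite fg.
Qed.

Lemma inf_isometry_comp f h : inf_isometry f -> inf_isometry h ->
  inf_isometry (fun q => h (f q)).
Proof.
move=> fi hi q hq; have [fB fd fg] := fi _ hq; have [hB hd hg] := hi _ fB.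
split=> //.
  exact: (@differentiable_comp _ _ _ _ f h).
by move=> v; rewrite derive_comp // hg fg.
Qed.

Lemma isometry_inf_isometry f : isometry_B f -> inf_isometry f.
Proof.
move=> [[fB [fs _]] fg] q hq; split; first exact: fB.
  exact: smooth_on_B_differentiable.
by move=> v; exact: fg.
Qed.

(** Differentiating [f (h q) = q] turns preservation of the metric by [f] into preservation by
    [h]. *)
Lemma isometry_inverse f : isometry_B f -> exists h,
  [/\ inf_isometry h, forall q, inB q -> h (f q) = q &
      forall q, inB q -> f (h q) = q].
Proof.
move=> fi; have fi' := isometry_inf_isometry fi.
case: fi => [[fB [fs [h [hB [hs hf]]]]] _].
exists h; split; [move=> q hq | by move=> q /hf [] | by move=> q /hf []].
have hq' := hB q hq; have hd := smooth_on_B_differentiable hs hq.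
have [_ fd fg] := fi' _ hq'.
split=> // v; rewrite -fg -derive_comp //.
rewrite (hf q hq).2; congr (gq q _).
have e : 'D_v (fun x => f (h x)) q = 'D_v id q.
  apply: near_eq_derive; near=> p.
  have pB : inB p by near: p; exact: inB_near.
  exact: (hf p pB).2.
by rewrite e derive_id.
Unshelve. all: by end_near. Qed.

Lemma act_inf_isometry (u : quat R) (e t : R) : inSp1 u -> is_sign e ->
  inf_isometry (act u e t).
Proof.
move=> hu he; apply: isometry_inf_isometry.
by case: (act_orient_pres_isometry t hu he).
Qed.

Lemma act_boost t q : act (qone R) 1 t q = boost (th t) q.
Proof. by rewrite actE qconj1 qmul1r qmul1l scale1r. Qed.

Lemma boost_inf_isometry t : inf_isometry (boost (th t)).
Proof.
have -> : boost (th t) = act (qone R) 1 t by apply/funext => q; rewrite act_boost.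
by apply: act_inf_isometry; [exact: inSp1_1 | left].
Qed.

(** With [w = 1 + s q], the sum and difference of 1 and the boost are [(1 + s) w^-1 (1 + q)] and
    [(1 - s) w^-1 (1 - q)]: in the coordinate [(1 + q) / (1 - q)] a boost is a dilation. *)
Lemma boost_onepm s q : s ^+ 2 < 1 -> inB q ->
  N2 (qone R + boost s q) =
    (1 + s) ^+ 2 * (N2 (qone R + q) / N2 (qone R + s *: q)) /\
  N2 (qone R - boost s q) =
    (1 - s) ^+ 2 * (N2 (qone R - q) / N2 (qone R + s *: q)).
Proof.
move=> hs hq; have w0 := boost_den_neq0 hs hq.
have wb : (qone R + s *: q) ** boost s q = q + qreal s.
  by rewrite /boost qmulA qmulVr // qmul1l.
have w0' : N2 (qone R + s *: q) != 0 by rewrite qnorm2_eq0.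
split; apply: (mulfI w0'); rewrite -qnorm2M.
  transitivity ((1 + s) ^+ 2 * N2 (qone R + q)); last by field.
  by rewrite qmulDr qmul1r wb -qnorm2Z; congr (N2 _); rewrite /qreal; qring.
transitivity ((1 - s) ^+ 2 * N2 (qone R - q)); last by field.
by rewrite qmulBr qmul1r wb -qnorm2Z; congr (N2 _); rewrite /qreal; qring.
Qed.

Lemma axis_coord_boost t q : inB q ->
  axis_coord (boost (th t) q) = t + axis_coord q.
Proof.
move=> hq; have hs := sqr_tanh_lt1 t.
have [bp bm] := boost_onepm hs hq.
rewrite /axis_coord bp bm -[t in RHS](ln_tanh t).
have [p0 n0] := onepm_gt0 hq.
have w0 : 0 < N2 (qone R + th t *: q) by rewrite qnorm2_gt0 boost_den_neq0.
have h1 : 0 < 1 + th t by have := tanh_gtN1 t; lra.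
have h2 : 0 < 1 - th t by have := tanh_lt1 t; lra.
have -> : (1 + th t) ^+ 2 * (N2 (qone R + q) / N2 (qone R + th t *: q)) /
    ((1 - th t) ^+ 2 * (N2 (qone R - q) / N2 (qone R + th t *: q))) =
  ((1 + th t) / (1 - th t)) * ((1 + th t) / (1 - th t)) *
  (N2 (qone R + q) / N2 (qone R - q)).
  by field; rewrite !gt_eqF.
have h3 : 0 < (1 + th t) / (1 - th t) by rewrite divr_gt0.
rewrite !lnM ?posrE ?mulr_gt0 ?divr_gt0 ?invr_gt0 //.
by field.
Qed.

Lemma axis_gap_boost s q : s ^+ 2 < 1 -> inB q -> axis_gap (boost s q) = axis_gap q.
Proof.
move=> hs hq; apply: (@addrI _ 1).
rewrite !axis_gap1 ?sdenE2 //; last exact: boost_inB.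
have [-> ->] := boost_onepm hs hq.
rewrite qnorm2_boost // qnorm2V.
have w0 : 0 < N2 (qone R + s *: q) by rewrite qnorm2_gt0 boost_den_neq0.
have m0 : 0 < 1 - N2 q by rewrite subr_gt0.
have s0 : 0 < 1 - s ^+ 2 by rewrite subr_gt0.
by field; rewrite !gt_eqF.
Qed.

Lemma axis_coord_real t : axis_coord (qreal (th t)) = t.
Proof.
have h1 : 0 < 1 + th t by have := tanh_gtN1 t; lra.
have h2 : 0 < 1 - th t by have := tanh_lt1 t; lra.
rewrite /axis_coord.
have -> : N2 (qone R + qreal (th t)) = (1 + th t) * (1 + th t).
  by rewrite /qnorm2 /qone /qreal /qone !qcE; ring.
have -> : N2 (qone R - qreal (th t)) = (1 - th t) * (1 - th t).
  by rewrite /qnorm2 /qone /qreal /qone !qcE; ring.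
rewrite -mulf_div lnM ?posrE ?divr_gt0 // -[RHS](ln_tanh t).
by field.
Qed.

Lemma axis_gap_real x : axis_gap (qreal x : quat R) = 0.
Proof. by rewrite /axis_gap /im2 /qreal /qone !qcE; ring. Qed.

Lemma real_inB x : x ^+ 2 < 1 -> inB (qreal x : quat R).
Proof. by rewrite /inB /qreal qnorm2Z qnorm2_1 mulr1. Qed.

Lemma im2_eq0 q : im2 q = 0 -> q = qreal (qc q 0).
Proof.
move/eqP; rewrite /im2 !paddr_eq0 ?addr_ge0 ?sqr_ge0 // !sqrf_eq0.
case/andP=> /andP[/eqP h1 /eqP h2] /eqP h3.
by apply: quatP; rewrite /qreal /qone !qcE ?h1 ?h2 ?h3; ring.
Qed.

Lemma axis_gap_eq0 q : inB q -> axis_gap q = 0 -> q = qreal (th (axis_coord q)).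
Proof.
move=> hq /eqP; rewrite /axis_gap !mulf_eq0 invr_eq0 sqrf_eq0.
have m0 : 1 - N2 q != 0 by rewrite gt_eqF // subr_gt0.
have -> : (4 == 0 :> R) = false by apply/negbTE.
rewrite (negbTE m0) orbF /= => /eqP y0.
have qE := im2_eq0 y0.
have hx : qc q 0 ^+ 2 < 1 by move: hq; rewrite /inB qnorm2_im y0 addr0.
have [t tE] := tanh_surj hx.
by rewrite {2}qE -tE axis_coord_real tE -qE.
Qed.

Definition imag_unit I := N2 I = 1 /\ qc I 0 = 0.

Lemma axis_gap_ray I t : imag_unit I ->
  axis_gap (th t *: I) = 4 * th t ^+ 2 / (1 - th t ^+ 2) ^+ 2.
Proof.
move=> [I1 I0]; rewrite /axis_gap qnorm2Z I1 mulr1; congr (_ / _).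
have := qnorm2_im I; rewrite I1 I0 => h.
have -> : im2 (th t *: I) = th t ^+ 2 * im2 I by rewrite /im2 !qcZ; ring.
by rewrite -(_ : 1 = im2 I) ?mulr1 // h; ring.
Qed.

Lemma tanh_ge0 t : 0 <= t -> 0 <= th t.
Proof.
move=> t0; rewrite tanhE; have : 1 <= expR (2 * t).
  by rewrite -expR0 ler_expR mulr_ge0.
by move=> h; rewrite divr_ge0 ?subr_ge0 // addr_ge0 // expR_ge0.
Qed.

(** So [th t *: I] is at distance exactly [t] from the axis: these rays attain the bound of
    [slow_axis_gap]. *)
Lemma sqrt_gap_ray I t : imag_unit I -> 0 <= t ->
  Num.sqrt (axis_gap (th t *: I)) + Num.sqrt (1 + axis_gap (th t *: I)) = expR (2 * t).
Proof.
move=> hI t0; rewrite axis_gap_ray //.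
have e1 : (1 + th t) / (1 - th t) = expR (2 * t).
  rewrite tanhE; have := expR_gt0 (2 * t); move: (expR _) => a a0.
  by field; rewrite !gt_eqF //; lra.
have := tanh_ge0 t0; have := tanh_lt1 t; move: e1; move: (th t) => s e1 s1 s0.
have m0 : 0 < 1 - s ^+ 2 by nra.
have -> : 4 * s ^+ 2 / (1 - s ^+ 2) ^+ 2 = (2 * s / (1 - s ^+ 2)) ^+ 2.
  by field; rewrite gt_eqF.
have -> : 1 + (2 * s / (1 - s ^+ 2)) ^+ 2 = ((1 + s ^+ 2) / (1 - s ^+ 2)) ^+ 2.
  by field; rewrite gt_eqF.
rewrite !sqrtr_sqr !ger0_norm -?e1; last 2 first.
- by rewrite divr_ge0 ?(ltW m0) // addr_ge0 ?sqr_ge0.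
- by rewrite divr_ge0 ?(ltW m0) // mulr_ge0.
by field; rewrite !gt_eqF //; lra.
Qed.

Lemma imag_polar q : qc q 0 = 0 -> inB q -> exists r I,
  [/\ 0 <= r, imag_unit I & q = th r *: I].
Proof.
move=> q0 hq; have [->|qn0] := eqVneq q 0.
  exists 0, (mkq 0 1 0 0); split=> //; last by rewrite tanh0 scale0r.
  by split; rewrite /qnorm2 ?qcE //; ring.
have n0 : 0 < N2 q by rewrite qnorm2_gt0.
have y0 : 0 < Num.sqrt (N2 q) by rewrite sqrtr_gt0.
have h : Num.sqrt (N2 q) ^+ 2 < 1 by rewrite sqr_sqrtr ?qnorm2_ge0.
have [r rE] := tanh_surj h.
exists r, ((Num.sqrt (N2 q))^-1 *: q); split.
- rewrite leNgt; apply/negP => r0.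
  have h1 : 0 <= - r by lra.
  by have := tanh_ge0 h1; rewrite tanhN rE; lra.
- split; last by rewrite qcZ q0 mulr0.
  by rewrite qnorm2Z exprVn sqr_sqrtr ?qnorm2_ge0 // mulVf // gt_eqF.
- by rewrite scalerA rE mulfV ?scale1r // gt_eqF.
Qed.

Lemma axis_coord_eq0 q : inB q -> axis_coord q = 0 -> qc q 0 = 0.
Proof.
move=> hq /eqP; rewrite /axis_coord mulf_eq0 invr_eq0.
have -> : (4 == 0 :> R) = false by apply/negbTE.
have [p0 n0] := onepm_gt0 hq.
rewrite /= ln_eq0 ?divr_gt0 // => /eqP h.
have : N2 (qone R + q) = N2 (qone R - q).
  by rewrite -[LHS](divfK (negbT (gt_eqF n0))) h mul1r.
by rewrite /qnorm2 /qone !qcE; move: (qc q 0) (qc q 1) (qc q 2) (qc q 3) => a b c d; lra.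
Qed.

(** A boost by [- axis_coord q] moves the foot of the perpendicular to 0, which leaves a purely
    imaginary point. *)
Lemma axis_polar q : inB q -> exists r I,
  [/\ 0 <= r, imag_unit I & q = boost (th (axis_coord q)) (th r *: I)].
Proof.
move=> hq; set s := axis_coord q.
have hB := boost_inB (sqr_tanh_lt1 (- s)) hq.
have h0 : qc (boost (th (- s)) q) 0 = 0.
  by apply: axis_coord_eq0 => //; rewrite axis_coord_boost // addNr.
have [r [I [r0 hI e]]] := imag_polar h0 hB.
exists r, I; split=> //; rewrite -e -!act_boost act_comp; try exact: inSp1_1.
- by rewrite qmul1l mul1r !mul1r subrr act_id.
- by left.
- by left.
- by [].
Qed.

Section AxisRay.
Variables (I : quat R) (s : R).
Hypothesis hI : imag_unit I.

(** The perpendicular to the axis at the point of coordinate [s], carried there from 0 by a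
    boost. *)
Definition axis_ray (t : R) : quat R := boost (th s) (th t *: I).

Lemma ray_inB t : inB (th t *: I).
Proof. by rewrite /inB qnorm2Z hI.1 mulr1 sqr_tanh_lt1. Qed.

Lemma axis_ray_slow : slow axis_ray.
Proof.
apply: (inf_isometry_slow (boost_inf_isometry s)).
by apply: slow_ray; [exact: hI.1 | right; exact: hI.2].
Qed.

Lemma axis_ray0 : axis_ray 0 = qreal (th s).
Proof.
rewrite /axis_ray tanh0 scale0r /boost scaler0 addr0 add0r.
by rewrite -{1}(qmul1l (qreal _)) qmulA qmulVl ?qone_neq0 ?qmul1l.
Qed.

Lemma axis_ray_gap t : axis_gap (axis_ray t) = axis_gap (th t *: I).
Proof. by apply: axis_gap_boost; [exact: sqr_tanh_lt1 | exact: ray_inB]. Qed.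
End AxisRay.

Lemma ray_real_slow : slow (fun t => qreal (th t) : quat R).
Proof. by apply: slow_ray; [exact: qnorm2_1 | left]. Qed.

End InfinitesimalIsometries.

(** * Isometries preserve the axis *)

Section AxisIsPreserved.
Variable R : realType.
Local Notation "x ** y" := (qmul x y) (at level 40, left associativity).
Local Notation N2 := (@qnorm2 R).
Local Notation th := (@Defs.tanh R).
Implicit Types (q v I : quat R) (f h : quat R -> quat R) (s t r : R).

(* The involution [phi] moves points by a bounded amount, so [t - u t] is a
   bounded nondecreasing function, where [u t] is the axis coordinate of the
   image of the axis. Far out the image hugs the axis, which forces
   [u (u t) - t] to be small there; by monotonicity [u t = t] everywhere,
   and a unit speed curve with [u' = 1] lies on the axis. *)
Lemma involution_fixes_axis (phi : quat R -> quat R) (L : R) :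
  inf_isometry phi -> (forall q, inB q -> phi (phi q) = q) ->
  (forall q, inB q -> `|axis_coord (phi q) - axis_coord q| <= L) ->
  forall t, phi (qreal (th t)) = qreal (th t).
Proof.
move=> phiI phiK phiL.
have realB t : inB (qreal (th t) : quat R) by apply: real_inB; exact: sqr_tanh_lt1.
pose c t := phi (qreal (th t)); pose u t := axis_coord (c t).
have cs : slow c := inf_isometry_slow phiI (@ray_real_slow R).
have cB t : inB (c t) by have [] := cs t.
have uL t : `|u t - t| <= L by have := phiL _ (realB t); rewrite axis_coord_real.
have L0 : 0 <= L := le_trans (normr_ge0 _) (uL 0).
have ud t : exists2 d : R, is_derive t 1 u d & (1 + axis_gap (c t)) * d ^+ 2 <= 1.
  have [ctB [v cv g1]] := cs t; exists (d_axis_coord (c t) v).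
    exact: is_derive_axis_coord.
  exact: le_trans (d_axis_coord_le v ctB) g1.
(* While the gap exceeds [e], the slope of [u] is at most [k < 1], so [t - u t] grows by at least
   [N * (1 - k)] over a window of length [N]; this [N] makes that exceed its total range [2 * L]. *)
have window e : 0 < e -> exists2 N, 0 <= N & forall T, exists2 t,
    T <= t <= T + N & axis_gap (c t) <= e.
  move=> e0; pose k := Num.sqrt (1 + e)^-1.
  have k2 : k ^+ 2 = (1 + e)^-1 by rewrite sqr_sqrtr // invr_ge0; lra.
  have k0 : 0 <= k := sqrtr_ge0 _.
  have k1 : k < 1.
    rewrite -(@ltr_pXn2r _ 2) ?nnegrE // k2 expr1n invf_lt1; lra.
  exists (2 * L / (1 - k) + 1).
    by rewrite addr_ge0 // divr_ge0 ?mulr_ge0 //; lra.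
  set N := _ + 1 => T.
  have N0 : 0 <= N by rewrite addr_ge0 // divr_ge0 ?mulr_ge0 //; lra.
  apply: contrapT => hn.
  have big t : T <= t <= T + N -> e < axis_gap (c t).
    by move=> tT; rewrite ltNge; apply/negP => ge; apply: hn; exists t.
  have : `|u (T + N) - u T| <= k * `|T + N - T|.
    apply: (@mvt_dist_le R u (fun x => 'D_1 u x)) => x.
    rewrite (min_idPl _) ?(max_idPr _) ?lerDl // => xT.
    have [d [du <-] hd] := ud x; split; first exact: derivableP.
    rewrite -(@ler_pXn2r _ 2) ?nnegrE // -normrX ger0_norm ?sqr_ge0 // k2.
    have gx := big _ xT; have p0 : 0 < 1 + e by lra.
    rewrite -(ler_pM2l p0) mulfV ?gt_eqF //; apply: le_trans hd.
    by rewrite ler_wpM2r ?sqr_ge0 // lerD2l ltW.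
  have -> : T + N - T = N by rewrite addrAC subrr add0r.
  rewrite (ger0_norm N0) ler_norml => /andP[_ h1].
  have := uL (T + N); have := uL T; rewrite !ler_norml => /andP[_ h2] /andP[h3 _].
  have h4 : N * (1 - k) = 2 * L + (1 - k).
    by rewrite /N mulrDl mul1r divfK // gt_eqF //; lra.
  by lra.
(* Push the perpendicular at [c t] forward by [phi]: the image joins [c (u t)] to [phi (c t)], the
   axis point of coordinate [t], in time [r], the distance of [c t] from the axis; and [r] is at
   most the root of the gap. *)
have close t : `|t - u (u t)| <= Num.sqrt (axis_gap (c t)).
  have [r [I [r0 hI e]]] := axis_polar (cB t).
  have := slow_axis_coord 0 r (inf_isometry_slow phiI (axis_ray_slow (axis_coord (c t)) hI)).
  rewrite axis_ray0 {1}/axis_ray -e /c phiK // axis_coord_real subr0 (ger0_norm r0).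
  rewrite -/(c t) -/(u t) -/(c (u t)) -/(u (u t)) => /le_trans; apply.
  have g0 := axis_gap_ge0 (c t).
  have := sqrt_gap_ray hI r0; rewrite -(axis_ray_gap (axis_coord (c t)) hI) /axis_ray -e => E.
  have s0 := sqrtr_ge0 (axis_gap (c t)).
  rewrite -(ler_pM2l (_ : 0 < 2)) // -ler_expR -E.
  apply: le_trans (expR_ge1Dx _).
  have : Num.sqrt (1 + axis_gap (c t)) <= 1 + Num.sqrt (axis_gap (c t)); last by lra.
  rewrite -(@ler_pXn2r _ 2) ?nnegrE ?sqrtr_ge0 ?addr_ge0 // sqrrD !sqr_sqrtr //; last by lra.
  by rewrite expr1n mul1r; lra.
have mono s t : s <= t -> s - u s <= t - u t.
  move=> st; have := slow_axis_coord s t cs; rewrite -/(u s) -/(u t).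
  by rewrite ler_norml ger0_norm ?subr_ge0 // => /andP[_]; lra.
have u_id t0 : u t0 = t0.
  suff : `|t0 - u t0| <= 0 by rewrite normr_le0 subr_eq0 => /eqP.
  apply/ler_addgt0Pr => e e0; rewrite add0r ler_norml.
  have e2 : 0 < e ^+ 2 by rewrite exprn_gt0.
  have [N N0 hN] := window _ e2.
  have small t : axis_gap (c t) <= e ^+ 2 -> `|t - u (u t)| <= e.
    move=> ge; apply: le_trans (close t) _.
    by rewrite -(ger0_norm (ltW e0)) -sqrtr_sqr ler_wsqrtr.
  (* [t - u (u t)] is the sum of the values of [x - u x] at [t] and at [u t]. With both points below
     [t0], monotonicity bounds [t0 - u t0] from below; with both above, from above. *)
  apply/andP; split.
    have [t /andP[_ tT] /small] := hN (t0 - L - N).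
    have := uL t; rewrite !ler_norml => /andP[_ h1] /andP[h2 _].
    have h3 : t <= t0 by lra.
    have h4 : u t <= t0 by lra.
    have := mono _ _ h3; have := mono _ _ h4; lra.
  have [t /andP[tT _] /small] := hN (t0 + L).
  have := uL t; rewrite !ler_norml => /andP[h1 _] /andP[_ h2].
  have h3 : t0 <= t by lra.
  have h4 : t0 <= u t by lra.
  have := mono _ _ h3; have := mono _ _ h4; lra.
move=> t; have uE : u = id by apply/funext => x; exact: u_id.
have [d dd hd] := ud t.
have d1 : d = 1 by case: dd => _ <-; rewrite uE derive_id.
have g0 : axis_gap (c t) = 0.
  apply/eqP; rewrite eq_le axis_gap_ge0 andbT.
  by move: hd; rewrite d1 expr1n mulr1; lra.
by have := axis_gap_eq0 (cB t) g0; rewrite -/(u t) u_id.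
Qed.

(** The displacement of [h o k o f] at [q] is at most the time [pi] of a [slow] path from [f q] to
    [k (f q)], pushed forward by [h]. *)
Lemma isometry_commutes_on_axis f (k : quat R -> quat R) : isometry_B f ->
  inf_isometry k -> (forall q, inB q -> k (k q) = q) ->
  (forall q, inB q -> exists c : R -> quat R, [/\ slow c, c 0 = q & c pi = k q]) ->
  forall t, k (f (qreal (th t))) = f (qreal (th t)).
Proof.
move=> fi ki kK kc t.
have [h [hi hf fh]] := isometry_inverse fi; have fi' := isometry_inf_isometry fi.
have realB : inB (qreal (th t) : quat R) by apply: real_inB; exact: sqr_tanh_lt1.
have fB q (hq : inB q) : inB (f q) by have [] := fi' q hq.
have kB q (hq : inB q) : inB (k q) by have [] := ki q hq.
have hB q (hq : inB q) : inB (h q) by have [] := hi q hq.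
have phi_fix : h (k (f (qreal (th t)))) = qreal (th t).
  apply: (@involution_fixes_axis (fun q => h (k (f q))) pi).
  - exact: (inf_isometry_comp (inf_isometry_comp fi' ki) hi).
  - by move=> q hq; rewrite fh ?kK ?hf //; [exact: fB | exact/kB/fB].
  - move=> q hq; have [c [cs c0 cpi]] := kc _ (fB _ hq).
    have := slow_axis_coord 0 pi (inf_isometry_slow hi cs).
    by rewrite c0 cpi hf // subr0 [X in _ <= X]ger0_norm // pi_ge0.
by rewrite -[in RHS]phi_fix fh //; exact/kB/fB.
Qed.

(** Only real quaternions are fixed by conjugation with both i and j. *)
Lemma isometry_axis f t : isometry_B f -> exists s, f (qreal (th t)) = qreal (th s).
Proof.
move=> fi; have fi' := isometry_inf_isometry fi.
have realB : inB (qreal (th t) : quat R) by apply: real_inB; exact: sqr_tanh_lt1.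
have fB : inB (f (qreal (th t))) by have [] := fi' _ realB.
pose i1 : quat R := mkq 0 1 0 0; pose j1 : quat R := mkq 0 0 1 0.
have i1S : inSp1 i1 by rewrite /inSp1 /qnorm2 !qcE; ring.
have j1S : inSp1 j1 by rewrite /inSp1 /qnorm2 !qcE; ring.
have sg : is_sign (1 : R) by left.
have iE q : act i1 1 0 q = mkq (qc q 0) (qc q 1) (- qc q 2) (- qc q 3).
  rewrite actE tanh0 boost0 scale1r /i1.
  by apply: quatP; rewrite /qmul /qconj !qcE; ring.
have jE q : act j1 1 0 q = mkq (qc q 0) (- qc q 1) (qc q 2) (- qc q 3).
  rewrite actE tanh0 boost0 scale1r /j1.
  by apply: quatP; rewrite /qmul /qconj !qcE; ring.
have fixi : act i1 1 0 (f (qreal (th t))) = f (qreal (th t)).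
  apply: isometry_commutes_on_axis => //; first exact: act_inf_isometry.
    by move=> q _; rewrite !iE; apply: quatP; rewrite !qcE; ring.
  move=> q hq; have [cs _] := rot_slow hq; eexists; split; first exact: cs.
    by rewrite /= sin0 cos0; apply: quatP; rewrite !qcE; ring.
  by rewrite /= sinpi cospi iE; apply: quatP; rewrite !qcE; ring.
have fixj : act j1 1 0 (f (qreal (th t))) = f (qreal (th t)).
  apply: isometry_commutes_on_axis => //; first exact: act_inf_isometry.
    by move=> q _; rewrite !jE; apply: quatP; rewrite !qcE; ring.
  move=> q hq; have [_ cs] := rot_slow hq; eexists; split; first exact: cs.
    by rewrite /= sin0 cos0; apply: quatP; rewrite !qcE; ring.
  by rewrite /= sinpi cospi jE; apply: quatP; rewrite !qcE; ring.
exists (axis_coord (f (qreal (th t)))); apply: axis_gap_eq0 => //.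
move: fixi fixj; rewrite iE jE; move: (f _) => p pi pj.
have e2 : qc p 2 = 0 by have := congr1 (fun x => qc x 2) pi; rewrite qcE; lra.
have e3 : qc p 3 = 0 by have := congr1 (fun x => qc x 3) pi; rewrite qcE; lra.
have e1 : qc p 1 = 0 by have := congr1 (fun x => qc x 1) pj; rewrite qcE; lra.
by rewrite /axis_gap /im2 e1 e2 e3; ring.
Qed.

End AxisIsPreserved.

(** * Isometries fixing the axis pointwise *)

Section NormalizedIsometries.
Variable R : realType.
Local Notation "x ** y" := (qmul x y) (at level 40, left associativity).
Local Notation N2 := (@qnorm2 R).
Local Notation th := (@Defs.tanh R).
Implicit Types (p q v w I : quat R) (f g h : quat R -> quat R) (r s t x : R).

Definition fixes_axis f := forall t, f (qreal (th t)) = qreal (th t).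

(** The perpendicular through [q] is mapped to a [slow] curve that starts on the axis, and along
    such curves the gap grows no faster than along the perpendicular itself. *)
Lemma axis_gap_le g q : inf_isometry g -> fixes_axis g -> inB q ->
  axis_gap (g q) <= axis_gap q.
Proof.
move=> gi ga hq; have [r [I [r0 hI e]]] := axis_polar hq.
set s := axis_coord q in e.
have gB : inB (g q) by have [] := gi q hq.
apply: gap_sqrt_inj; try exact: axis_gap_ge0.
have c0 : axis_gap (g (axis_ray I s 0)) = 0 by rewrite axis_ray0 ga axis_gap_real.
have := slow_axis_gap (inf_isometry_slow gi (axis_ray_slow s hI)) c0 r0.
by rewrite -(sqrt_gap_ray hI r0) -(axis_ray_gap s hI) /axis_ray -e.
Qed.

(** Equality in [d_axis_gap_le], with unit speed and no motion along the axis. *)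
Lemma d_axis_gap_ray I t : imag_unit I ->
  d_axis_gap (th t *: I) ((1 - th t ^+ 2) *: I) ^+ 2 =
  16 * (axis_gap (th t *: I) * (1 + axis_gap (th t *: I))).
Proof.
move=> hI; rewrite (axis_gap_ray t hI); case: hI => [I1 I0].
have := qnorm2_im I; rewrite I1 I0 expr0n add0r => I2.
have m0 : 0 < 1 - th t ^+ 2 by rewrite subr_gt0 sqr_tanh_lt1.
move: (th t) m0 => s m0; rewrite /d_axis_gap !qcZ I0 qnorm2Z I1.
have -> : imdot (s *: I) ((1 - s ^+ 2) *: I) = s * (1 - s ^+ 2) * im2 I.
  by rewrite /im2 /imdot !qcZ; ring.
rewrite -I2 !mulr0 !mulr1.
by field; rewrite gt_eqF.
Qed.

(* Equality in the bound on the growth of the axis gap leaves no room for the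
   axis coordinate to vary. *)
Lemma axis_coord_preserved g q : inf_isometry g -> fixes_axis g ->
  (forall q, inB q -> axis_gap (g q) = axis_gap q) -> inB q ->
  axis_coord (g q) = axis_coord q.
Proof.
move=> gi ga gap hq; have [r [I [r0 hI e]]] := axis_polar hq.
set s := axis_coord q in e *.
pose c t := g (axis_ray I s t).
have cs : slow c := inf_isometry_slow gi (axis_ray_slow s hI).
have c0 : axis_coord (c 0) = s by rewrite /c axis_ray0 ga axis_coord_real.
have cr : c r = g q by rewrite /c /axis_ray -e.
have := r0; rewrite le_eqVlt => /orP[/eqP r00|rp]; first by rewrite -cr -r00 c0.
have gapc t : axis_gap (c t) = axis_gap (th t *: I).
  by rewrite /c gap ?axis_ray_gap //; have [] := axis_ray_slow s hI t.
(* At [t = 0] the gap vanishes and the bound carries no information, so the mean value theorem is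
   used on the open interval with continuity at the ends. *)
have dc t : 0 < t -> is_derive t 1 (fun t => axis_coord (c t)) 0.
  move=> t0; have [cB [v cv g1]] := cs t.
  suff <- : d_axis_coord (c t) v = 0 by exact: is_derive_axis_coord.
  have d1 := is_derive_axis_gap cB cv.
  have [rB _] := slow_ray hI.1 (or_intror hI.2) t.
  have dI : is_derive t 1 (fun t => th t *: I) ((1 - th t ^+ 2) *: I).
    apply: is_derive_quat => i _; under eq_fun do rewrite qcZ.
    have dt := is_derive_tanh t.
    by apply: is_derive_eq; rewrite /GRing.scale /= qcZ; ring.
  have d2 := is_derive_axis_gap rB dI.
  have E : d_axis_gap (c t) v = d_axis_gap (th t *: I) ((1 - th t ^+ 2) *: I).
    have := @derive_val _ _ _ _ _ _ _ d1; have := @derive_val _ _ _ _ _ _ _ d2.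
    under eq_fun do rewrite -gapc.
    by move=> -> ->.
  have := d_axis_gap_le v cB; rewrite E d_axis_gap_ray // -gapc.
  have G0 : 0 < axis_gap (c t).
    rewrite gapc axis_gap_ray //.
    have tt0 : 0 < th t.
      have : 1 < expR (2 * t) by rewrite -expR0 ltr_expR mulr_gt0.
      by move=> h; rewrite tanhE divr_gt0 ?subr_gt0 // addr_gt0 // expR_gt0.
    have m0 : 0 < 1 - th t ^+ 2 by rewrite subr_gt0 sqr_tanh_lt1.
    by apply: divr_gt0; [apply: mulr_gt0 => //|]; exact: exprn_gt0.
  move: (axis_gap (c t)) (d_axis_coord (c t) v) (gq (c t) v) G0 g1 => G d k G0 k1 le1.
  have P0 : 0 < 16 * (G * (1 + G)) by rewrite !mulr_gt0 // addr_gt0.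
  have : 1 <= k - (1 + G) * d ^+ 2 by rewrite -(ler_pM2l P0) mulr1.
  move=> h; have : (1 + G) * d ^+ 2 <= 0 by lra.
  by rewrite pmulr_rle0 ?addr_gt0 // => h'; apply/eqP; rewrite -sqrf_eq0 eq_le h' sqr_ge0.
rewrite -cr -c0.
have [z _ /eqP] : exists2 z, z \in `]0, r[%R &
    axis_coord (c r) - axis_coord (c 0) = 0 * (r - 0).
  apply: (@MVT R (fun t => axis_coord (c t)) (fun=> 0)) => //.
    by move=> z; rewrite in_itv => /andP[z0 _]; exact: dc.
  apply: derivable_within_continuous => z _.
  have [zB [v cv _]] := cs z.
  by have [] := is_derive_axis_coord zB cv.
by rewrite mul0r subr_eq0 => /eqP.
Qed.

(** With [a = 1 + |p|^2] and [x = Re p], the coordinate determines [x / a] and the gap determines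
    [(a^2 - 4 x^2) / (2 - a)^2]. Together they determine [a / (2 - a)], hence [a] and [x]. *)
Lemma axis_coordinates_inj p q : inB p -> inB q ->
  axis_coord p = axis_coord q -> axis_gap p = axis_gap q ->
  qc p 0 = qc q 0 /\ N2 p = N2 q.
Proof.
move=> hp hq.
have [p1 p2] := onepm_gt0 hp; have [q1 q2] := onepm_gt0 hq.
have n4 : 4^-1 != 0 :> R by rewrite invr_eq0.
rewrite /axis_coord => /(mulfI n4) /ln_inj.
rewrite !posrE !divr_gt0 // => /(_ isT isT) /eqP.
rewrite (eqr_div _ _ (lt0r_neq0 p2) (lt0r_neq0 q2)) => /eqP h1 h2.
have := axis_gap1 hp; rewrite h2 axis_gap1 // => /eqP.
have mp : 0 < 1 - N2 p by rewrite subr_gt0.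
have mq : 0 < 1 - N2 q by rewrite subr_gt0.
rewrite (eqr_div _ _ (lt0r_neq0 (exprn_gt0 2 mq)) (lt0r_neq0 (exprn_gt0 2 mp))) !sdenE2.
move=> /eqP {h2}.
have pE z : N2 (qone R + z) = (1 + N2 z) + 2 * qc z 0.
  by rewrite /qnorm2 /qone !qcE; ring.
have mE z : N2 (qone R - z) = (1 + N2 z) - 2 * qc z 0.
  by rewrite /qnorm2 /qone !qcE; ring.
move: h1; rewrite !mE !pE.
have ap : 1 <= 1 + N2 p by rewrite lerDl qnorm2_ge0.
have aq : 1 <= 1 + N2 q by rewrite lerDl qnorm2_ge0.
move: p1 p2 q1 q2; rewrite !mE !pE.
have -> : 1 - N2 p = 2 - (1 + N2 p) by ring.
have -> : 1 - N2 q = 2 - (1 + N2 q) by ring.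
have -> : (N2 p = N2 q) = (1 + N2 p = 1 + N2 q).
  by apply/propext; split=> [->//|/addrI].
move: mp mq ap aq; have -> : 1 - N2 p = 2 - (1 + N2 p) by ring.
have -> : 1 - N2 q = 2 - (1 + N2 q) by ring.
move: (1 + N2 p) (1 + N2 q) (qc p 0) (qc q 0) => a b x y mp mq ap aq p1 p2 q1 q2 h1 h2.
have xy : x * b = y * a by lra.
have e1 : (a * (2 - b)) ^+ 2 * (b + 2 * y) * (b - 2 * y) =
          (b * (2 - a)) ^+ 2 * (b + 2 * y) * (b - 2 * y).
  have -> : (a * (2 - b)) ^+ 2 * (b + 2 * y) * (b - 2 * y) =
    (2 - b) ^+ 2 * ((a * b) ^+ 2 - (2 * (y * a)) ^+ 2) by ring.
  rewrite -xy.
  have -> : (2 - b) ^+ 2 * ((a * b) ^+ 2 - (2 * (x * b)) ^+ 2) =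
    b ^+ 2 * ((2 - b) ^+ 2 * ((a + 2 * x) * (a - 2 * x))) by ring.
  by rewrite [_ * ((a + _) * _)]mulrC -h2; ring.
have e2 : (a * (2 - b)) ^+ 2 = (b * (2 - a)) ^+ 2.
  by apply: (mulIf (negbT (gt_eqF q1))); apply: (mulIf (negbT (gt_eqF q2))).
have e3 : a * (2 - b) = b * (2 - a).
  apply/eqP; rewrite -(@eqrXn2 _ 2) ?e2 //; apply: mulr_ge0; lra.
have ab : a = b by lra.
split=> //; move: xy; rewrite ab; apply: mulIf; rewrite gt_eqF //; lra.
Qed.

Definition preserves_coords g := forall q, inB q -> qc (g q) 0 = qc q 0 /\ N2 (g q) = N2 q.

(** Differentiating the preserved real part and modulus along a line shows that the real part and
    the radial component of [v] are preserved; by [gqE], equality of speeds then leaves equality of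
    [im2]. *)
Lemma coords_euclidean g q v : inf_isometry g -> preserves_coords g -> inB q ->
  N2 ('D_v g q) = N2 v.
Proof.
move=> gi gc hq; have [gB gd gg] := gi q hq.
pose c t := t *: v + q.
have c0 : c 0 = q by rewrite /c scale0r add0r.
have cd : is_derive (0 : R) 1 c v.
  have := @is_derive_along R (quat R) (quat R) id q v 0.
  rewrite derive_id; apply; exact: derivable_id.
have gcd : is_derive (0 : R) 1 (fun t => g (c t)) ('D_v g q).
  by rewrite -[in 'D_v g q]c0; apply: is_derive_comp_curve => //; rewrite c0.
have cB : \forall t \near (0 : R), inB (c t).
  have cc : {for 0, continuous c}.
    by apply: differentiable_continuous; apply/derivable1_diffP; case: cd.
  by apply: (cc _ (inB_near _)); rewrite c0.
have c0B : inB (c 0) by rewrite c0.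
have gc0B : inB (g (c 0)) by rewrite c0.
have x1 := is_derive_qc 0 gcd.
have x2 := is_derive_qc 0 cd.
have n1 := is_derive_qnorm2 gcd.
have n2 := is_derive_qnorm2 cd.
have ex : qc ('D_v g q) 0 = qc v 0.
  rewrite -(@derive_val _ _ _ _ _ _ _ x1) -(@derive_val _ _ _ _ _ _ _ x2).
  apply: near_eq_derive; near=> t.
  have tB : inB (c t) by near: t.
  by case: (gc _ tB).
have en : 2 * (qc (g (c 0)) 0 * qc ('D_v g q) 0 + imdot (g (c 0)) ('D_v g q)) =
          2 * (qc (c 0) 0 * qc v 0 + imdot (c 0) v).
  rewrite -(@derive_val _ _ _ _ _ _ _ n1) -(@derive_val _ _ _ _ _ _ _ n2).
  apply: near_eq_derive; near=> t.
  have tB : inB (c t) by near: t.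
  by case: (gc _ tB).
have [gx gn] := gc q hq.
rewrite c0 gx ex in en.
have ed : imdot (g q) ('D_v g q) = imdot q v by lra.
have im_eq : im2 (g q) = im2 q.
  by have := gn; rewrite !qnorm2_im gx => /addrI.
have := gg v; rewrite !gqE !sdenE gn im_eq ex ed.
have m0 : 0 < 1 - N2 q by rewrite subr_gt0.
have D0 := sden_gt0 hq; rewrite sdenE in D0.
move=> /(mulIf _) => h.
have {h} : (1 - N2 q) ^+ 2 * im2 ('D_v g q) = (1 - N2 q) ^+ 2 * im2 v.
  suff : ((1 - N2 q) ^+ 2 + 4 * im2 q) * qc v 0 ^+ 2 + (1 - N2 q) ^+ 2 * im2 ('D_v g q) +
     4 * imdot q v ^+ 2 = ((1 - N2 q) ^+ 2 + 4 * im2 q) * qc v 0 ^+ 2 +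
     (1 - N2 q) ^+ 2 * im2 v + 4 * imdot q v ^+ 2 by move=> /addIr /addrI.
  by apply: h; rewrite gt_eqF // invr_gt0 mulr_gt0 // exprn_gt0.
move/(mulfI _) => h; rewrite !qnorm2_im ex h // gt_eqF // exprn_gt0 //.
Unshelve. all: by end_near. Qed.

End NormalizedIsometries.

(** * From Euclidean contractions to a linear isometry *)

Section Contractions.
Variable R : realType.
Local Notation "x ** y" := (qmul x y) (at level 40, left associativity).
Local Notation N2 := (@qnorm2 R).
Local Notation th := (@Defs.tanh R).
Implicit Types (p q v w : quat R) (f g h : quat R -> quat R) (r s t : R).

Definition qdot p q : R :=
  qc p 0 * qc q 0 + qc p 1 * qc q 1 + qc p 2 * qc q 2 + qc p 3 * qc q 3.

Lemma qdot_norm2 p : qdot p p = N2 p.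
Proof. by rewrite /qdot /qnorm2 -!expr2. Qed.

Lemma qdotB p q : N2 (p - q) = N2 p - 2 * qdot p q + N2 q.
Proof. by rewrite /qdot /qnorm2 !qcE; ring. Qed.

Lemma qdot_cauchy p q : qdot p q ^+ 2 <= N2 p * N2 q.
Proof.
rewrite -subr_ge0.
have -> : N2 p * N2 q - qdot p q ^+ 2 =
  (qc p 0 * qc q 1 - qc p 1 * qc q 0) ^+ 2 + (qc p 0 * qc q 2 - qc p 2 * qc q 0) ^+ 2 +
  (qc p 0 * qc q 3 - qc p 3 * qc q 0) ^+ 2 + (qc p 1 * qc q 2 - qc p 2 * qc q 1) ^+ 2 +
  (qc p 1 * qc q 3 - qc p 3 * qc q 1) ^+ 2 + (qc p 2 * qc q 3 - qc p 3 * qc q 2) ^+ 2.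
  by rewrite /qdot /qnorm2; ring.
by rewrite !addr_ge0 ?sqr_ge0.
Qed.

Lemma inB_segment p q t : inB p -> inB q -> 0 <= t <= 1 -> inB (t *: (q - p) + p).
Proof.
move=> hp hq /andP[t0 t1]; rewrite /inB in hp hq *.
have -> : N2 (t *: (q - p) + p) =
    (1 - t) * N2 p + t * N2 q - t * (1 - t) * N2 (q - p).
  by rewrite /qnorm2 !qcE; ring.
have := qnorm2_ge0 (q - p) => n0.
have h : 0 <= t * (1 - t) * N2 (q - p) by rewrite !mulr_ge0 // subr_ge0.
have [->|tn] := eqVneq t 0; first by rewrite !mul0r !subr0 mul1r addr0.
have tp : 0 < t by rewrite lt0r tn.
have h1 : t * N2 q < t by rewrite gtr_pMr.
have h2 : (1 - t) * N2 p <= 1 - t by rewrite -[leRHS]mulr1 ler_wpM2l ?subr_ge0 // ltW.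
lra.
Qed.

(** [F] is the inner product of [g] along the segment with the image chord [e]: its increment is
    [|e|^2] and its slope at most [|d| |e|]. *)
Lemma contraction g p q : inf_isometry g -> preserves_coords g ->
  inB p -> inB q -> N2 (g q - g p) <= N2 (q - p).
Proof.
move=> gi gc hp hq; set e := g q - g p; set d := q - p.
pose c t := t *: d + p.
have cB t : 0 <= t <= 1 -> inB (c t) by exact: inB_segment.
have cd t : is_derive t 1 c d.
  have := @is_derive_along R (quat R) (quat R) id p d t.
  rewrite derive_id; apply; exact: derivable_id.
pose F t := qdot (g (c t)) e.
have Fd t : 0 <= t <= 1 -> is_derive t 1 F (qdot ('D_d g (c t)) e).
  move=> t01; have [_ gd _] := gi _ (cB t t01).
  have gcd := is_derive_comp_curve gd (cd t).
  have k i := is_derive_qc i gcd.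
  have k0 := k 0; have k1 := k 1; have k2 := k 2; have k3 := k 3.
  by rewrite /F /qdot; apply: is_derive_eq; rewrite /GRing.scale /=; ring.
have := @mvt_dist_le R F (fun t => qdot ('D_d g (c t)) e) 0 1 (Num.sqrt (N2 d * N2 e)).
rewrite (min_idPl ler01) (max_idPr ler01) subr0 normr1 mulr1.
have -> : F 1 - F 0 = N2 e.
  rewrite -qdot_norm2 {1}/e /F /c scale1r scale0r add0r /d subrK /qdot !qcE.
  by ring.
rewrite ger0_norm ?qnorm2_ge0 // => h.
have {h} : N2 e <= Num.sqrt (N2 d * N2 e).
  apply: h => t t01; split; first exact: Fd.
  rewrite -sqrtr_sqr ler_wsqrtr //.
  apply: le_trans (qdot_cauchy _ _) _.
  by rewrite (coords_euclidean d gi gc (cB t t01)).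
have e0 := qnorm2_ge0 e; have d0 := qnorm2_ge0 d.
rewrite -(@ler_pXn2r _ 2) ?nnegrE ?sqrtr_ge0 // sqr_sqrtr ?mulr_ge0 // expr2 => h.
have := e0; rewrite le_eqVlt => /orP[/eqP <- //|ep].
by rewrite -(ler_pM2r ep).
Qed.

Definition qbasis_comb (A : nat -> quat R) q : quat R :=
  qc q 0 *: A 0 + qc q 1 *: A 1 + qc q 2 *: A 2 + qc q 3 *: A 3.

(** As [g] and its left inverse both contract, [g] preserves distances; with norms preserved, it
    preserves inner products, and a point is recovered from its inner products with an orthonormal
    frame. *)
Lemma orthogonal_of_contractions g h : inf_isometry g -> inf_isometry h ->
  preserves_coords g -> preserves_coords h ->
  (forall q, inB q -> h (g q) = q) -> fixes_axis g ->
  exists A : nat -> quat R, [/\ A 0 = qone R,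
    forall i j, (i < 4)%N -> (j < 4)%N -> qdot (A i) (A j) = (i == j)%:R &
    forall q, inB q -> g q = qbasis_comb A q].
Proof.
move=> gi hi gc hc hg ga.
have gB q (hq : inB q) : inB (g q) by have [] := gi q hq.
have iso p q : inB p -> inB q -> N2 (g q - g p) = N2 (q - p).
  move=> hp hq; apply/eqP; rewrite eq_le contraction //=.
  by rewrite -{1}(hg p hp) -{1}(hg q hq); apply: contraction => //; exact: gB.
have dot p q : inB p -> inB q -> qdot (g p) (g q) = qdot p q.
  move=> hp hq; have := iso q p hq hp; rewrite !qdotB (gc p hp).2 (gc q hq).2; lra.
(* The units lie on the boundary of the ball, so their halves are used and the images rescaled by
   2. *)
pose e i : quat R := 2^-1 *: qunit R i.
have eB i : inB (e i).
  rewrite /inB /e qnorm2Z; have : N2 (qunit R i) <= 1.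
    by case: i => [|[|[|[|i]]]]; rewrite /qnorm2 /qunit !qcE /= ?expr0n ?expr1n /=; lra.
  by move=> le1; have := qnorm2_ge0 (qunit R i); lra.
exists (fun i => 2 *: g (e i)).
have qdotZ a b p q : qdot (a *: p) (b *: q) = a * b * qdot p q.
  by rewrite /qdot !qcE; ring.
have ortho i j : (i < 4)%N -> (j < 4)%N -> qdot (2 *: g (e i)) (2 *: g (e j)) = (i == j)%:R.
  rewrite qdotZ dot // /e qdotZ.
  by case: i j => [|[|[|[|//]]]] [|[|[|[|//]]]] _ _;
    rewrite /qdot /qunit !qcE /=; field.
split=> //.
  have [t tE] : exists t, th t = 2^-1 by apply: tanh_surj; lra.
  have -> : e 0%N = qreal (th t).
    by rewrite tE /e /qreal /qunit /qone /=; apply: quatP; rewrite !qcE; ring.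
  by rewrite ga tE /qreal scalerA mulfV ?scale1r // pnatr_eq0.
move=> q hq; apply/eqP; rewrite -subr_eq0 -qnorm2_eq0 qdotB (gc q hq).2.
set A := fun i => _.
have AE i j : (i < 4)%N -> (j < 4)%N -> qdot (A i) (A j) = (i == j)%:R := @ortho i j.
have dA i : (i < 4)%N -> qdot (g q) (A i) = qc q i.
  move=> i4; rewrite /A -[g q]scale1r qdotZ dot //.
  rewrite /e -[q]scale1r qdotZ scale1r /qdot /qunit !qcE.
  by case: i i4 => [|[|[|[|//]]]] _ /=; field.
have -> : qdot (g q) (qbasis_comb A q) = N2 q.
  have -> : qdot (g q) (qbasis_comb A q) = qc q 0 * qdot (g q) (A 0)
    + qc q 1 * qdot (g q) (A 1) + qc q 2 * qdot (g q) (A 2) + qc q 3 * qdot (g q) (A 3).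
    by rewrite /qbasis_comb /qdot !qcE; ring.
  by rewrite !dA // /qnorm2; ring.
have -> : N2 (qbasis_comb A q) = N2 q.
  have -> : N2 (qbasis_comb A q) =
    qc q 0 ^+ 2 * qdot (A 0) (A 0) + qc q 1 ^+ 2 * qdot (A 1) (A 1) +
    qc q 2 ^+ 2 * qdot (A 2) (A 2) + qc q 3 ^+ 2 * qdot (A 3) (A 3) +
    2 * (qc q 0 * qc q 1 * qdot (A 0) (A 1) + qc q 0 * qc q 2 * qdot (A 0) (A 2) +
         qc q 0 * qc q 3 * qdot (A 0) (A 3) + qc q 1 * qc q 2 * qdot (A 1) (A 2) +
         qc q 1 * qc q 3 * qdot (A 1) (A 3) + qc q 2 * qc q 3 * qdot (A 2) (A 3)).
    rewrite /qnorm2 /qbasis_comb /qdot !qcE.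
    by ring.
  by rewrite !AE //= /qnorm2; ring.
by apply/eqP; ring.
Qed.

End Contractions.

(** * Oriented orthonormal frames are conjugate to the standard one *)

Section OrthogonalFrames.
Variable R : realType.
Local Notation "x ** y" := (qmul x y) (at level 40, left associativity).
Local Notation N2 := (@qnorm2 R).
Implicit Types (p q x y z : quat R).

(* An orientation preserving orthogonal frame of the imaginary quaternions
   multiplies like i, j, k; averaging over the basis then produces an
   intertwiner, by Skolem-Noether. *)
Lemma frame_conj (A : nat -> quat R) : A 0 = qone R ->
  (forall i j, (i < 4)%N -> (j < 4)%N -> qdot (A i) (A j) = (i == j)%:R) ->
  0 < \det (\matrix_(i < 4, j < 4) qc (A j) i) ->
  exists2 u, inSp1 u & forall q, qbasis_comb A q = u ** q ** qconj u.
Proof.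
move=> A0 AE; rewrite (det_mx44 (fun i j => qc (A j) i)) => detA.
have dot1 p : qdot (qone R) p = qc p 0 by rewrite /qdot /qone !qcE; ring.
have re i : (0 < i < 4)%N -> qc (A i) 0 = 0.
  by move=> /andP[i0 i4]; rewrite -dot1 -A0 AE // -(inj_eq succn_inj); case: i i0 i4.
have r1 := re 1%N isT; have r2 := re 2%N isT; have r3 := re 3%N isT.
move: (AE 1 1 isT isT) (AE 2 2 isT isT) (AE 3 3 isT isT) (AE 1 2 isT isT)
  (AE 1 3 isT isT) (AE 2 3 isT isT).
rewrite /= ; move: detA; rewrite A0 /det3 /qone !qcE r1 r2 r3.
have combE q : qbasis_comb A q =
    qc q 0 *: qone R + qc q 1 *: A 1 + qc q 2 *: A 2 + qc q 3 *: A 3.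
  by rewrite /qbasis_comb A0.
move: (A 1) (A 2) (A 3) r1 r2 r3 combE => a b c r1 r2 r3 combE.
(* The determinant reduces to the triple product [T] of the imaginary frame. Its square is the Gram
   determinant, hence 1, and orientation selects [T = 1]. *)
pose T := qc a 1 * (qc b 2 * qc c 3 - qc b 3 * qc c 2)
        - qc a 2 * (qc b 1 * qc c 3 - qc b 3 * qc c 1)
        + qc a 3 * (qc b 1 * qc c 2 - qc b 2 * qc c 1).
rewrite ?(mul0r, mul1r, mulr0, subr0, sub0r, addr0, add0r) => T0 aa bb cc ab ac bc.
have {}T0 : 0 < T by apply: lt_le_trans T0 _; rewrite /T le_eqVlt; apply/orP; left; apply/eqP; ring.
have T2 : T ^+ 2 = 1.
  have -> : T ^+ 2 = (qdot a a - qc a 0 ^+ 2) * ((qdot b b - qc b 0 ^+ 2) * (qdot c c - qc c 0 ^+ 2)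
     - (qdot b c - qc b 0 * qc c 0) ^+ 2)
     - (qdot a b - qc a 0 * qc b 0) * ((qdot a b - qc a 0 * qc b 0) * (qdot c c - qc c 0 ^+ 2)
        - (qdot b c - qc b 0 * qc c 0) * (qdot a c - qc a 0 * qc c 0))
     + (qdot a c - qc a 0 * qc c 0) * ((qdot a b - qc a 0 * qc b 0) * (qdot b c - qc b 0 * qc c 0)
        - (qdot b b - qc b 0 ^+ 2) * (qdot a c - qc a 0 * qc c 0)).
    by rewrite /T /qdot; ring.
  by rewrite aa bb cc ab ac bc r1 r2 r3; ring.
have T1 : T = 1.
  apply/eqP; move/eqP: T2; rewrite sqrf_eq1 => /orP[//|/eqP h].
  by move: T0; rewrite h; lra.
have sq x : qc x 0 = 0 -> qdot x x = 1 -> x ** x = - qone R.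
  move=> x0 xx; have -> : x ** x = - (qdot x x *: qone R).
    by rewrite /qdot; apply: quatP; rewrite /qmul /qone !qcE x0; ring.
  by rewrite xx scale1r.
have anti x y : qc x 0 = 0 -> qc y 0 = 0 -> qdot x y = 0 -> y ** x = - (x ** y).
  move=> x0 y0 xy; apply/eqP; rewrite -subr_eq0 opprK; apply/eqP.
  have -> : y ** x + x ** y = (- 2 * qdot x y) *: qone R.
    by rewrite /qdot; apply: quatP; rewrite /qmul /qone !qcE x0 y0; ring.
  by rewrite xy mulr0 scale0r.
(* Unit vectors with inner product 1 coincide, and the inner product of [a ** b] with [c] is [T]. *)
have prod x y z : qc x 0 = 0 -> qc y 0 = 0 -> qc z 0 = 0 ->
    qdot x x = 1 -> qdot y y = 1 -> qdot z z = 1 -> qdot x y = 0 ->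
    qdot (x ** y) z = 1 -> x ** y = z.
  move=> x0 y0 z0 xx yy zz xy h; apply/eqP.
  rewrite -subr_eq0 -qnorm2_eq0 qdotB h qnorm2M -!qdot_norm2 xx yy zz.
  by apply/eqP; ring.
have ca : qdot c a = 0 by apply: etrans _ ac; rewrite /qdot; ring.
have abc : a ** b = c.
  by apply: prod => //; rewrite -T1 /T /qdot /qmul !qcE r1 r2 r3; ring.
have bca : b ** c = a.
  by apply: prod => //; rewrite -T1 /T /qdot /qmul !qcE r1 r2 r3; ring.
have cab : c ** a = b.
  apply: prod => //.
  by rewrite -T1 /T /qdot /qmul !qcE r1 r2 r3; ring.
have bac : b ** a = - c by rewrite anti // abc.
have cba : c ** b = - a by rewrite anti // bca.
have acb : a ** c = - b.
  by rewrite anti ?cab.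
have dec q : q = qc q 0 *: qone R + qc q 1 *: qunit R 1 + qc q 2 *: qunit R 2
    + qc q 3 *: qunit R 3.
  by apply: quatP; rewrite /qunit /qone !qcE /=; ring.
have [e11 [e22 [e33 [e12 [e21 [e23 [e32 [e31 e13]]]]]]]] :
    qunit R 1 ** qunit R 1 = - qone R /\ qunit R 2 ** qunit R 2 = - qone R /\
    qunit R 3 ** qunit R 3 = - qone R /\ qunit R 1 ** qunit R 2 = qunit R 3 /\
    qunit R 2 ** qunit R 1 = - qunit R 3 /\ qunit R 2 ** qunit R 3 = qunit R 1 /\
    qunit R 3 ** qunit R 2 = - qunit R 1 /\ qunit R 3 ** qunit R 1 = qunit R 2 /\
    qunit R 1 ** qunit R 3 = - qunit R 2.
  by rewrite /qunit /=; do ![split]; qring.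
move: (qunit R 1) (qunit R 2) (qunit R 3) dec e11 e22 e33 e12 e21 e23 e32 e31 e13
  => i1 j1 k1 dec e11 e22 e33 e12 e21 e23 e32 e31 e13.
have a2 := sq a r1 aa; have b2 := sq b r2 bb; have c2 := sq c r3 cc.
(* The sum of [A e ** q ** qconj e] over the basis; the signs come from the conjugates of i, j,
   k. *)
pose M q := q - a ** q ** i1 - b ** q ** j1 - c ** q ** k1.
have int1 q : a ** M q = M q ** i1.
  rewrite /M !(qmulBl, qmulBr) -(qmulA _ i1 i1) -(qmulA _ j1 i1) -(qmulA _ k1 i1).
  rewrite e11 e21 e31.
  rewrite !qmulA a2 abc acb !(qmulNl, qmulNr, qmul1l, qmul1r).
  move: (a ** q) (q ** i1) (c ** q ** j1) (b ** q ** k1) => x y z w; qring.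
have int2 q : b ** M q = M q ** j1.
  rewrite /M !(qmulBl, qmulBr) -(qmulA _ i1 j1) -(qmulA _ j1 j1) -(qmulA _ k1 j1).
  rewrite e12 e22 e32.
  rewrite !qmulA b2 bac bca !(qmulNl, qmulNr, qmul1l, qmul1r).
  move: (b ** q) (q ** j1) (c ** q ** i1) (a ** q ** k1) => x y z w; qring.
have int3 q : c ** M q = M q ** k1.
  rewrite /M !(qmulBl, qmulBr) -(qmulA _ i1 k1) -(qmulA _ j1 k1) -(qmulA _ k1 k1).
  rewrite e13 e23 e33.
  rewrite !qmulA c2 cab cba !(qmulNl, qmulNr, qmul1l, qmul1r).
  move: (c ** q) (q ** k1) (a ** q ** j1) (b ** q ** i1) => x y z w; qring.
have [q0 Ml] : exists q0, M q0 != 0.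
  apply: contrapT => h.
  have M0 q0 : M q0 = 0.
    by apply/eqP; apply: contrapT => /negP hl; apply: h; exists q0.
  (* In this combination the terms in [a], [b] and [c] cancel and the four contributions of 1
     remain. *)
  have : M (qone R) - M i1 ** i1 - M j1 ** j1 - M k1 ** k1 = 4 *: qone R.
    rewrite /M !(qmulBl, qmul1r) -!qmulA ?(e11, e22, e33, e12, e21, e23, e32, e31, e13).
    rewrite !(qmulNl, qmulNr, qmul1l, qmul1r, opprK).
    rewrite ?(e11, e22, e33, e12, e21, e23, e32, e31, e13) ?opprK.
    rewrite !(qmulNl, qmulNr, qmul1l, qmul1r, opprK).
    move: (a ** i1) (b ** j1) (c ** k1) => x y z; qring.
  rewrite !M0 !qmul0l !subr0 => /esym/eqP.
  by rewrite scaler_eq0 (negbTE (qone_neq0 R)) orbF pnatr_eq0.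
move: (M q0) Ml (int1 q0) (int2 q0) (int3 q0) => m Ml I1 I2 I3.
have n0 : 0 < N2 m by rewrite qnorm2_gt0.
exists ((Num.sqrt (N2 m))^-1 *: m).
  by rewrite /inSp1 qnorm2Z exprVn sqr_sqrtr ?qnorm2_ge0 // mulVf // gt_eqF.
move=> q; rewrite qconjZ !qmulZl qmulZr scalerA -expr2 exprVn sqr_sqrtr ?qnorm2_ge0 //.
have mE x e : x ** m = m ** e -> m ** e ** qconj m = N2 m *: x.
  by move=> <-; rewrite -qmulA qmul_conjr qmulZr qmul1r.
have -> : m ** q ** qconj m = N2 m *: qbasis_comb A q.
  rewrite combE {1}(dec q) !(qmulDr, qmulDl, qmulZr, qmulZl) qmul1r qmul_conjr.
  rewrite (mE _ _ I1) (mE _ _ I2) (mE _ _ I3).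
  by apply: quatP; rewrite !(qcD, qcZ); ring.
by rewrite scalerA mulVf ?scale1r // gt_eqF.
Qed.

End OrthogonalFrames.

(** * Classification of orientation preserving isometries *)

Section OrientationPreservingIsometries.
Variable R : realType.
Local Notation "x ** y" := (qmul x y) (at level 40, left associativity).
Local Notation N2 := (@qnorm2 R).
Local Notation th := (@Defs.tanh R).
Implicit Types (p q v : quat R) (f g h : quat R -> quat R).

(** A point of the line is determined by its distances to two points: subtracting the squared
    distances of [u t] to [u 0] and [u 1] gives [e * (u t - u 0) = t]. *)
Lemma line_isometry (u : R -> R) : (forall s t, `|u t - u s| = `|t - s|) ->
  exists2 e, is_sign e & forall t, u t = u 0 + e * t.
Proof.
move=> h; have sq s t : (u t - u s) ^+ 2 = (t - s) ^+ 2.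
  by rewrite -(real_normK (num_real (u t - u s))) h real_normK ?num_real.
pose e := u 1 - u 0.
have e2 : e ^+ 2 = 1 by rewrite sq subr0 expr1n.
exists e.
  by move/eqP: e2; rewrite sqrf_eq1 => /orP[] /eqP ->; [left|right].
move=> t; have h0 := sq 0 t; have h1 := sq 1 t; rewrite subr0 in h0.
have : e * (u t - u 0) = t.
  have w1 : u t - u 1 = (u t - u 0) - e by rewrite /e; ring.
  rewrite w1 in h1; move: (u t - u 0) e e2 h0 h1 {w1} => w d; nra.
by move=> et; rewrite -[in RHS]et mulrA -expr2 e2 mul1r; ring.
Qed.

Lemma jacobian_comp f g q : differentiable f q -> differentiable g (f q) ->
  Defs.jacobian (fun x => g (f x)) q = Defs.jacobian g (f q) *m Defs.jacobian f q.
Proof.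
move=> fd gd; apply/matrixP => i j; rewrite !mxE derive_comp // deriveE //.
set w := 'D_(ebasis R j) f q.
rewrite [in LHS](qc_sum_ebasis w) linear_sum summxE; apply: eq_bigr => k _.
rewrite linearZ !mxE mulrC (deriveE _ gd); congr (_ * _).
by rewrite /qc inord_val.
Qed.

Lemma act_real (e s t : R) : is_sign e ->
  act (qone R) e s (qreal (th t)) = qreal (th (e * (s + t))).
Proof.
move=> he; have hB : inB (qreal (th t) : quat R).
  by apply: real_inB; exact: sqr_tanh_lt1.
have -> : act (qone R) e s (qreal (th t)) = e *: boost (th s) (qreal (th t)).
  by rewrite actE qconj1 qmul1l qmul1r.
have -> : th (e * (s + t)) = e * th (s + t).
  by case: he => ->; rewrite ?mul1r ?mulN1r ?tanhN.
rewrite /qreal -scalerA; congr (_ *: _); rewrite -!/(qreal _).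
have g0 : axis_gap (boost (th s) (qreal (th t))) = 0.
  by rewrite axis_gap_boost ?sqr_tanh_lt1 // axis_gap_real.
have bB := boost_inB (sqr_tanh_lt1 s) hB.
by have := axis_gap_eq0 bB g0; rewrite axis_coord_boost // axis_coord_real.
Qed.

Lemma isometry_normal_form f : isometry_B f -> exists e t,
  is_sign e /\ exists A : nat -> quat R,
  [/\ A 0 = qone R,
    forall i j, (i < 4)%N -> (j < 4)%N -> qdot (A i) (A j) = (i == j)%:R &
    forall q, inB q -> act (qone R) e t (f q) = qbasis_comb A q].
Proof.
move=> fi; have fi' := isometry_inf_isometry fi.
have [h [hi hf fh]] := isometry_inverse fi.
have realB t : inB (qreal (th t) : quat R) by apply: real_inB; exact: sqr_tanh_lt1.
have [u fu] : exists u : R -> R, forall t, f (qreal (th t)) = qreal (th (u t)).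
  exists (fun t => axis_coord (f (qreal (th t)))) => t.
  by have [s sE] := isometry_axis t fi; rewrite sE axis_coord_real.
have hu t : h (qreal (th (u t))) = qreal (th t) by rewrite -fu hf.
have ui s t : `|u t - u s| = `|t - s|.
  apply/eqP; rewrite eq_le; apply/andP; split.
    have := slow_axis_coord s t (inf_isometry_slow fi' (@ray_real_slow R)).
    by rewrite !fu !axis_coord_real.
  have := slow_axis_coord (u s) (u t) (inf_isometry_slow hi (@ray_real_slow R)).
  by rewrite !hu !axis_coord_real.
have [e he uE] := line_isometry ui.
have ee : e * e = 1 by case: he => ->; ring.
have S1 := inSp1_1 R.
(* On the axis [f] acts as [t -> u 0 + e * t], which this group element undoes. *)
exists e, (- u 0); split=> //.
pose G := act (qone R) e (- u 0).
pose K := act (qconj (qone R)) e (- (e * - u 0)).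
pose g q := G (f q); pose h' q := h (K q).
have Gi : inf_isometry G := act_inf_isometry _ S1 he.
have Ki : inf_isometry K := act_inf_isometry _ (inSp1_conj S1) he.
have gi : inf_isometry g := inf_isometry_comp fi' Gi.
have hi' : inf_isometry h' := inf_isometry_comp Ki hi.
have fB q (hq : inB q) : inB (f q) by have [] := fi' q hq.
have KB q (hq : inB q) : inB (K q) by have [] := Ki q hq.
have h'B q (hq : inB q) : inB (h' q) by have [] := hi' q hq.
have gB q (hq : inB q) : inB (g q) by have [] := gi q hq.
have hg q : inB q -> h' (g q) = q.
  by move=> hq; rewrite /h' /g /K /G act_inv ?hf //; exact: fB.
have gh q : inB q -> g (h' q) = q.
  by move=> hq; rewrite /h' /g fh; [exact: act_invr | exact: KB].
have ga : fixes_axis g.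
  move=> t; rewrite /g fu /G act_real // (uE t).
  by have -> : e * (- u 0 + (u 0 + e * t)) = (e * e) * t by [ring]; rewrite ee mul1r.
have ha : fixes_axis h' by move=> t; rewrite -[in LHS](ga t) hg.
have gap q : inB q -> axis_gap (g q) = axis_gap q.
  move=> hq; apply/eqP; rewrite eq_le axis_gap_le //=.
  by rewrite -{1}(hg q hq); apply: axis_gap_le => //; exact: gB.
have gc : preserves_coords g.
  move=> q hq; apply: axis_coordinates_inj => //; [exact: gB| |exact: gap].
  exact: axis_coord_preserved.
have hc : preserves_coords h'.
  by move=> q hq; have [] := gc _ (h'B q hq); rewrite gh // => -> ->.
have [A [A0 AE gA]] := orthogonal_of_contractions gi hi' gc hc hg ga.
by exists A; split.
Qed.

Lemma is_derive_comb (A : nat -> quat R) q v :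
  is_derive q v (qbasis_comb A) (qbasis_comb A v).
Proof.
have k i : is_derive q v (fun x : quat R => qc x i) (qc v i).
  exact: (is_derive_qc i (is_derive_id q v)).
have k0 := k 0%N; have k1 := k 1%N; have k2 := k 2%N; have k3 := k 3%N.
apply: is_derive_quat => i _; rewrite /qbasis_comb; under eq_fun do rewrite !qcE.
by apply: is_derive_eq; rewrite /GRing.scale /= !qcE; ring.
Qed.

Lemma qbasis_comb_unit (A : nat -> quat R) j : (j < 4)%N ->
  qbasis_comb A (qunit R j) = A j.
Proof.
by case: j => [|[|[|[|//]]]] _; rewrite /qbasis_comb /qunit !qcE /=
  ?(scale0r, scale1r, addr0, add0r).
Qed.

Lemma orient_pres_isometry_action f :
  orient_pres_isometry_B f -> action_transformation f.
Proof.
move=> [fi fj]; have fi' := isometry_inf_isometry fi.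
have [e [t [he [A [A0 AE gA]]]]] := isometry_normal_form fi.
have S1 := inSp1_1 R.
have B0 : inB (0 : quat R) by rewrite /inB qnorm2_0.
have [f0B fd _] := fi' 0 B0.
have Gi := act_inf_isometry t S1 he.
have [_ Gd _] := Gi _ f0B.
(* The normalised map is linear on the ball, so its frame determinant is its Jacobian at 0, a
   product of two positive ones by the chain rule. *)
have detA : 0 < \det (\matrix_(i < 4, j < 4) qc (A j) i).
  have -> : \matrix_(i < 4, j < 4) qc (A j) i =
      Defs.jacobian (fun q => act (qone R) e t (f q)) 0.
    apply/matrixP => i j; rewrite !mxE.
    have -> : 'D_(ebasis R j) (fun q => act (qone R) e t (f q)) 0 =
        'D_(ebasis R j) (qbasis_comb A) 0.
      apply: near_eq_derive; near=> q.
      by apply: gA; near: q; exact: inB_near.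
    have [_ ->] := is_derive_comb A 0 (ebasis R j).
    by rewrite ebasisE qbasis_comb_unit // /qc inord_val.
  rewrite (jacobian_comp fd Gd) det_mulmx.
  by apply: mulr_gt0; [exact: act_jacobian | exact: fj].
have [u uS uE] := frame_conj A0 AE detA.
(* The inverse of the normalising element composed with conjugation by [u], with the parameters that
   [act_comp] produces. *)
exists (qconj (qone R) ** u), (e * 1), (1 * (- (e * t)) + 0).
have uS1 : inSp1 (qconj (qone R) ** u) by apply: inSp1_mul => //; exact: inSp1_conj.
have s1 : is_sign (1 : R) by left.
split=> //; split; first by rewrite mulr1.
move=> q hq; rewrite -act_comp //; last exact: inSp1_conj.
have -> : act u 1 0 q = u ** q ** qconj u by rewrite actE tanh0 boost0 scale1r.
rewrite -uE -gA // act_inv //.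
by have [] := fi' q hq.
Unshelve. all: by end_near. Qed.

End OrientationPreservingIsometries.

(** * Quaternionic limits and uniqueness of power series *)

Section PowerSeries.
Variable R : realType.
Local Open Scope classical_set_scope.
Local Notation "x ** y" := (qmul x y) (at level 40, left associativity).
Local Notation N2 := (@qnorm2 R).
Implicit Types (p q x y : quat R) (a b : nat -> quat R).

Lemma qnormE_le x : `|x| <= Num.sqrt (N2 x).
Proof.
apply: row_norm_le; first exact: sqrtr_ge0.
move=> i; rewrite -sqrtr_sqr ler_wsqrtr // qcE_ord /qnorm2.
have h k : 0 <= qc x k ^+ 2 := sqr_ge0 _.
move: (h 0%N) (h 1%N) (h 2%N) (h 3%N).
by case: i => -[|[|[|[|//]]]] ? /=; lra.
Qed.

Lemma cvg_rlim (u : nat -> R) (l l' : R) : l = l' -> u @ \oo --> l -> u @ \oo --> l'.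
Proof. by move=> ->. Qed.

(** The topology comes from the maximum norm of the coordinates; passing to the multiplicative
    [qnorm2] makes limits of products accessible. *)
Lemma cvg_qnorm2 (u : nat -> quat R) (l : quat R) :
  (N2 (u n - l) @[n --> \oo] --> (0 : R)) -> u @ \oo --> l.
Proof.
move=> h; apply/cvgrPdist_lt => e e0.
have e2 : 0 < e ^+ 2 by rewrite exprn_gt0.
move/cvgrPdist_lt : h => /(_ _ e2); apply: filter_app; near=> n.
rewrite sub0r normrN ger0_norm ?qnorm2_ge0 // => h.
rewrite distrC; apply: le_lt_trans (qnormE_le _) _.
by rewrite -(ger0_norm (ltW e0)) -sqrtr_sqr ltr_sqrt.
Unshelve. all: by end_near. Qed.

Lemma cvg_qc (u : nat -> quat R) (l : quat R) i :
  u @ \oo --> l -> qc (u n) i @[n --> \oo] --> qc l i.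
Proof.
move=> h; apply: (@cvg_comp _ _ _ u (fun x : quat R => qc x i)); first exact: h.
have d : differentiable (fun x : quat R => qc x i) l by exact: differentiable_coord.
exact: (differentiable_continuous d).
Qed.

Lemma cvg_qnorm2P (u : nat -> quat R) (l : quat R) :
  u @ \oo --> l -> (N2 (u n - l) @[n --> \oo] --> (0 : R)).
Proof.
move=> h; have c i : (qc (u n) i - qc l i) ^+ 2 @[n --> \oo] --> (0 : R).
  apply: (@cvg_rlim _ ((qc l i - qc l i) * (qc l i - qc l i))).
    by rewrite subrr mulr0.
  under eq_fun do rewrite expr2.
  by apply: cvgM; apply: cvgB; [exact: cvg_qc|exact: cvg_cst|exact: cvg_qc|exact: cvg_cst].
apply: (@cvg_rlim _ (0 + 0 + 0 + 0)); first by rewrite !addr0.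
under eq_fun do rewrite /qnorm2 !qcD !qcN.
by do ![apply: cvgD => //].
Qed.

Lemma qnorm2D_le x y : N2 (x + y) <= 2 * N2 x + 2 * N2 y.
Proof.
rewrite -subr_ge0; have -> : 2 * N2 x + 2 * N2 y - N2 (x + y) = N2 (x - y).
  by rewrite /qnorm2 !qcE; ring.
exact: qnorm2_ge0.
Qed.

Lemma cvg_qmulr (u : nat -> quat R) l p : u @ \oo --> l -> (fun n => u n ** p) @ \oo --> l ** p.
Proof.
move=> /cvg_qnorm2P h; apply: cvg_qnorm2.
under eq_fun do rewrite -qmulBl qnorm2M.
apply: (@cvg_rlim _ (0 * N2 p)); first by rewrite mul0r.
by apply: cvgM => //; exact: cvg_cst.
Qed.

Lemma cvg_qmull (u : nat -> quat R) l p : u @ \oo --> l -> (fun n => p ** u n) @ \oo --> p ** l.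
Proof.
move=> /cvg_qnorm2P h; apply: cvg_qnorm2.
under eq_fun do rewrite -qmulBr qnorm2M.
apply: (@cvg_rlim _ (N2 p * 0)); first by rewrite mulr0.
by apply: cvgM => //; exact: cvg_cst.
Qed.

(** It suffices to kill the constant term, since dividing by [x] then gives a series with the same
    property. The constant term is at most [x] times a bounded tail, for every small [x]. *)
Lemma real_pseries_eq0 (c : nat -> R) :
  (forall x : R, 0 < x < 1 -> series (fun n => c n * x ^+ n) @ \oo --> (0 : R)) ->
  forall n, c n = 0.
Proof.
move=> hc; suff H (d : nat -> R) : (forall x : R, 0 < x < 1 ->
    series (fun n => d n * x ^+ n) @ \oo --> (0 : R)) ->
    d 0%N = 0 /\ (forall x : R, 0 < x < 1 ->
    series (fun n => d n.+1 * x ^+ n) @ \oo --> (0 : R)).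
  move=> n; elim: n c hc => [|n IH] c hc; first by have [] := H c hc.
  by apply: (IH (fun n => c n.+1)); have [] := H c hc.
move=> {c} {}hc.
have rec (x : R) (N : nat) : series (fun n => d n * x ^+ n) N.+1 =
    d 0%N + x * series (fun n => d n.+1 * x ^+ n) N.
  rewrite /series /= big_nat_recl //= expr0 mulr1; congr (_ + _).
  by rewrite mulr_sumr; apply: eq_bigr => k _; rewrite exprS; ring.
have d0 : d 0%N = 0.
  have h12 : 0 < (2^-1 : R) < 1 by lra.
  have : cvgn (series (fun n => d n * 2^-1 ^+ n)).
    by apply/cvg_ex; exists 0; exact: hc.
  move/cvg_series_cvg_0 => /cvgP/cvg_seq_bounded [M [_ /(_ (M + 1))]].
  rewrite ltrDl ltr01 => /(_ isT) hM.
  set K := M + 1 in hM; have K0 : 0 <= K by apply: le_trans (hM 0%N I).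
  apply/eqP; rewrite -normr_eq0 eq_le normr_ge0 andbT.
  apply/ler_addgt0Pr => e e0; rewrite add0r.
  (* Convergence at 1/2 bounds the terms there by [K], hence the tail at any [x <= 1/4] by
     [4 * K]. *)
  pose x := Num.min (4^-1) (e / (4 * (K + 1))).
  have P0 : 0 < 4 * (K + 1) by lra.
  have x0 : 0 < x by rewrite lt_min divr_gt0 // andbT; lra.
  have x4 : x <= 4^-1 by rewrite ge_min lexx.
  have xe : x * (4 * (K + 1)) <= e.
    by rewrite -ler_pdivlMr // ge_min lexx orbT.
  have hx : 0 < x < 1 by rewrite x0; lra.
  have bound (N : nat) : `|x * series (fun n => d n.+1 * x ^+ n) N| <= e.
    apply: le_trans xe; rewrite normrM gtr0_norm // ler_pM2l //.
    have h1 : `|series (fun n => d n.+1 * x ^+ n) N| <= 2 * K * series (fun n => 2^-1 ^+ n) N.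
      rewrite /series /=; apply: le_trans (ler_norm_sum _ _ _) _.
      rewrite mulr_sumr; apply: ler_sum => n _.
      have p0 : 0 <= 2^-1 ^+ n :> R by rewrite exprn_ge0 // invr_ge0.
      have h : `|d n.+1| * (2^-1 * 2^-1 ^+ n) <= K.
        have := hM n.+1 I; rewrite /= normrM exprS [X in _ * X]ger0_norm //.
      rewrite normrM normrX (gtr0_norm x0).
      apply: (@le_trans _ _ (`|d n.+1| * (2^-1 * 2^-1) ^+ n)).
        have q4 : x <= 2^-1 * 2^-1 by move: x4; lra.
        have q0 : 0 <= 2^-1 * 2^-1 :> R by lra.
        by rewrite ler_wpM2l // lerXn2r // nnegrE // ltW.
      rewrite exprMn; have := ler_wpM2r p0 h; lra.
    apply: le_trans h1 _.
    have h2 : series (fun n => 2^-1 ^+ n : R) N <= 2.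
      elim: N => [|N _]; first by rewrite /series /= big_geq.
      have -> : series (fun n => 2^-1 ^+ n : R) N.+1 = 2 - 2^-1 ^+ N.
        elim: N => [|N IHN]; first by rewrite /series /= big_nat1 !expr0; ring.
        by rewrite seriesSr IHN !exprS; field.
      by rewrite gerBl exprn_ge0 ?invr_ge0.
    have := ler_wpM2l (mulr_ge0 (ler0n R 2) K0) h2; lra.
  have cv : (fun N => `|series (fun n => d n * x ^+ n) N.+1 - d 0%N|) @ \oo --> `|0 - d 0%N|.
    apply: cvg_norm; apply: cvgB; last exact: cvg_cst.
    by have := hc x hx; rewrite -(cvg_shiftS (series _)).
  rewrite -normrN -sub0r; apply: (cvgr_to_le cv).
  by near=> N; rewrite rec addrAC subrr add0r; exact: bound.
split=> // x hx.
have cv : (fun N => x^-1 * series (fun n => d n * x ^+ n) N.+1) @ \oo --> x^-1 * 0.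
  apply: cvgM; first exact: cvg_cst.
  by have := hc x hx; rewrite -(cvg_shiftS (series _)).
rewrite mulr0 in cv; apply: cvg_trans cv.
apply: near_eq_cvg; near=> N; rewrite rec d0 add0r mulKf //.
by rewrite gt_eqF //; case/andP: hx.
Unshelve. all: by end_near. Qed.

End PowerSeries.

(** * Star inverse of a linear function *)

Section RegularMobius.
Variable R : realType.
Local Open Scope classical_set_scope.
Local Notation "x ** y" := (qmul x y) (at level 40, left associativity).
Local Notation N2 := (@qnorm2 R).
Implicit Types (p q x y : quat R) (a b c d : quat R) (s : nat -> quat R).

Lemma qpow_real (r : R) n : qpow (qreal r : quat R) n = qreal (r ^+ n).
Proof.
elim: n => [|n IH]; first by rewrite /qpow /= expr0 /qreal scale1r.
by rewrite /qpow /= -/(qpow _ n) IH qrealE /qreal scalerA exprS.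
Qed.

Lemma qc_series (u : nat -> quat R) i n :
  qc (series u n) i = series (fun k => qc (u k) i) n.
Proof.
elim: n => [|n IH]; first by rewrite /series /= !big_geq // qc0.
by rewrite !seriesSr qcD IH.
Qed.

(** At real points each coordinate of the series is a real power series in the coordinates of the
    coefficients. *)
Lemma pseries_unique s s' (f : quat R -> quat R) :
  (forall q, inB q -> Defs.pseries s q @ \oo --> f q) ->
  (forall q, inB q -> Defs.pseries s' q @ \oo --> f q) -> forall n, s n = s' n.
Proof.
move=> hs hs'.
have H i n : qc (s n) i - qc (s' n) i = 0.
  apply: (@real_pseries_eq0 R (fun n => qc (s n) i - qc (s' n) i)) => r /andP[r0 r1].
  have qB : inB (qreal r : quat R) by apply: real_inB; nra.
  have E (t : nat -> quat R) m : qc (Defs.pseries t (qreal r) m) i =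
      series (fun n => r ^+ n * qc (t n) i) m.
    rewrite /Defs.pseries qc_series; congr (series _ m); apply/funext => k.
    by rewrite qpow_real qrealE qcZ.
  have c1 := @cvg_qc _ _ _ i (hs _ qB); have c2 := @cvg_qc _ _ _ i (hs' _ qB).
  have -> : series (fun n => (qc (s n) i - qc (s' n) i) * r ^+ n) =
      (fun m => qc (Defs.pseries s (qreal r) m) i - qc (Defs.pseries s' (qreal r) m) i).
    apply/funext => m.
    by rewrite !E /series /= -sumrB; apply: eq_bigr => k _; ring.
  by have := cvgB c1 c2; rewrite subrr; apply.
move=> n; have h i := subr0_eq (H i n).
by apply: quatP; exact: h.
Qed.

(** The choice made by [epsilon] can be identified only through uniqueness of the coefficients. *)
Lemma sr_coeffs_eq (f : quat R -> quat R) s :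
  (forall q, inB q -> Defs.pseries s q @ \oo --> f q) -> sr_coeffs f = s.
Proof.
move=> hs; apply/funext => n; apply: (pseries_unique _ hs).
rewrite /sr_coeffs; move: n => _.
exact: (ClassicalEpsilon.epsilon_spec (inhabits (fun=> 0))
  (fun t => forall q, inB q -> Defs.pseries t q @ \oo --> f q)
  (ex_intro _ s hs)).
Qed.

Lemma sr_eval_eq s q l : Defs.pseries s q @ \oo --> l -> sr_eval s q = l.
Proof. by move=> h; apply: cvg_lim. Qed.

Lemma pseries_quadratic s q : (forall n, (3 <= n)%N -> s n = 0) ->
  Defs.pseries s q @ \oo --> s 0 + q ** s 1 + q ** q ** s 2.
Proof.
move=> s0.
have E n : (3 <= n)%N -> Defs.pseries s q n = s 0%N + q ** s 1%N + q ** q ** s 2%N.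
  rewrite /Defs.pseries; elim: n => [//|n IH]; rewrite leq_eqVlt => /orP[/eqP <-|].
    by rewrite !seriesSr /series /= big_geq // add0r /qpow /= !qmul1r qmul1l.
  by rewrite ltnS => n3; rewrite seriesSr IH // (s0 n) // qmul0r addr0.
apply: cvg_near_cst; near=> n; apply: E; near: n; exact: nbhs_infty_ge.
Unshelve. all: by end_near. Qed.

Definition lin_coef a b (n : nat) : quat R :=
  match n with 0 => b | 1 => a | _ => 0 end.

Lemma pseries_lin a b q : Defs.pseries (lin_coef a b) q @ \oo --> q ** a + b.
Proof.
have := @pseries_quadratic (lin_coef a b) q; rewrite /= qmul0r addr0 addrC.
by apply; case=> [|[|[]]].
Qed.

Lemma sr_coeffs_ell a b : sr_coeffs (ell a b) = lin_coef a b.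
Proof. by apply: sr_coeffs_eq => q _; exact: pseries_lin. Qed.

Lemma sr_c_ell c d q : sr_c (ell c d) q = q ** qconj c + qconj d.
Proof.
rewrite /sr_c sr_coeffs_ell; apply: sr_eval_eq.
have -> : (fun n => qconj (lin_coef c d n)) = lin_coef (qconj c) (qconj d).
  by apply/funext => -[|[|n]] //=; rewrite qconj0.
exact: pseries_lin.
Qed.

(** The symmetrisation of [d + q c]; its coefficients are real, so it commutes with [q]. *)
Definition ell_s c d q : quat R :=
  N2 d *: qone R + (2 * qdot c d) *: q + N2 c *: (q ** q).

Lemma sr_s_ell c d q : sr_s (ell c d) q = ell_s c d q.
Proof.
rewrite /sr_s /sr_star sr_coeffs_ell.
have -> : sr_coeffs (sr_c (ell c d)) = lin_coef (qconj c) (qconj d).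
  apply: sr_coeffs_eq => p _; rewrite sr_c_ell; exact: pseries_lin.
apply: sr_eval_eq; rewrite /ell_s.
set s := star_coef _ _.
have s0 : s 0%N = N2 d *: qone R.
  by rewrite /s /star_coef big_ord1 /= qmul_conjr.
have s1 : s 1%N = (2 * qdot c d) *: qone R.
  rewrite /s /star_coef !big_ord_recl big_ord0 /= addr0.
  by rewrite /qdot; qring.
have s2 : s 2%N = N2 c *: qone R.
  rewrite /s /star_coef !big_ord_recl big_ord0 /= /bump /= addr0.
  by rewrite qmul0r qmul0l add0r addr0 qmul_conjr.
have sn n : (3 <= n)%N -> s n = 0.
  move=> n3; rewrite /s /star_coef big1 // => k _.
  have [k2|k2] := leqP 2 k.
    by case: (nat_of_ord k) k2 => [|[|m]] //= _; rewrite qmul0l.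
  have : (2 <= n - k)%N := leq_sub n3 (k2 : (k <= 1)%N).
  by case: (n - k)%N => [|[|m]] //= _; rewrite qmul0r.
have := @pseries_quadratic s q sn; rewrite s0 s1 s2 !qmulZr !qmul1r; by apply.
Qed.

Lemma ell_s_mul c d q x : ell_s c d q ** x =
  (N2 d *: x + (2 * qdot c d) *: (q ** x)) + N2 c *: (q ** q ** x).
Proof. by rewrite /ell_s !qmulDl !qmulZl qmul1l. Qed.

(** For a slice regular function with value [X] at [q], the star product with [d + q c] has the
    value [X d + q X c]; here [X] is the value of the conjugate function. *)
Lemma ell_sE c d q :
  ell_s c d q = (q ** qconj c + qconj d) ** d + q ** (q ** qconj c + qconj d) ** c.
Proof.
rewrite /ell_s !qmulDr !qmulDl -!qmulA !qmul_conjl !qmulZr !qmul1r.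
have -> : (2 * qdot c d) *: q = q ** (qconj c ** d + qconj d ** c).
  have -> : qconj c ** d + qconj d ** c = (2 * qdot c d) *: qone R.
    by rewrite /qdot; qring.
  by rewrite qmulZr qmul1r.
rewrite qmulDr; move: (q ** (qconj c ** d)) (q ** (qconj d ** c)) (q ** q) => u v w.
by qring.
Qed.

(** Norms in [X d = - q X c] with [|q| |c| < |d|] force [X = 0], and then [|q| |c| = |d|]. *)
Lemma ell_s_neq0 c d q : N2 c < N2 d -> inB q -> ell_s c d q != 0.
Proof.
move=> cd hq; apply/eqP => h; have := ell_sE c d q; rewrite h.
set X := q ** qconj c + qconj d.
move=> /esym/eqP; rewrite addr_eq0 => /eqP e.
have := congr1 N2 e; rewrite qnorm2N !qnorm2M => e2.
have q0 := qnorm2_ge0 q; have c0 := qnorm2_ge0 c; rewrite /inB in hq.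
have lt : N2 q * N2 c < N2 d.
  by apply: le_lt_trans cd; rewrite -[leRHS]mul1r ler_wpM2r // ltW.
have X0 : N2 X = 0.
  apply/eqP; apply: contraT => Xn.
  have Xp : 0 < N2 X by rewrite lt0r Xn qnorm2_ge0.
  by move: lt; rewrite -(ltr_pM2l Xp); move: e2; rewrite /X; lra.
move/eqP: X0; rewrite qnorm2_eq0 addr_eq0 => /eqP e3.
have := congr1 N2 e3; rewrite qnorm2N qnorm2M !qnorm2_conj; lra.
Qed.

Lemma ell_s_comm c d q : q ** ell_s c d q = ell_s c d q ** q.
Proof.
by rewrite ell_s_mul /ell_s !qmulDr !qmulZr qmul1r !qmulA.
Qed.

(** A geometric series, solving [s 0 ** d = 1] and [s n.+1 ** d + s n ** c = 0]. *)
Definition inv_coef c d (n : nat) : quat R :=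
  qinv d ** qpow (- (c ** qinv d)) n.

Lemma qpowS x n : qpow x n.+1 = x ** qpow x n.
Proof. by []. Qed.

Lemma qpowSr x n : qpow x n.+1 = qpow x n ** x.
Proof.
elim: n => [|n IH]; first by rewrite /qpow /= qmul1l qmul1r.
by rewrite [LHS]qpowS {1}IH qmulA -qpowS.
Qed.

Lemma qnorm2_pow x n : N2 (qpow x n) = N2 x ^+ n.
Proof.
elim: n => [|n IH]; first by rewrite /qpow /= qnorm2_1.
by rewrite qpowS qnorm2M IH exprS.
Qed.

Lemma pseriesS s q n : Defs.pseries s q n.+1 = Defs.pseries s q n + qpow q n ** s n.
Proof. by rewrite /Defs.pseries seriesSr. Qed.

Lemma pseries0 s q : Defs.pseries s q 0 = 0.
Proof. by rewrite /Defs.pseries /series /= big_geq. Qed.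

Lemma inv_coef_partial c d q n : d != 0 ->
  Defs.pseries (inv_coef c d) q n ** d + q ** Defs.pseries (inv_coef c d) q n ** c =
  qone R - qpow q n ** inv_coef c d n ** d.
Proof.
move=> d0; elim: n => [|n IH].
  rewrite pseries0 !(qmul0l, qmul0r) addr0 /inv_coef /qpow /= qmul1r qmul1l.
  by rewrite qmulVl // subrr.
rewrite pseriesS !qmulDl !qmulDr !qmulDl addrACA IH.
have -> : inv_coef c d n.+1 = - (inv_coef c d n ** c ** qinv d).
  by rewrite /inv_coef qpowSr qmulNr !qmulA qmulNr !qmulA.
rewrite qmulNr qmulNl opprK addrA subrK -!qmulA; congr (_ + _).
by rewrite qmulVl // qmul1r.
Qed.

(** [W] solves [W d + q W c = 1], and by telescoping the partial sums solve it up to [Y n], which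
    decays geometrically. Inverting [E -> E d + q E c] explicitly turns this into convergence to
    [W]. *)
Lemma sr_invstar_ell c d q : N2 c < N2 d -> inB q ->
  Defs.pseries (inv_coef c d) q @ \oo --> sr_invstar (ell c d) q.
Proof.
move=> cd hq; rewrite /sr_invstar sr_s_ell sr_c_ell.
have c0 := qnorm2_ge0 c; have q0 := qnorm2_ge0 q.
have dp : 0 < N2 d by exact: le_lt_trans cd.
have d0 : d != 0 by rewrite -qnorm2_gt0.
have L0 := ell_s_neq0 cd hq.
set L := ell_s c d q in L0 *; set X := q ** qconj c + qconj d.
have Lq : q ** qinv L = qinv L ** q.
  apply: (qmulI L0); apply: (qmulIr L0).
  by rewrite !qmulA qmulVr // qmul1l -!qmulA qmulVl // qmul1r -ell_s_comm.
set W := qinv L ** X.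
have WE : W ** d + q ** W ** c = qone R.
  rewrite /W qmulA Lq -!qmulA -qmulDr -[RHS](qmulVl L0); congr (_ ** _).
  by rewrite /L ell_sE !qmulA.
(* This operator followed by its conjugate is left multiplication by the symmetrisation [L]. *)
have solve E : L ** E = (E ** d + q ** E ** c) ** qconj d + q ** (E ** d + q ** E ** c) ** qconj c.
  rewrite /L ell_s_mul !qmulDr !qmulDl -!qmulA !qmul_conjr !qmulZr !qmul1r.
  have -> : (2 * qdot c d) *: (q ** E) = q ** (E ** (c ** qconj d + d ** qconj c)).
    have -> : c ** qconj d + d ** qconj c = (2 * qdot c d) *: qone R.
      by rewrite /qdot; qring.
    by rewrite !qmulZr qmul1r.
  rewrite !qmulDr.
  move: (q ** (E ** (c ** qconj d))) (q ** (E ** (d ** qconj c))) (q ** (q ** E)) => u v w.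
  by apply: quatP; rewrite !(qcD, qcZ); ring.
apply: cvg_qnorm2.
pose Y n := - (qpow q n ** inv_coef c d n ** d).
pose K := N2 (qinv L) * (2 * N2 d + 2 * (N2 q * N2 c)).
have bound n : N2 (Defs.pseries (inv_coef c d) q n - W) <= K * N2 (Y n).
  set E := _ - W.
  have EY : E ** d + q ** E ** c = Y n.
    rewrite /E qmulBl qmulBr qmulBl addrACA inv_coef_partial //.
    by rewrite -opprD WE addrAC subrr add0r.
  have : E = qinv L ** (Y n ** qconj d + q ** Y n ** qconj c).
    by apply: (qmulI L0); rewrite solve EY qmulA qmulVr // qmul1l.
  move=> ->; rewrite qnorm2M /K -mulrA ler_wpM2l ?qnorm2_ge0 //.
  apply: le_trans (qnorm2D_le _ _) _; rewrite !qnorm2M !qnorm2_conj.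
  by rewrite le_eqVlt; apply/orP; left; apply/eqP; ring.
have YE n : N2 (Y n) = (N2 q * (N2 c / N2 d)) ^+ n.
  rewrite /Y qnorm2N !qnorm2M !qnorm2_pow qnorm2N qnorm2M !qnorm2V [RHS]exprMn.
  move: (N2 q ^+ n) ((N2 c / N2 d) ^+ n) => A B.
  by field; rewrite gt_eqF.
set k := N2 q * (N2 c / N2 d) in YE.
have k0 : 0 <= k by rewrite mulr_ge0 // divr_ge0 // ltW.
have k1 : k < 1.
  apply: le_lt_trans hq; rewrite -[leRHS]mulr1 ler_wpM2l //.
  by rewrite ler_pdivrMr // mul1r ltW.
have cv : (K * k ^+ n @[n --> \oo] --> (0 : R)).
  apply: (@cvg_rlim _ _ (K * 0)); first by rewrite mulr0.
  apply: cvgM; first exact: cvg_cst.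
  by apply: cvg_expr; rewrite ger0_norm.
apply: (squeeze_cvgr _ (cvg_cst 0) cv).
near=> n; rewrite qnorm2_ge0 /= -YE; exact: bound.
Unshelve. all: by end_near. Qed.

End RegularMobius.

(** * Zeros of regular Moebius transformations *)

Section MobiusZero.
Variable R : realType.
Local Open Scope classical_set_scope.
Local Notation "x ** y" := (qmul x y) (at level 40, left associativity).
Local Notation N2 := (@qnorm2 R).
Implicit Types (p q u x y : quat R) (a b c d : quat R) (X Y A : qmat R).

Lemma star_coef_lin0 (s : nat -> quat R) a b :
  star_coef s (lin_coef a b) 0 = s 0%N ** b.
Proof. by rewrite /star_coef big_ord1. Qed.

Lemma star_coef_linS (s : nat -> quat R) a b n :
  star_coef s (lin_coef a b) n.+1 = s n.+1 ** b + s n ** a.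
Proof.
rewrite /star_coef big_ord_recr /= subnn big_ord_recr /= subSnn /= big1.
  by rewrite add0r addrC.
move=> k _; have : (2 <= n.+1 - k)%N.
  by have := leq_sub (leqnn n.+2) (ltn_ord k); rewrite subSS -[(n.+2 - n)%N]/(n.+2 - n)%N subSn // subSnn.
by case: (n.+1 - k)%N => [|[|m]] //= _; rewrite qmul0r.
Qed.

Lemma mobius_eval Y q : N2 (m12 Y) < N2 (m22 Y) -> inB q ->
  let W := sr_invstar (ell (m12 Y) (m22 Y)) q in
  mobius Y q = W ** m21 Y + q ** W ** m11 Y.
Proof.
case: Y => a c b d /= cd hq; rewrite /mobius /sr_star /= sr_coeffs_ell.
have -> : sr_coeffs (sr_invstar (ell c d)) = inv_coef c d.
  by apply: sr_coeffs_eq => p pB; exact: sr_invstar_ell.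
have hW := sr_invstar_ell cd hq; set W := sr_invstar _ q in hW *.
apply: sr_eval_eq; set P := Defs.pseries (inv_coef c d) q in hW.
(* Multiplication by [q] shifts degrees, so the sum paired with [a] is one term shorter than the one
   paired with [b]; the limit is the same. *)
have E n : Defs.pseries (star_coef (inv_coef c d) (lin_coef a b)) q n.+1 =
    P n.+1 ** b + q ** P n ** a.
  elim: n => [|n IH].
    by rewrite /P !pseriesS !pseries0 star_coef_lin0 !(qmul0l, qmul0r) !add0r addr0 !qmulA.
  have P1 : P n.+1 = P n + qpow q n ** inv_coef c d n := pseriesS _ _ _.
  have P2 : P n.+2 = P n.+1 + qpow q n.+1 ** inv_coef c d n.+1 := pseriesS _ _ _.
  rewrite pseriesS IH star_coef_linS P2 [in q ** P n.+1]P1.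
  rewrite qpowS; move: (P n.+1) (P n) (qpow q n) (inv_coef c d n) (inv_coef c d n.+1).
  by move=> u v z e e1; rewrite !(qmulDl, qmulDr) !qmulA addrACA.
rewrite -cvg_shiftS /=; under eq_fun do rewrite E.
apply: cvgD; last by apply: cvg_qmulr; exact: cvg_qmull.
by apply: cvg_qmulr; rewrite (cvg_shiftS P).
Qed.

(** The inverse of the symmetrisation commutes with [q] and factors out on the left, leaving a
    polynomial equation. *)
Lemma mobius_eq0 Y q : N2 (m12 Y) < N2 (m22 Y) -> inB q ->
  let x := q ** qconj (m12 Y) + qconj (m22 Y) in
  mobius Y q = 0 <-> x ** m21 Y + q ** x ** m11 Y = 0.
Proof.
move=> cd hq x; rewrite mobius_eval // /sr_invstar sr_s_ell sr_c_ell -/x.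
have L0 := ell_s_neq0 cd hq; have Lq := ell_s_comm (m12 Y) (m22 Y) q.
move: (ell_s _ _ _) L0 Lq => L L0 Lq.
have iq : q ** qinv L = qinv L ** q.
  apply: (qmulI L0); apply: (qmulIr L0).
  by rewrite !qmulA qmulVr // qmul1l -!qmulA qmulVl // qmul1r Lq.
rewrite (qmulA q) iq -!(qmulA (qinv L)) -qmulDr; split; last by move=> ->; rewrite qmul0r.
by move/eqP; rewrite qmul_eq0 qinv_eq0 (negbTE L0) => /eqP.
Qed.

End MobiusZero.

(** * The group Sp(1,1) and the identification Phi *)

Section SymplecticMatrices.
Variable R : realType.
Local Notation "x ** y" := (qmul x y) (at level 40, left associativity).
Local Notation N2 := (@qnorm2 R).
Local Notation th := (@Defs.tanh R).
Implicit Types (p q u x y : quat R) (X Y A B : qmat R).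

Lemma qmmulA X Y A : qmmul X (qmmul Y A) = qmmul (qmmul X Y) A.
Proof.
case: X Y A => a b c d [a' b' c' d'] [a2 b2 c2 d2]; rewrite /qmmul /=.
by congr QM; rewrite !qmulDr !qmulDl !qmulA addrACA.
Qed.

Lemma qmmul1 X : qmmul X (qm1 R) = X.
Proof. by case: X => a b c d; rewrite /qmmul /= !(qmul1r, qmul0r) !(addr0, add0r). Qed.

Lemma qmmul1l X : qmmul (qm1 R) X = X.
Proof. by case: X => a b c d; rewrite /qmmul /= !(qmul1l, qmul0l) !(addr0, add0r). Qed.

Lemma qmadjM X Y : qmadj (qmmul X Y) = qmmul (qmadj Y) (qmadj X).
Proof.
case: X Y => a b c d [a' b' c' d']; rewrite /qmmul /qmadj /=.
by rewrite !qconjD !qconjM.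
Qed.

Lemma inSp11_mul X Y : inSp11 X -> inSp11 Y -> inSp11 (qmmul X Y).
Proof.
move=> hX hY; rewrite /inSp11 qmadjM.
by rewrite -!qmmulA (qmmulA (qmadj X)) (qmmulA _ _ Y) [qmmul (qmmul (qmadj X) _) X]hX
  qmmulA hY.
Qed.

Lemma inSp11P X : inSp11 X <->
  [/\ N2 (m11 X) = 1 + N2 (m21 X), N2 (m22 X) = 1 + N2 (m12 X) &
      qconj (m11 X) ** m12 X = qconj (m21 X) ** m22 X].
Proof.
case: X => a b c d; rewrite /inSp11 /qmadj /I11 /qmmul /=.
rewrite !(qmul1r, qmul0r, add0r, addr0, qmulNr, qmulNl) !qmul_conjl.
have sc (r s : R) : (r *: qone R - s *: qone R = qone R) <-> r = 1 + s.
  rewrite -scalerBl; split=> [h|->]; last by rewrite addrK scale1r.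
  have := congr1 (fun x => qc x 0) h; rewrite qcZ /qone qcE mulr1; lra.
split=> [[h1 h2 h3 h4]|[h1 h2 h3]].
  split.
  - exact/sc.
  - apply/sc; rewrite -[RHS]opprK -h4; by rewrite opprB.
  - exact: subr0_eq.
have h1' := (sc _ _).2 h1; have h2' := (sc _ _).2 h2.
congr QM => //.
- by rewrite h3 subrr.
- apply/eqP; rewrite subr_eq0; apply/eqP.
  by have := congr1 (@qconj R) h3; rewrite !qconjM !qconjK.
- by rewrite -opprB h2'.
Qed.

(** The row relations, deduced from the column relations; they make the left inverse below a right
    inverse too. *)
Lemma inSp11_dual X : inSp11 X ->
  [/\ N2 (m12 X) = N2 (m21 X), N2 (m11 X) = N2 (m22 X) &
      m11 X ** qconj (m21 X) = m12 X ** qconj (m22 X)].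
Proof.
move=> /inSp11P [h1 h2 h3].
have e12 : N2 (m12 X) = N2 (m21 X).
  have := congr1 N2 h3; rewrite !qnorm2M !qnorm2_conj h1 h2; lra.
have e11 : N2 (m11 X) = N2 (m22 X) by rewrite h1 h2 e12.
split=> //.
have n0 : N2 (m22 X) != 0.
  by rewrite h2 gt_eqF // ltr_wpDr // qnorm2_ge0.
apply/esym/(scalerI n0).
rewrite -{1}e11.
have -> : N2 (m11 X) *: (m12 X ** qconj (m22 X)) =
    m11 X ** (qconj (m11 X) ** m12 X) ** qconj (m22 X).
  by rewrite qmulA qmul_conjr !qmulZl qmul1l.
by rewrite h3 -!qmulA qmul_conjr !qmulZr qmul1r.
Qed.

(** This is [I11 X^* I11]. *)
Definition sp11_inv X : qmat R :=
  QM (qconj (m11 X)) (- qconj (m21 X)) (- qconj (m12 X)) (qconj (m22 X)).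

Lemma sp11_invl X : inSp11 X -> qmmul (sp11_inv X) X = qm1 R.
Proof.
move=> /inSp11P [h1 h2 h3]; rewrite /sp11_inv /qmmul /qm1 /= !qmulNl.
congr QM.
- by rewrite !qmul_conjl h1 -scalerBl addrK scale1r.
- by rewrite h3 subrr.
- have := congr1 (@qconj R) h3; rewrite !qconjM !qconjK => ->.
  by rewrite addNr.
- by rewrite !qmul_conjl h2 -scaleNr -scalerDl addrCA addNr addr0 scale1r.
Qed.

Lemma sp11_invr X : inSp11 X -> qmmul X (sp11_inv X) = qm1 R.
Proof.
move=> hX; have [h1 h2 _] := (inSp11P X).1 hX; have [e1 e2 h3] := inSp11_dual hX.
rewrite /sp11_inv /qmmul /qm1 /= !qmulNr; congr QM.
- by rewrite !qmul_conjr h1 e1 -scalerBl addrK scale1r.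
- by rewrite h3 addNr.
- have := congr1 (@qconj R) h3; rewrite !qconjM !qconjK => ->.
  by rewrite subrr.
- by rewrite !qmul_conjr h2 e1 -scaleNr -scalerDl addrCA addNr addr0 scale1r.
Qed.

Lemma sp11_inv_unique X Y : inSp11 X -> qmmul Y X = qm1 R -> Y = sp11_inv X.
Proof.
by move=> hX h; rewrite -[LHS]qmmul1 -(sp11_invr hX) qmmulA h qmmul1l.
Qed.

(** With [m = m21 X ** qinv (m22 X)], the equation for a zero of the transformation of [X^-1] is
    [(p - m) - p (p - m) m = 0] times an invertible factor; as [|p|] and [|m|] are below 1, norms
    force [p = m]. *)
Lemma Phi_relP X p : inSp11 X ->
  Phi_rel X p <-> inB p /\ p ** m22 X = m21 X.
Proof.
move=> hX; have [h1 h2 _] := (inSp11P X).1 hX; have [e1 e2 h3] := inSp11_dual hX.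
have n22 : 0 < N2 (m22 X) by rewrite h2 ltr_wpDr // qnorm2_ge0.
have n11 : 0 < N2 (m11 X) by rewrite e2.
have T0 : m22 X != 0 by rewrite -qnorm2_gt0.
have A0 : qconj (m11 X) != 0 by rewrite qconj_eq0 -qnorm2_gt0.
have cd : N2 (m12 (sp11_inv X)) < N2 (m22 (sp11_inv X)).
  by rewrite /= qnorm2N !qnorm2_conj h2 e1 ltrDr.
pose m := m21 X ** qinv (m22 X).
have mT : m ** m22 X = m21 X by rewrite /m -qmulA qmulVl // qmul1r.
have mB : N2 m < 1.
  by rewrite /m qnorm2M qnorm2V ltr_pdivrMr // mul1r h2 e1 ltrDr.
clearbody m.
have bE : m22 X ** qconj (m12 X) = m ** m22 X ** qconj (m11 X).
  have := congr1 (@qconj R) h3; rewrite !qconjM !qconjK mT => ->; by [].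
have key : inB p -> (mobius (sp11_inv X) p = 0 <-> p = m).
  move=> pB; rewrite mobius_eq0 //= qconjN !qconjK.
  have -> : (p ** - m21 X + m22 X) ** - qconj (m12 X) +
      p ** (p ** - m21 X + m22 X) ** qconj (m11 X) =
      ((p - m) - p ** (p - m) ** m) ** (m22 X ** qconj (m11 X)).
    rewrite -mT; move: (m22 X) (qconj (m12 X)) (qconj (m11 X)) bE => T x y bE.
    transitivity (p ** m ** (T ** x) - T ** x - p ** p ** m ** T ** y + p ** T ** y).
      rewrite !(qmulDl, qmulDr, qmulNl, qmulNr) !qmulA opprK.
      move: (p ** m ** T ** x) (T ** x) (p ** p ** m ** T ** y) (p ** T ** y) => a b c d.
      by qring.
    rewrite bE !(qmulBl, qmulBr) !qmulA.
    move: (p ** m ** m ** T ** y) (m ** T ** y) (p ** p ** m ** T ** y) (p ** T ** y) => a b c d.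
    by qring.
  split=> [/eqP|->]; last by rewrite subrr qmul0r qmul0l subrr qmul0l.
  rewrite !qmul_eq0 (negbTE T0) (negbTE A0) !orbF subr_eq0 => /eqP e.
  apply/eqP; rewrite -subr_eq0 -qnorm2_eq0; apply: contraT => dn.
  have dp : 0 < N2 (p - m) by rewrite lt0r dn qnorm2_ge0.
  have := congr1 N2 e; rewrite !qnorm2M => e'.
  have := qnorm2_ge0 p; have := qnorm2_ge0 m; rewrite /inB in pB.
  move: (N2 (p - m)) (N2 p) (N2 m) dp e' pB mB => D P M dp e' pB mB M0 P0.
  have : P * M < 1 by nra.
  nra.
split=> [[pB h]|[pB h]].
  split=> //; rewrite -mT; congr (_ ** _); apply/(key pB)/h; exact: sp11_invl.
split=> // Y hY; rewrite (sp11_inv_unique hX hY); apply/(key pB).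
by apply: (qmulIr T0); rewrite mT.
Qed.

End SymplecticMatrices.

(** * Maps induced by commuting translations *)

Section TranslationGroup.
Variable R : realType.
Local Notation "x ** y" := (qmul x y) (at level 40, left associativity).
Local Notation N2 := (@qnorm2 R).
Local Notation th := (@Defs.tanh R).
Implicit Types (p q u x y : quat R) (X Y A B : qmat R) (f : quat R -> quat R).

Lemma Phi_surj p : inB p -> exists2 X, inSp11 X & Phi_rel X p.
Proof.
move=> pB; have m0 : 0 < 1 - N2 p by rewrite subr_gt0.
(* Normalises the matrix with rows [1, qconj p] and [p, 1]. *)
pose k := (Num.sqrt (1 - N2 p))^-1.
have k2 : k ^+ 2 = (1 - N2 p)^-1 by rewrite /k exprVn sqr_sqrtr // ltW.
have XS : inSp11 (QM (k *: qone R) (k *: qconj p) (k *: p) (k *: qone R)).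
  have kE : k ^+ 2 = 1 + k ^+ 2 * N2 p.
    by rewrite k2; field; rewrite gt_eqF.
  apply/inSp11P; split=> /=.
  - by rewrite !qnorm2Z qnorm2_1 mulr1.
  - by rewrite !qnorm2Z qnorm2_1 qnorm2_conj mulr1.
  - by rewrite !qconjZ qconj1 !qmulZl !qmulZr qmul1l qmul1r.
exists (QM (k *: qone R) (k *: qconj p) (k *: p) (k *: qone R)) => //.
by apply/(Phi_relP _ XS); split=> //=; rewrite qmulZr qmul1r.
Qed.

Lemma central_real x : (forall u, inSp1 u -> u ** x = x ** u) -> x = qreal (qc x 0).
Proof.
move=> h; pose i1 : quat R := mkq 0 1 0 0; pose j1 : quat R := mkq 0 0 1 0.
have hi : inSp1 i1 by rewrite /inSp1 /qnorm2 !qcE; ring.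
have hj : inSp1 j1 by rewrite /inSp1 /qnorm2 !qcE; ring.
have ei := h _ hi; have ej := h _ hj.
have h2 := congr1 (fun x => qc x 3) ei; have h3 := congr1 (fun x => qc x 2) ei.
have h1 := congr1 (fun x => qc x 3) ej.
rewrite /qmul !qcE in h1 h2 h3.
apply: im2_eq0; have e1 : qc x 1 = 0 by lra.
have e2 : qc x 2 = 0 by lra.
have e3 : qc x 3 = 0 by lra.
by rewrite /im2 e1 e2 e3; ring.
Qed.

Lemma qm1_inSp11 : inSp11 (qm1 R).
Proof.
by apply/inSp11P; rewrite /= qnorm2_1 qnorm2_0 addr0 qconj1 qconj0 qmul0l qmul0r.
Qed.

(** Left translation by [diag(1, u)] multiplies both entries of the second row by [u], which
    conjugates their quotient [p]. *)
Lemma rotation_generator u : inSp1 u -> translation_generator (act u 1 0).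
Proof.
move=> hu; pose A := QM (qone R) 0 0 u.
have AS : inSp11 A.
  by apply/inSp11P; rewrite /= qnorm2_1 qnorm2_0 addr0 hu qmul0r qconj0 qmul0l.
exists A; split=> //; left; split.
  move=> v X hv hX; rewrite !qmmulA; split=> //.
  congr (qmmul _ X); rewrite /qmmul /A /diagu1 /=.
  by rewrite !(qmul0l, qmul0r, qmul1l, qmul1r, addr0, add0r).
move=> X p hX /(Phi_relP _ hX) [pB e].
apply/(Phi_relP _ (inSp11_mul AS hX)); split.
  by apply: act_inB => //; left.
rewrite /= !qmul0l !add0r actE tanh0 boost0 scale1r.
by rewrite -!qmulA (qmulA (qconj u)) inSp1_mull // qmul1l e.
Qed.

Lemma scalar_mx_comm X A u : (exists a b c d : R,
   A = QM (qreal a) (qreal b) (qreal c) (qreal d)) ->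
  qmmul (qmmul X (scalu u)) A = qmmul (qmmul X A) (scalu u).
Proof.
move=> [a [b [c [d ->]]]]; case: X => x y z w; rewrite /qmmul /scalu /=.
by congr QM; rewrite !qmul0r !addr0 !add0r ?qmulDl !qrealEr !qmulZl.
Qed.

(** Right translation by a real matrix acts on [p] by a real fractional map. The matrix is [H(t)]
    with its first column multiplied by [e]; [k] is [cosh t]. *)
Lemma boost_generator (e t : R) : is_sign e -> translation_generator (act (qone R) e t).
Proof.
move=> he; have hs := sqr_tanh_lt1 t; set s := th t in hs.
have ee : e * e = 1 by case: he => ->; ring.
have m0 : 0 < 1 - s ^+ 2 by rewrite subr_gt0.
pose k := (Num.sqrt (1 - s ^+ 2))^-1.
have k2 : k ^+ 2 = (1 - s ^+ 2)^-1 by rewrite /k exprVn sqr_sqrtr // ltW.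
have kE : k ^+ 2 = 1 + k ^+ 2 * s ^+ 2.
  by rewrite k2; field; rewrite gt_eqF.
clearbody k; pose A : qmat R := QM (qreal (e * k)) (qreal (k * s)) (qreal (e * k * s)) (qreal k).
have nr (r : R) : N2 (qreal r : quat R) = r ^+ 2 by rewrite /qreal qnorm2Z qnorm2_1 mulr1.
have AS : inSp11 A.
  apply/inSp11P; split=> /=.
  - rewrite !nr; have -> : (e * k) ^+ 2 = (e * e) * k ^+ 2 by ring.
    have -> : (e * k * s) ^+ 2 = (e * e) * (k ^+ 2 * s ^+ 2) by ring.
    by rewrite ee !mul1r.
  - by rewrite !nr exprMn.
  - by rewrite /qreal /qone; qring.
exists A; split=> //; right; split.
  move=> u X hu hX; split; first by rewrite qmmulA.
  by apply: scalar_mx_comm; do 4 eexists.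
move=> X p hX /(Phi_relP _ hX) [pB eq].
apply/(Phi_relP _ (inSp11_mul hX AS)); split.
  by apply: act_inB => //; exact: inSp1_1.
have w0 := boost_den_neq0 hs pB.
have bw : boost s p ** (qone R + s *: p) = p + qreal s.
  by rewrite boost_comm // -qmulA qmulVl // qmul1r.
rewrite /= !qrealEr -eq actE qconj1 qmul1l qmul1r -/s.
have -> : (k * s) *: (p ** m22 X) + k *: m22 X = k *: ((qone R + s *: p) ** m22 X).
  by rewrite qmulDl qmul1l qmulZl scalerDr scalerA addrC.
rewrite qmulZl qmulZr qmulA bw qmulDl qrealE.
by rewrite !scalerDr !scalerA.
Qed.

(** Commutation is tested on the identity matrix. For a left translation [u = -1] kills [m21 A]; for
    a right translation every entry of [A] commutes with Sp(1), hence is real. [Phi_surj] then lets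
    the induced map be read off at each point. *)
Lemma translation_generator_action f :
  translation_generator f -> action_transformation f.
Proof.
move=> [A [AS [] [comm ind]]].
- have c1 u : inSp1 u -> qmmul A (diagu1 u) = qmmul (diagu1 u) A.
    by move=> hu; have [] := comm u (qm1 R) hu qm1_inSp11; rewrite !qmmul1.
  have [h1 h2 _] := (inSp11P A).1 AS; have [e1 e2 _] := inSp11_dual AS.
  have a21 : m21 A = 0.
    have hu : inSp1 (- qone R) by rewrite /inSp1 qnorm2N qnorm2_1.
    have := congr1 (@m21 R) (c1 _ hu); rewrite /= qmulNr qmul1r !qmul0l qmul1l !qmul0r addr0 add0r.
    move=> h; have k i : qc (m21 A) i = 0.
      by have := congr1 (fun x => qc x i) h; rewrite qcN; lra.
    by apply: quatP; rewrite k qc0.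
  have uS : inSp1 (m22 A).
    by rewrite /inSp1 h2 e1 a21 qnorm2_0 addr0.
  exists (m22 A), 1, 0; split=> //; split; first by left.
  move=> p pB; have [X hX hp] := Phi_surj pB.
  have [_ e] := (Phi_relP _ hX).1 hp.
  have [_ e'] := (Phi_relP _ (inSp11_mul AS hX)).1 (ind X p hX hp).
  move: e'; rewrite /= a21 !qmul0l !add0r -e => e'.
  have [_ hx22 _] := (inSp11P X).1 hX.
  have x0 : m22 X != 0.
    by rewrite -qnorm2_gt0 hx22 ltr_wpDr // qnorm2_ge0.
  have {}e' : f p ** m22 A = m22 A ** p.
    by apply: (qmulIr x0); rewrite -!qmulA e'.
  rewrite actE tanh0 boost0 scale1r -e' -qmulA inSp1_mulr // qmul1r.
  by [].
- have c1 u : inSp1 u -> qmmul (scalu u) A = qmmul A (scalu u).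
    by move=> hu; have [] := comm u (qm1 R) hu qm1_inSp11; rewrite !qmmul1l.
  have r11 : m11 A = qreal (qc (m11 A) 0).
    apply: central_real => u /c1 /(congr1 (@m11 R)) /=.
    by rewrite qmul0l qmul0r !addr0.
  have r12 : m12 A = qreal (qc (m12 A) 0).
    apply: central_real => u /c1 /(congr1 (@m12 R)) /=.
    by rewrite qmul0l qmul0r addr0 add0r.
  have r21 : m21 A = qreal (qc (m21 A) 0).
    apply: central_real => u /c1 /(congr1 (@m21 R)) /=.
    by rewrite qmul0l qmul0r addr0 add0r.
  have r22 : m22 A = qreal (qc (m22 A) 0).
    apply: central_real => u /c1 /(congr1 (@m22 R)) /=.
    by rewrite qmul0l qmul0r !add0r.
  have [h1 h2 h3] := (inSp11P A).1 AS; have [e1 e2 _] := inSp11_dual AS.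
  move: r11 r12 r21 r22 h2 h3 e2.
  set a := qc (m11 A) 0; set b := qc (m12 A) 0; set c := qc (m21 A) 0; set d := qc (m22 A) 0.
  move=> r11 r12 r21 r22; rewrite r11 r12 r21 r22.
  have nr (r : R) : N2 (qreal r : quat R) = r ^+ 2 by rewrite /qreal qnorm2Z qnorm2_1 mulr1.
  rewrite !nr => d2 abcd ad.
  have {}abcd : a * b = c * d.
    have := congr1 (fun x => qc x 0) abcd; rewrite /qreal /qone /qconj /qmul !qcE; lra.
  have d0 : d != 0.
    by apply/eqP => e; move: d2; rewrite e; have := sqr_ge0 b; rewrite expr0n /=; lra.
  (* The relations [a^2 = d^2] and [b^2 < d^2] make [e] a sign and [s] a hyperbolic tangent. *)
  pose e := a / d; pose s := b / d.
  have ee : e ^+ 2 = 1 by rewrite /e expr_div_n ad divff // sqrf_eq0.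
  have he : is_sign e.
    by move/eqP: ee; rewrite sqrf_eq1 => /orP[] /eqP ->; [left|right].
  have hs : s ^+ 2 < 1.
    have dp : 0 < d ^+ 2 by rewrite exprn_even_gt0.
    by rewrite /s expr_div_n ltr_pdivrMr // mul1r d2 ltrDr.
  have [t tE] := tanh_surj hs.
  have aE : a = e * d by rewrite /e divfK.
  have bE : b = s * d by rewrite /s divfK.
  have cE : c = e * s * d.
    by apply: (mulIf d0); rewrite -abcd aE bE; ring.
  exists (qone R), e, t; split; first exact: inSp1_1.
  split=> // p pB; have [X hX hp] := Phi_surj pB.
  have [_ eX] := (Phi_relP _ hX).1 hp.
  have [_] := (Phi_relP _ (inSp11_mul hX AS)).1 (ind X p hX hp).
  rewrite /= r11 r12 r21 r22 !qrealEr -eX.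
  have [_ hx22 _] := (inSp11P X).1 hX.
  have x0 : m22 X != 0.
    by rewrite -qnorm2_gt0 hx22 ltr_wpDr // qnorm2_ge0.
  have w0 := boost_den_neq0 hs pB.
  have bw : boost s p ** (qone R + s *: p) = p + qreal s.
    by rewrite boost_comm // -qmulA qmulVl // qmul1r.
  have -> : b *: (p ** m22 X) + d *: m22 X = d *: ((qone R + s *: p) ** m22 X).
    by rewrite qmulDl qmul1l qmulZl scalerDr scalerA addrC bE mulrC.
  have -> : a *: (p ** m22 X) + c *: m22 X = d *: ((e *: (p + qreal s)) ** m22 X).
    by rewrite qmulZl qmulDl qrealE !scalerDr !scalerA aE cE; congr (_ *: _ + _ *: _); ring.
  rewrite qmulZr => /(scalerI d0); rewrite qmulA => /(qmulIr x0).
  rewrite actE qconj1 qmul1l qmul1r tE => h; apply: (qmulIr w0).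
  by rewrite h qmulZl bw.
Qed.

Lemma action_generated f : action_transformation f ->
  generated (@translation_generator R) f.
Proof.
move=> [u [e [t [hu [he fE]]]]].
have s1 : is_sign (1 : R) by left.
apply: (gen_mul (s := act u 1 0) (g := act (qone R) e t)).
- exact: rotation_generator.
- apply: (gen_mul (s := act (qone R) e t) (g := id)) => //.
    exact: boost_generator.
  by apply: gen_id.
move=> q qB; rewrite fE // act_comp //; last exact: inSp1_1.
by rewrite qmul1r mul1r mulr0 add0r.
Qed.

Lemma generated_action f : generated (@translation_generator R) f ->
  action_transformation f.
Proof.
have s1 : is_sign (1 : R) by left.
have sm (a b : R) : is_sign a -> is_sign b -> is_sign (a * b).
  by case=> -> [] ->; rewrite ?mulrNN ?mulN1r ?mul1r ?mulr1; [left|right|right|left].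
elim=> {f} [f fE|s g f /translation_generator_action hs _ hg fE
           |s s' g f /translation_generator_action hs ss _ hg fE].
- exists (qone R), 1, 0; split; first exact: inSp1_1.
  by split=> // q qB; rewrite act_id fE.
- case: hs => u1 [e1 [t1 [hu1 [he1 sE]]]]; case: hg => u2 [e2 [t2 [hu2 [he2 gE]]]].
  exists (u1 ** u2), (e1 * e2), (e2 * t1 + t2); split; first exact: inSp1_mul.
  split; first exact: sm.
  by move=> q qB; rewrite fE // gE // sE ?act_comp //; exact: act_inB.
- case: hs => u1 [e1 [t1 [hu1 [he1 sE]]]]; case: hg => u2 [e2 [t2 [hu2 [he2 gE]]]].
  have hu1' := inSp1_conj hu1.
  have s'E q : inB q -> s' q = act (qconj u1) e1 (- (e1 * t1)) q.
    move=> qB; have [s'B [h _]] := ss q qB.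
    by rewrite -[in RHS]h sE // act_inv.
  exists (qconj u1 ** u2), (e1 * e2), (e2 * (- (e1 * t1)) + t2); split; first exact: inSp1_mul.
  split; first exact: sm.
  by move=> q qB; rewrite fE // gE // s'E ?act_comp //; exact: act_inB.
Qed.

(** [f] is the action map on the open ball, so its derivatives there are those of the action. *)
Lemma action_orient_pres_isometry f :
  action_transformation f -> orient_pres_isometry_B f.
Proof.
move=> [u [e [t [hu [he fE]]]]].
have [[[aB [as_ [h [hB [hs hh]]]]] ag] aj] := act_orient_pres_isometry t hu he.
have der q v : inB q -> 'D_v f q = 'D_v (act u e t) q.
  move=> qB; apply: near_eq_derive; near=> p.
  by apply: fE; near: p; exact: inB_near.
split; last first.
  move=> q qB; have -> : Defs.jacobian f q = Defs.jacobian (act u e t) q.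
    by apply/matrixP => i j; rewrite !mxE der.
  exact: aj.
split; last by move=> q a b qB; rewrite !der // fE // ag.
split; first by move=> q qB; rewrite fE //; exact: aB.
split; first exact: smooth_of_qrational (act_qrational u e t) fE.
exists h; split=> //; split=> // q qB.
by have [h1 h2] := hh q qB; rewrite !fE //; exact: hB.
Unshelve. all: by end_near. Qed.

End TranslationGroup.

Theorem theorem3p12 (R : realType) :
  (* the formula defines an action of Sp(1) x (Z_2 |x SO_0(1,1)) on B,
     the element (u, eps, H(t)) being encoded by (u, eps, t) *)
  (forall (u : quat R) (eps t : R) (q : quat R),
      inSp1 u -> is_sign eps -> inB q -> inB (act u eps t q)) /\
  (forall q : quat R, inB q -> act (qone R) 1 0 q = q) /\
  (forall (u1 u2 : quat R) (e1 e2 t1 t2 : R) (q : quat R),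
      inSp1 u1 -> is_sign e1 -> inSp1 u2 -> is_sign e2 -> inB q ->
      act u1 e1 t1 (act u2 e2 t2 q) = act (qmul u1 u2) (e1 * e2) (e2 * t1 + t2) q) /\
  (* the transformations given by the action are exactly I^+(B,g) *)
  (forall f : quat R -> quat R,
      orient_pres_isometry_B f <-> action_transformation f) /\
  (* and coincide with the group generated by the maps induced by
     commuting left/right translations of Sp(1,1) *)
  (forall f : quat R -> quat R,
      generated (@translation_generator R) f <-> action_transformation f).

Proof.
split; first by move=> *; exact: act_inB.
split; first by move=> *; exact: act_id.
split; first by move=> *; exact: act_comp.
split=> f; split.
- exact: orient_pres_isometry_action.
- exact: action_orient_pres_isometry.
- exact: generated_action.
- exact: action_generated.
Qed.
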